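(* Let $p=2$, $\alpha=p-1=1$ and $\theta\ge0$. Then the infimum $$B(2,\theta)^{-1}:=\inf_{0\ne u\in W^{1,2}_{1,\theta}(0,\infty)}\frac{\|u'\|^2_{L^2_1(0,\infty)}\cdot\|u\|^2_{L^2_\theta(0,\infty)}}{\|u\|^4_{L^4_\theta(0,\infty)}}$$ is attained by a positive nonincreasing function in $W^{1,2}_{1,\theta}(0,\infty)$. Moreover, $$B(2,\theta)^{-1}<\pi(1+\theta).$$
   Context: For $\beta\ge 0$ put $\omega_\beta=\frac{2\pi^{(1+\beta)/2}}{\Gamma((1+\beta)/2)}$ and $d\lambda_\beta(x)=\omega_\beta x^\beta dx$ on $(0,\infty)$. For $1\le q<\infty$, $\|u\|_{L^q_\beta(0,\infty)}=\left(\int_0^\infty|u|^q\,d\lambda_\beta\right)^{1/q}$, and $L^q_\beta(0,\infty)$ is the space of measurable functions for which this is finite. $W^{1,2}_{1,\theta}(0,\infty)=\{u\in L^2_\theta(0,\infty):\ u'\in L^2_1(0,\infty),\ \lim_{x\to\infty}u(x)=0\}$ (with $u$ locally absolutely continuous, $u'$ its derivative). *)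

(* Defs.v *)
From HB Require Import structures.
From mathcomp Require Import all_boot all_order all_algebra.
From mathcomp Require Import all_classical all_reals all_analysis.
Set Implicit Arguments.
Unset Strict Implicit.
Unset Printing Implicit Defensive.
Import Order.TTheory GRing.Theory Num.Theory.
Import numFieldNormedType.Exports.

Local Open Scope classical_set_scope.
Local Open Scope ring_scope.

(* Functions on (0, oo) are represented by total functions u : R -> R; every
   definition below depends only on the restriction of u to (0, oo). *)

Section weighted_spaces.
Context {R : realType}.
Implicit Types (s beta q theta a b : R) (u : R -> R).

Definition Gamma s : R :=
  \int[@lebesgue_measure R]_(t in `]0, +oo[) (t `^ (s - 1) * expR (- t)).

Definition omega beta : R :=
  2 * pi `^ ((1 + beta) / 2) / Gamma ((1 + beta) / 2).

(* The norm of L^q_beta(0, oo), with d lambda_beta = omega_beta x^beta dx. *)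
Definition wnorm q beta u : \bar R :=
  ((\int[@lebesgue_measure R]_(x in `]0%R, +oo[)
     (`|u x| `^ q * (omega beta * x `^ beta))%:E) `^ q^-1)%E.

Definition wLebesgue q beta u : Prop :=
  measurable_fun (`]0, +oo[ : set R) u /\ (wnorm q beta u < +oo)%E.

Definition abs_continuous a b u : Prop :=
  forall e : R, 0 < e -> exists2 d : R, 0 < d &
    forall (n : nat) (x y : 'I_n -> R),
      (forall i, [/\ a <= x i, x i <= y i & y i <= b]) ->
      trivIset [set: 'I_n] (fun i => `]x i, y i[%classic) ->
      \sum_(i < n) (y i - x i) < d ->
      \sum_(i < n) `|u (y i) - u (x i)| < e.

Definition loc_abs_continuous u : Prop :=
  forall a b, 0 < a -> a < b -> abs_continuous a b u.

(* W^{1,2}_{1,theta}(0, oo). A locally absolutely continuous u is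
   differentiable almost everywhere on (0, oo), so that the pointwise derivative
   derive1 u is the derivative u' up to a null set, where it takes a default value. *)
Definition W12 theta u : Prop :=
  [/\ loc_abs_continuous u,
      wLebesgue 2 theta u,
      wLebesgue 2 1 (derive1 u) &
      u x @[x --> +oo] --> (0 : R)].

Definition nonzero u : Prop := exists2 x : R, 0 < x & u x != 0.

(* For nonzero u in W12 theta the three norms are positive and finite, hence the
   conventions of \bar R for the division play no role. *)
Definition GN_quotient theta u : \bar R :=
  (wnorm 2 1 (derive1 u) ^+ 2 * wnorm 2 theta u ^+ 2 / wnorm 4 theta u ^+ 4)%E.

(* B(2, theta)^{-1} *)
Definition GN_inf theta : \bar R :=
  ereal_inf [set GN_quotient theta u | u in [set u | W12 theta u /\ nonzero u]].

End weighted_spaces.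

(* Main.v *)
Require Import Defs.
From HB Require Import structures.
From mathcomp Require Import all_boot all_order all_algebra.
From mathcomp Require Import all_classical all_reals all_analysis.
From mathcomp Require Import measurable_realfun.
From mathcomp Require Import lra ring.

(** Let D, a and q be the integrals over (0, oo) of u'^2 x, u^2 x^theta and
    u^4 x^theta. The constant omega theta cancels and omega 1 = 2 pi, so that the
    quotient of u is 2 pi D a / q. Put m = 1 + theta. In the variable t = x^m the
    weight m x^theta dx becomes dt, while the form u'^2 x dx keeps its shape and is
    only multiplied by a constant. All values of theta thus reduce to a single
    problem: to maximize the integral of v^4 dt when the integrals of v'^2 t dt
    and of v^2 dt are at most 1. If Q is the maximum, the infimum is 2 pi m / Q.

    The Dirichlet integral is handled through [energy_bound u G M], an inequality
    between increments of u and of a nondecreasing function G <= M, which follows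
    from the Cauchy-Schwarz inequality and mentions no derivative. An element of
    W12 satisfies it with M = D ([abs_continuous_energy]; this uses that locally
    absolutely continuous functions are indefinite integrals). Conversely the
    inequality implies local absolute continuity ([energy_loc_abs_continuous]) and
    D <= M ([energy_dirichlet_le]).

    The nonincreasing rearrangement of u with respect to x^theta dx keeps a and q,
    and does not increase the energy ([rearrangement_energy]): between two levels,
    u descends on an interval of no more mass than the one that separates these
    levels for the rearrangement. So nonincreasing competitors suffice
    ([quartic_weighted_le]). These form a compact set for pointwise convergence,
    and are dominated by a fixed function with integrable fourth power; hence a
    maximizer exists ([quartic_maximizer]). It is positive ([maximizer_gt0]): if it
    vanished from T on, cutting it off with a logarithmic profile slightly before T
    would save more energy than the cutoff costs. Finally, the trial function
    (1 + t)^(-2) shows that Q >= 15/7 > 2 ([quartic_bound_gt2]), so that the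
    infimum is less than pi m. *)

Set Implicit Arguments.
Unset Strict Implicit.
Unset Printing Implicit Defensive.
Import Order.TTheory GRing.Theory Num.Theory.
Import numFieldNormedType.Exports.
Local Open Scope classical_set_scope.
Local Open Scope ring_scope.

(** * Families of separated intervals *)

Section families.
Context {R : realType}.
Implicit Types (a b x y : R) (p q : R * R) (s t : seq (R * R)) (u F : R -> R).

Definition separated p q := (p.2 <= q.1) || (q.2 <= p.1).

(** Lists of intervals, unlike indexed families, can be concatenated, refined
    and cut at a point. *)
Definition family a b s :=
  all (fun p => [&& a <= p.1, p.1 <= p.2 & p.2 <= b]) s && pairwise separated s.

Definition increments F s := \sum_(p <- s) (F p.2 - F p.1).

Definition variation u s := \sum_(p <- s) `|u p.2 - u p.1|.

Lemma separatedC : symmetric separated.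
Proof. by move=> p q; rewrite /separated orbC. Qed.

Lemma allrel_separatedC s t : allrel separated s t = allrel separated t s.
Proof. by rewrite allrelC; apply: eq_allrel => p q; exact: separatedC. Qed.

Lemma family_cat a b s t : family a b (s ++ t) =
  [&& family a b s, family a b t & allrel separated s t].
Proof.
rewrite /family all_cat pairwise_cat.
by do !case: (all _ _); do !case: (pairwise _ _); case: (allrel _ _ _).
Qed.

Lemma family_sub a b s x y : family a b s -> x <= a -> b <= y -> family x y s.
Proof.
move=> /andP[/allP As ps] xa by_; apply/andP; split => //.
apply/allP => p /As /and3P[h1 h2 h3].
by rewrite (le_trans xa h1) h2 (le_trans h3 by_).
Qed.

Lemma family_map (f : R -> R) a b x y s : {homo f : x y / x <= y} ->
  {in [pred z | a <= z <= b], forall z, x <= f z <= y} ->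
  family a b s -> family x y [seq (f p.1, f p.2) | p <- s].
Proof.
move=> fm fab /andP[/allP As ps]; apply/andP; split.
  apply/allP => _ /mapP[p /As /and3P[h1 h2 h3] ->] /=.
  have /andP[-> _] : x <= f p.1 <= y by apply: fab; rewrite inE h1 (le_trans h2).
  have /andP[_ ->] : x <= f p.2 <= y by apply: fab; rewrite inE h3 (le_trans h1).
  by rewrite fm.
rewrite pairwise_map; apply: sub_pairwise ps => p q /orP[h|h]; apply/orP.
  by left; exact: fm.
by right; exact: fm.
Qed.

Lemma family_split_left a b x s : x <= b -> a <= x -> family a b s ->
  family a x [seq (Num.min x p.1, Num.min x p.2) | p <- s].
Proof.
move=> xb ax; apply: family_map => [y z yz|z].
  by rewrite le_min !ge_min lexx yz orbT.
by rewrite inE => /andP[az _]; rewrite le_min ax az ge_min lexx.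
Qed.

Lemma family_split_right a b x s : x <= b -> a <= x -> family a b s ->
  family x b [seq (Num.max x p.1, Num.max x p.2) | p <- s].
Proof.
move=> xb ax; apply: family_map => [y z yz|z].
  by rewrite ge_max !le_max lexx yz orbT.
by rewrite inE => /andP[_ zb]; rewrite ge_max xb zb le_max lexx.
Qed.

(** Taking the minimum or the maximum with x truncates every interval to one side
    of x; intervals that do not contain x have a degenerate piece. *)
Lemma variation_split u x s :
  variation u s <= variation u [seq (Num.min x p.1, Num.min x p.2) | p <- s]
                 + variation u [seq (Num.max x p.1, Num.max x p.2) | p <- s].
Proof.
rewrite /variation !big_map -big_split /=; apply: ler_sum => p _.
have h z : u z = u (Num.min x z) + u (Num.max x z) - u x.
  by case: (leP x z) => _; rewrite ?addrK // addrAC subrr add0r.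
rewrite (h p.2) (h p.1) /=; apply: le_trans (ler_normD _ _).
by rewrite le_eqVlt; apply/orP; left; apply/eqP; congr `|_|; ring.
Qed.

(** Removing one interval [x, y] splits the others into those to the left of x
    and those to the right of y. *)
Lemma increments_le F a b s : {homo F : x y / x <= y} -> a <= b ->
  family a b s -> increments F s <= F b - F a.
Proof.
move=> Fm; have [n] := ubnP (size s).
elim: n s a b => // n IH [|p s] a b /= sn ab; rewrite /increments.
  by rewrite big_nil subr_ge0 Fm.
rewrite big_cons => /andP[/= /andP[/and3P[ap pp pb] As] /andP[sep ps]].
have fs : family a b s by apply/andP.
suff : increments F s <= (F p.1 - F a) + (F b - F p.2).
  by rewrite /increments => h; lra.
pose L := [seq (Num.min p.1 q.1, Num.min p.1 q.2) | q <- s].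
pose M := [seq (Num.max p.2 q.1, Num.max p.2 q.2) | q <- s].
have fL : family a p.1 L by apply: family_split_left fs => //; exact: le_trans pp pb.
have fM : family p.2 b M by apply: family_split_right fs => //; exact: le_trans ap pp.
have hL : increments F L <= F p.1 - F a by apply: IH => //; rewrite size_map.
have hM : increments F M <= F b - F p.2 by apply: IH => //; rewrite size_map.
apply: le_trans (lerD hL hM).
rewrite /increments !big_map -big_split /= !big_seq; apply: ler_sum => q qs /=.
have /and3P[aq qq qb] := allP As _ qs.
have /orP[h|h] := allP sep _ qs.
  have e1 : p.1 <= q.1 := le_trans pp h.
  have e2 : p.1 <= q.2 := le_trans e1 qq.
  have e3 : p.2 <= q.2 := le_trans h qq.
  by rewrite (min_idPl e1) (min_idPl e2) (max_idPr h) (max_idPr e3); lra.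
have e1 : q.1 <= p.1 := le_trans qq h.
have e2 : q.2 <= p.2 := le_trans h pp.
have e3 : q.1 <= p.2 := le_trans e1 pp.
by rewrite (min_idPr e1) (min_idPr h) (max_idPl e2) (max_idPl e3); lra.
Qed.

Lemma abs_continuous_family a b u : abs_continuous a b u ->
  forall e : R, 0 < e -> exists2 d : R, 0 < d & forall s, family a b s ->
    increments id s < d -> variation u s < e.
Proof.
move=> acu e /acu[d d0 H]; exists d => // s /andP[/allP As ps] ls.
have := H (size s) (fun i => (nth (a, a) s i).1) (fun i => (nth (a, a) s i).2).
rewrite /variation (big_nth (a, a)) big_mkord; apply.
- by move=> i; have /and3P[] := As _ (mem_nth (a, a) (ltn_ord i)).
- apply/trivIsetP => i j _ _; move/pairwiseP : ps => ps.
  wlog ij : i j / (i < j)%N.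
    move=> W ne; have [|] := ltnP i j; first by move/W; exact.
    rewrite leq_eqVlt => /orP[/eqP ji|]; last first.
      by move=> /W; rewrite setIC; apply; rewrite eq_sym.
    by case/eqP : ne; exact: val_inj.
  move=> _; rewrite -subset0 => z [] /=; rewrite !in_itv /=.
  move=> /andP[z1 z2] /andP[z3 z4].
  have /orP[h|h] : separated (nth (a, a) s i) (nth (a, a) s j).
    by apply: ps => //; rewrite inE.
  by have := lt_trans (lt_le_trans z2 h) z3; rewrite ltxx.
  by have := lt_trans (lt_le_trans z4 h) z1; rewrite ltxx.
- by move: ls; rewrite /increments (big_nth (a, a)) big_mkord.
Qed.

End families.

(** * The variation function *)

Section variation_function.
Context {R : realType}.
Implicit Types (a b x y : R) (p q : R * R) (s t : seq (R * R)) (u F : R -> R).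

Definition var_fun u a x : R := sup [set variation u s | s in family a x].

Lemma variation_cat u s t : variation u (s ++ t) = variation u s + variation u t.
Proof. by rewrite /variation big_cat. Qed.

Lemma increments_cat F s t :
  increments F (s ++ t) = increments F s + increments F t.
Proof. by rewrite /increments big_cat. Qed.

Variables (u : R -> R) (a b : R).
Hypothesis bounded_var : forall s, family a b s -> variation u s <= 1.

Let has_sup_var x : x <= b -> has_sup [set variation u s | s in family a x].
Proof.
move=> xb; split; first by exists (variation u [::]), [::].
by exists 1 => _ [s fs <-]; apply: bounded_var; exact: family_sub fs _ xb.
Qed.

Lemma var_fun_ge x s : x <= b -> family a x s -> variation u s <= var_fun u a x.
Proof. by move=> xb fs; apply: ub_le_sup; [case: (has_sup_var xb)|exists s]. Qed.

(** A family in [a, y] is cut at x; its part in [a, x] contributes at most the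
    variation up to x. *)
Lemma var_fun_le x y (c : R) : a <= x -> x <= y -> y <= b ->
  (forall s, family x y s -> variation u s <= c) ->
  var_fun u a y - var_fun u a x <= c.
Proof.
move=> ax xy yb H; rewrite lerBlDr; apply: ge_sup; first by case: (has_sup_var yb).
move=> _ [s fs <-]; apply: le_trans (variation_split u x s) _.
rewrite addrC lerD //.
  by apply: H; exact: family_split_right fs.
by apply: var_fun_ge; [exact: le_trans yb | exact: family_split_left fs].
Qed.

Lemma var_fun_increment x y : a <= x -> x <= y -> y <= b ->
  `|u y - u x| <= var_fun u a y - var_fun u a x.
Proof.
move=> ax xy yb; rewrite lerBrDr.
suff : forall s, family a x s -> variation u s <= var_fun u a y - `|u y - u x|.
  move=> H; rewrite addrC -lerBrDr; apply: ge_sup.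
    by case: (has_sup_var (le_trans xy yb)).
  by move=> _ [s fs <-]; exact: H.
move=> s fs; rewrite lerBrDl.
have -> : `|u y - u x| + variation u s = variation u ((x, y) :: s).
  by rewrite /variation big_cons.
apply: var_fun_ge => //; case/andP : (fs) => /allP As ps.
rewrite /family /= ax xy lexx ps /= andbT; apply/andP; split.
  by apply/allP => q /As /and3P[-> -> h] /=; exact: le_trans xy.
by apply/allP => q /As /and3P[_ _ h]; rewrite /separated /= h orbT.
Qed.

(** Up to an arbitrarily small error, the increments of the variation function
    over a family are variations of u over a refinement of the family, which is
    not longer than the family. *)
Lemma var_fun_absolutely_continuous (d e : R) :
  (forall s, family a b s -> increments id s < d -> variation u s <= e) ->
  forall s, family a b s -> increments id s < d ->
    increments (var_fun u a) s <= e.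
Proof.
(* The intervals of s are already refined, those of t are not yet. *)
move=> H; suff G t s : family a b (s ++ t) -> increments id (s ++ t) < d ->
    variation u s + increments (var_fun u a) t <= e.
  by move=> s fs ls; have := G s [::] fs ls; rewrite /variation big_nil add0r.
elim: t s => [|q t IH] s.
  by rewrite /increments big_nil addr0 cats0; exact: H.
move=> fst lst; rewrite -lerBrDl /increments big_cons -lerBrDr.
have fq : family a b [:: q].
  move: fst; rewrite -cat1s !family_cat => /and3P[_ /and3P[//]].
move: (fq); rewrite /family /= !andbT => /and3P[aq qq qb].
apply: var_fun_le => // s' fs'.
rewrite lerBrDr lerBrDr -addrA addrC -addrA.
have fs'ab : family a b s' by exact: family_sub fs' aq qb.
have sepl (w : seq (R * R)) : allrel separated [:: q] w -> allrel separated s' w.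
  rewrite allrel1l => /allP qw; apply/allrelP => z1 z2 z1s /qw.
  case/andP : fs' => /allP /(_ _ z1s) /and3P[h1 h2 h3] _ /orP[h|h].
    by apply/orP; left; exact: le_trans h.
  by apply/orP; right; exact: le_trans h1.
have fss' : family a b ((s ++ s') ++ t).
  move: fst; rewrite -cat1s !family_cat fs'ab.
  move=> /and3P[-> /and3P[_ -> qt]]; rewrite allrel_catr => /andP[sq st] /=.
  rewrite allrel_catl st (sepl _ qt) /= !andbT.
  by rewrite allrel_separatedC sepl // allrel_separatedC.
rewrite addrC -addrA addrC.
have := IH _ fss'; rewrite variation_cat /increments => K.
have K1 : \sum_(p <- (s ++ s') ++ t) (id p.2 - id p.1) < d.
  apply: le_lt_trans lst; rewrite -/(increments id _) -(cat1s q).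
  rewrite !increments_cat -addrA lerD2l lerD2r.
  have := increments_le (fun _ _ => id) qq fs'.
  by rewrite [X in _ -> _ <= X]/increments big_seq1.
by move: (K K1); lra.
Qed.

End variation_function.

(** * Stieltjes measures and null sets *)

Section monotone_density.
Context {R : realType}.
Implicit Types (p q : R * R) (s t : seq (R * R)).
Local Notation leb := (@lebesgue_measure R).

Definition cells s : set R := \big[setU/set0]_(p <- s) `]p.1, p.2]%classic.

Lemma cellsP s z : cells s z <-> exists2 p, p \in s & p.1 < z <= p.2.
Proof.
rewrite /cells; elim: s => [|p s IH]; first by rewrite big_nil; split=> // -[].
rewrite big_cons; split.
  move=> [|/IH[q qs qz]]; last by exists q; rewrite // inE qs orbT.
  by rewrite /= in_itv /= => h; exists p; rewrite // inE eqxx.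
move=> [q]; rewrite inE => /orP[/eqP ->|qs] qz; first by left; rewrite /= in_itv.
by right; apply/IH; exists q.
Qed.

Lemma measurable_cells s : measurable (cells s : set R).
Proof.
by rewrite /cells; apply: bigsetU_measurable => p _; exact: measurable_itv.
Qed.

Lemma measure_cells (mu : {measure set (measurableTypeR R) -> \bar R})
    (F : R -> R) (a b : R) s :
  (forall x y, x <= y -> mu `]x, y]%classic = (F y - F x)%:E) ->
  family a b s -> mu (cells s) = (increments F s)%:E.
Proof.
move=> muF; elim: s => [|p s IH].
  by rewrite /cells /increments !big_nil measure0.
move=> /andP[/= /andP[/and3P[ap pp pb] As] /andP[/allP sep ps]].
rewrite /cells /increments !big_cons measureU //.
- rewrite EFinD; congr (_ + _)%E; first exact: muF.
  by apply: IH; apply/andP.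
- exact: measurable_cells.
- rewrite -subset0 => z [] /=; rewrite in_itv /= => /andP[pz zp].
  move=> /cellsP[q /sep /orP[h|h] /andP[qz zq]].
    by have := lt_le_trans (le_lt_trans h qz) zp; rewrite ltxx.
  by have := lt_le_trans (le_lt_trans h pz) zq; rewrite ltxx.
Qed.

Variables (F : R -> R) (a b : R).
Hypothesis ab : a < b.
Hypothesis acF : forall e : R, 0 < e -> exists2 d : R, 0 < d &
  forall s, family a b s -> increments id s < d -> increments F s <= e.

(** A null set has an open neighbourhood U of small measure. Every point of U in
    (a, b] belongs to a cell contained in U as soon as the grid is fine enough, so
    that the mass of U for nu is controlled by increments of F over families of
    small total length. *)
Lemma absolutely_continuous_null (nu : {measure set (measurableTypeR R) -> \bar R})
    (A : set R) :
  (forall x y, x <= y -> nu `]x, y]%classic = (F y - F x)%:E) ->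
  measurable A -> leb A = 0%E -> nu (A `&` `]a, b]%classic) = 0%E.
Proof.
move=> nuF mA A0.
apply/eqP; rewrite eq_le measure_ge0 andbT; apply/lee_addgt0Pr => e e0.
rewrite add0e; have [d d0 H] := acF e0.
have [|U [oU AU UA]] := @lebesgue_regularity_outer R A d mA _ d0.
  by rewrite [X in (X < _)%E]A0 ltry.
have mU : measurable (U : set R) by exact: open_measurable.
have leU : (leb U < d%:E)%E.
  apply: le_lt_trans UA; rewrite -[in leLHS](setDUK AU).
  rewrite measureU //; last by rewrite setDIK.
    by rewrite [X in (X + _)%E](_ : _ = 0%E) // add0e.
  exact: measurableD.
pose h n : R := (b - a) / n.+1%:R.
have h0 n : 0 < h n by rewrite divr_gt0 ?subr_gt0.
pose c n (k : nat) : R * R := (a + k%:R * h n, a + k.+1%:R * h n).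
pose s n := [seq c n k | k <- iota 0 n.+1 & `[< `](c n k).1, (c n k).2] `<=` U >]].
have fs n : family a b (s n).
  apply/andP; split.
    apply/allP => p /mapP[k]; rewrite mem_filter mem_iota add0n => /and3P[_ _ kn] ->.
    rewrite /c /=; apply/and3P; split.
    - by rewrite lerDl mulr_ge0 // ltW.
    - by rewrite lerD2l ler_pM2r // ler_nat.
    - rewrite -lerBrDl /h mulrCA -[leRHS]mulr1 ler_pM2l ?subr_gt0 //.
      by rewrite ler_pdivrMr // mul1r ler_nat.
  rewrite pairwise_map; apply: (@sub_pairwise _ ltn) => [k l kl|].
    by apply/orP; left; rewrite /c /= lerD2l ler_pM2r // ler_nat.
  by rewrite -(sorted_pairwise ltn_trans) sorted_filter ?iota_ltn_sorted //; exact: ltn_trans.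
have sU n : cells (s n) `<=` U.
  move=> z /cellsP[p /mapP[k]]; rewrite mem_filter => /andP[/asboolP kU _] -> zk.
  by apply: kU; rewrite /= in_itv.
have nus n : (nu (cells (s n)) <= e%:E)%E.
  rewrite (measure_cells nuF (fs n)) lee_fin; apply: H => //.
  rewrite -lte_fin; apply: le_lt_trans leU.
  have lebE x y : x <= y -> leb `]x, y]%classic = (id y - id x)%:E.
    move=> xy; rewrite lebesgue_measure_itv /= lte_fin.
    by case: ltgtP xy => // -> _; rewrite subrr.
  rewrite -(measure_cells lebE (fs n)).
  apply: le_measure; rewrite ?inE //; exact: measurable_cells.
pose K n := \bigcap_(m in [set m | (n <= m)%N]) cells (s m).
have mK n : measurable (K n : set R).
  by apply: bigcap_measurable => [|m _]; [exists n => /= | exact: measurable_cells].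
have mbK : measurable (\bigcup_n K n : set R).
  exact: bigcupT_measurable.
have ndK : nondecreasing_seq K.
  move=> n m nm; apply/subsetPset => z Kz k /= mk; apply: Kz => /=.
  exact: leq_trans mk.
apply: (@le_trans _ _ (nu (\bigcup_n K n))).
  apply: le_measure; rewrite ?inE //.
    by apply: measurableI => //; exact: measurable_itv.
  move=> x [Ax /=]; rewrite in_itv /= => /andP[ax xb].
  have [r /= r0 rU] := (nbhs_ballP _ _).1 (open_nbhs_nbhs (conj oU (AU _ Ax))).
  have [N _ HN] : \forall n \near \oo, h n < r.
    near=> n; rewrite /h ltr_pdivrMr // mulrC -ltr_pdivrMr //.
    apply: lt_le_trans (_ : n%:R <= _); last by rewrite ler_nat.
    by near: n; exact: nbhs_infty_gtr.
  exists N => // n /= /HN hn.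
  have ex : exists j : nat, x <= a + j%:R * h n.
    by exists n.+1; rewrite /h mulrC divfK ?pnatr_eq0 // subrKC.
  have [j xj minj] := ex_minnP ex.
  case: j xj minj => [|j] xj minj.
    by move: xj; rewrite mul0r addr0 leNgt ax.
  have jx : a + j%:R * h n < x.
    by rewrite ltNge; apply/negP => /minj; rewrite ltnn.
  have jn : (j < n.+1)%N.
    by apply: minj; rewrite /h mulrC divfK ?pnatr_eq0 // subrKC.
  apply/cellsP; exists (c n j); last by rewrite /c /= jx.
  apply/mapP; exists j => //; rewrite mem_filter mem_iota add0n jn andbT /=.
  rewrite andbT; apply/asboolP => z; rewrite /c /= in_itv /= => /andP[z1 z2].
  apply: rU; rewrite -ball_normE /= ltr_norml.
  by move: jx xj z1 z2 hn; rewrite -!natr1; lra.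
have cK : nu \o K @ \oo --> nu (\bigcup_n K n) by exact: nondecreasing_cvg_mu.
rewrite -(cvg_lim _ cK) //; apply: lime_le; first by apply/cvg_ex; exists (nu (\bigcup_n K n)).
near=> n; apply: le_trans (nus n); apply: le_measure; rewrite ?inE.
  exact: mK.
  exact: measurable_cells.
by move=> z; apply => /=.
Unshelve. all: by end_near. Qed.

End monotone_density.

(** * Absolutely continuous functions as indefinite integrals *)

Section density.
Context {R : realType}.
Local Notation leb := (@lebesgue_measure R).
Variables (F : R -> R) (a b : R).
Hypothesis ab : a < b.
Hypothesis ndF : {homo F : x y / x <= y}.
Hypothesis acF : forall e : R, 0 < e -> exists2 d : R, 0 < d &
  forall s, family a b s -> increments id s < d -> increments F s <= e.
(* Being constant outside [a, b], F is right continuous on the whole line. *)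
Hypothesis Fclamp : forall x, F x = F (Num.max a (Num.min b x)).

Let rcF : right_continuous F.
Proof.
move=> x; apply/cvgrPdist_le => e e0; have [d d0 H] := acF e0.
near=> y; have xy : x < y by near: y; exact: nbhs_right_gt.
have yd : y < x + d by near: y; apply: nbhs_right_lt; rewrite ltrDl.
pose c z := Num.max a (Num.min b z).
have cab z : a <= c z <= b.
  by rewrite /c le_max lexx ge_max ge_min lexx (ltW ab).
have cm : c x <= c y <= c x + (y - x).
  rewrite /c; case: (leP b x); case: (leP b y); case: (leP a x);
    by case: (leP a y); case: (leP a b) => *; lra.
have /andP[cm1 cm2] := cm; have /andP[ax _] := cab x; have /andP[_ yb] := cab y.
have := H [:: (c x, c y)]; rewrite /family /increments !big_seq1 /= ax cm1 yb.
move=> /(_ isT) K; rewrite distrC ger0_norm ?subr_ge0 ?ndF ?(ltW xy) //.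
rewrite (Fclamp y) (Fclamp x); apply: K; lra.
Unshelve. all: by end_near. Qed.

(** The Stieltjes measure of F is dominated by Lebesgue measure, and its
    Radon-Nikodym derivative is the density g. *)
Lemma monotone_density : exists g : R -> R,
  [/\ forall x, 0 <= g x, leb.-integrable setT (EFin \o g) &
   forall x, a <= x <= b -> F x - F a = \int[leb]_(t in `]a, x]) g t].
Proof.
pose Fc : cumulative R R := HB.pack F (isCumulative.Build R _ R F ndF rcF).
pose LS : {measure set (measurableTypeR R) -> \bar R} :=
  lebesgue_stieltjes_measure Fc.
have LSE x y : x <= y -> LS `]x, y]%classic = (F y - F x)%:E.
  move=> xy; rewrite /LS /= /lebesgue_stieltjes_measure /measure_extension.
  rewrite measurable_mu_extE /=; last exact: is_ocitv.
  by rewrite wlength_itv_bnd.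
have mD : measurable (`]a, b]%classic : set (measurableTypeR R)).
  exact: measurable_itv.
have LSD : (LS `]a, b]%classic < +oo)%E by rewrite LSE ?ltry // ltW.
pose nu : {finite_measure set (measurableTypeR R) -> \bar R} := mfrestr mD LSD.
have numu : nu `<< leb.
  apply/null_content_dominatesP => A mA A0.
  exact: (absolutely_continuous_null ab acF LSE mA A0).
have [f [f0 ff intf nuf]] := radon_nikodym_sigma_finite numu.
exists (fine \o f); split => [x||x /andP[ax xb]].
- by rewrite fine_ge0.
- by rewrite (_ : EFin \o _ = f) //; apply/funext => x /=; rewrite fineK.
- rewrite /Rintegral (eq_integral f) => [|y _]; last by rewrite /= fineK.
  rewrite -nuf; last exact: measurable_itv.
  rewrite /nu /= /mfrestr /mrestr.
  rewrite [X in LS X](_ : _ = `]a, x]%classic) ?LSE //.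
  apply/seteqP; split => [z []|z] //=; rewrite !in_itv /= => /andP[-> zx].
  by rewrite zx (le_trans zx).
Qed.

End density.

Section absolutely_continuous_increment.
Context {R : realType}.
Local Notation leb := (@lebesgue_measure R).

(** On an interval where u has bounded variation V, both V and V - u are
    nondecreasing and absolutely continuous, so u is the indefinite integral of
    an integrable function, which is almost everywhere its derivative. The
    majorant k is chosen later through Young's inequality. *)
Lemma abs_continuous_increment_le (u : R -> R) (a b : R) (k : R -> \bar R) :
  a < b -> abs_continuous a b u ->
  (forall s, family a b s -> variation u s <= 1) ->
  measurable_fun (`]a, b]%classic : set R) k ->
  (forall x, x \in `]a, b[ -> (`|derive1 u x|%:E <= k x)%E) ->
  (forall x, x \in `]a, b] -> (0 <= k x)%E) ->
  (`|u b - u a|%:E <= \int[leb]_(t in `]a, b]) k t)%E.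
Proof.
move=> ab acu var1 mk uk k0.
pose c z := Num.max a (Num.min b z).
have cab z : a <= c z <= b by rewrite /c le_max lexx ge_max ge_min lexx (ltW ab).
have cm : {homo c : x y / x <= y}.
  by move=> x y xy; rewrite /c ge_max !le_max lexx /= le_min !ge_min lexx xy !orbT.
have cid x : a <= x <= b -> c x = x.
  by move=> /andP[ax xb]; rewrite /c (min_idPr xb) (max_idPr ax).
pose V := var_fun u a.
have Vu x y : a <= x -> x <= y -> y <= b -> `|u y - u x| <= V y - V x.
  exact: var_fun_increment.
pose F1 x := V (c x); pose F2 x := V (c x) - u (c x).
have F1E x : a <= x <= b -> F1 x = V x by rewrite /F1 => /cid ->.
have F2E x : a <= x <= b -> F2 x = V x - u x by rewrite /F2 => /cid ->.
have nd1 : {homo F1 : x y / x <= y}.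
  move=> x y /cm; rewrite /F1; move: (cab x) (cab y) => /andP[ax _] /andP[_ yb] xy.
  by rewrite -subr_ge0 (le_trans _ (Vu _ _ ax xy yb)).
have nd2 : {homo F2 : x y / x <= y}.
  move=> x y /cm; rewrite /F2; move: (cab x) (cab y) => /andP[ax _] /andP[_ yb] xy.
  by have := Vu _ _ ax xy yb; move/(le_trans (ler_norm _)); lra.
have acV : forall e : R, 0 < e -> exists2 d : R, 0 < d &
    forall s, family a b s -> increments id s < d -> increments V s <= e.
  move=> e e0; have [d d0 H] := abs_continuous_family acu e0; exists d => //.
  apply: var_fun_absolutely_continuous => // s fs ls; exact/ltW/H.
have ac1 : forall e : R, 0 < e -> exists2 d : R, 0 < d &
    forall s, family a b s -> increments id s < d -> increments F1 s <= e.
  move=> e /acV[d d0 H]; exists d => // s fs ls.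
  have -> : increments F1 s = increments V s; last exact: H.
  rewrite /increments !big_seq; apply: eq_bigr => p ps.
  case/andP : fs => /allP /(_ _ ps) /and3P[ap pp pb] _.
  by rewrite !F1E ?ap ?pb ?(le_trans pp) ?(le_trans ap).
have ac2 : forall e : R, 0 < e -> exists2 d : R, 0 < d &
    forall s, family a b s -> increments id s < d -> increments F2 s <= e.
  move=> e e0; have e2 : 0 < e / 2 by rewrite divr_gt0.
  have [d1 d10 H1] := acV _ e2.
  have [d2 d20 H2] := abs_continuous_family acu e2.
  exists (Num.min d1 d2) => [|s fs]; first by rewrite lt_min d10.
  rewrite lt_min => /andP[/(H1 _ fs) h1 /(H2 _ fs) h2].
  apply: (@le_trans _ _ (increments V s + variation u s)); last by lra.
  rewrite /increments /variation -big_split /= !big_seq; apply: ler_sum => p ps.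
  case/andP : fs => /allP /(_ _ ps) /and3P[ap pp pb] _.
  rewrite !F2E ?ap ?pb ?(le_trans pp) ?(le_trans ap) //.
  by have := ler_norm (u p.1 - u p.2); rewrite distrC; lra.
have cc x : c x = c (c x) by rewrite [in RHS]cid.
have [g1 [g10 ig1 Fg1]] := monotone_density ab nd1 ac1 (fun x => congr1 V (cc x)).
have [g2 [g20 ig2 Fg2]] := monotone_density ab nd2 ac2
  (fun x => congr1 (fun y => V y - u y) (cc x)).
have sub (x : R) : `]a, x]%classic `<=` [set: R] by [].
have mI (x : R) : measurable (`]a, x]%classic : set R) by exact: measurable_itv.
have i1 (x : R) : leb.-integrable `]a, x] (EFin \o g1).
  by apply: integrableS ig1.
have i2 (x : R) : leb.-integrable `]a, x] (EFin \o g2).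
  by apply: integrableS ig2.
have d1 := FTC1 (a := BRight a) i1 (open_integrable_locally openT ig1).
have d2 := FTC1 (a := BRight a) i2 (open_integrable_locally openT ig2).
have ae_g : {ae leb, forall x, x \in `]a, b[ -> derive1 u x = g1 x - g2 x}.
  move: d1 d2; apply: filterS2; first exact: (ae_filter_ringOfSetsType leb).
  move=> x /= h1 h2; rewrite in_itv /= => /andP[ax xb].
  have [dG1 G1x] := h1 ax; have [dG2 G2x] := h2 ax.
  have near_u : {near x, (fun y => (\int[leb]_(t in `]a, y]) g1 t) -
       (\int[leb]_(t in `]a, y]) g2 t) + u a) =1 u}.
    near=> y; have yab : a <= y <= b.
      apply/andP; split; apply/ltW; near: y; [exact: lt_nbhsr|exact: lt_nbhsl].
    have aab : a <= a <= b by rewrite lexx ltW.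
    by rewrite -Fg1 // -Fg2 // !F1E // !F2E //; ring.
  have du : is_derive x 1 u (g1 x - g2 x).
    apply: near_eq_is_derive near_u _.
    rewrite -[g1 x - g2 x]addr0 -G1x -G2x !derive1E.
    by apply: is_deriveD; apply: is_deriveB; exact/derivableP.
  by rewrite derive1E; apply: derive_val.
have -> : u b - u a = \int[leb]_(t in `]a, b]) (g1 t - g2 t).
  rewrite RintegralB // -Fg1 ?lexx ?ltW // -Fg2 ?lexx ?ltW //.
  by rewrite !F1E ?F2E ?lexx ?ltW //; ring.
have ig : leb.-integrable `]a, b] (EFin \o (fun t => g1 t - g2 t)).
  by rewrite (_ : EFin \o _ = (EFin \o g1) \- (EFin \o g2))%E //; exact: integrableB.
apply: (@le_trans _ _ (\int[leb]_(t in `]a, b]) `|g1 t - g2 t|%:E)%E).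
  apply: le_trans (_ : (`|\int[leb]_(t in `]a, b]) (g1 t - g2 t)%:E|)%E <= _)%E.
    by rewrite /Rintegral -[leRHS]fineK ?abse_fin_num ?fine_abse //; exact: integrable_fin_num.
  by apply: le_abse_integral => //; case/integrableP: ig.
apply: ae_ge0_le_integral => //.
- apply/measurable_EFinP; apply: measurableT_comp => //.
  by case/integrableP : ig => /measurable_EFinP.
- have : {ae leb, forall x : R, x <> b}.
    exists [set b]; split => //; first exact: lebesgue_measure_set1.
    by move=> x /= /contrapT.
  move: ae_g; apply: filterS2; first exact: (ae_filter_ringOfSetsType leb).
  move=> x /= xE xb; rewrite in_itv /= => /andP[ax xlb].
  have xab : x \in `]a, b[ by rewrite in_itv /= ax lt_neqAle xlb andbT; apply/eqP.
  by rewrite -xE // uk.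
Unshelve. all: by end_near. Qed.

End absolutely_continuous_increment.

(** * The fundamental theorem of calculus on a half-line *)

Section fundamental_theorem.
Context {R : realType}.
Local Notation leb := (@lebesgue_measure R).
Variables (f F : R -> R).
Hypothesis dF : forall x : R, 0 < x -> is_derive x 1 F (f x).
Hypothesis cf : forall x : R, 0 < x -> {for x, continuous f}.

Lemma FTC_oc (a b : R) : 0 < a -> a <= b ->
  (\int[leb]_(x in `]a, b]) (f x)%:E = (F b - F a)%:E)%E.
Proof.
move=> a0; rewrite le_eqVlt => /predU1P[->|ab].
  by rewrite set_itvoc0 integral_set0 subrr.
have pos x : a <= x -> 0 < x by exact: lt_le_trans.
have mf : measurable_fun (`]a, b]%classic : set R) (EFin \o f).
  apply/measurable_EFinP; apply: (measurable_funS (measurable_itv `]0%R, +oo[)).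
    by move=> x /=; rewrite !in_itv /= andbT => /andP[/ltW/pos].
  apply: open_continuous_measurable_fun => // x; rewrite inE /= in_itv /= andbT.
  exact: cf.
rewrite integral_itv_obnd_cbnd // EFinB; apply: continuous_FTC2 => //.
- apply: continuous_in_subspaceT => x; rewrite inE /= in_itv /= => /andP[/pos + _].
  exact: cf.
- have cF x : a <= x -> F z @[z --> x] --> F x.
    by move=> /pos /dF[/derivable1_diffP/differentiable_continuous].
  split => [x||]; first by rewrite in_itv /= => /andP[/ltW/pos/dF[]].
    by apply: cvg_at_right_filter; exact: cF.
  by apply: cvg_at_left_filter; apply: cF; exact: ltW.
- move=> x; rewrite in_itv /= => /andP[/ltW/pos/dF Dx _].
  by rewrite derive1E; apply: derive_val.
Qed.

Hypothesis f0 : forall x, 0 < x -> 0 <= f x.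

(** Monotone convergence along intervals that are compact in (0, oo), on which
    the fundamental theorem of calculus applies. *)
Lemma FTC_exhaust (D : set R) (a_ b_ : R^nat) (L : R) :
  (forall n, 0 < a_ n) -> (forall n, a_ n <= b_ n) ->
  {homo a_ : n m / (n <= m)%N >-> m <= n} ->
  {homo b_ : n m / (n <= m)%N >-> n <= m} ->
  \bigcup_n `]a_ n, b_ n]%classic = D ->
  F (b_ n) - F (a_ n) @[n --> \oo] --> L ->
  (\int[leb]_(x in D) (f x)%:E = L%:E)%E.
Proof.
move=> a0 ab nda ndb <- FL.
pose I n : set R := `]a_ n, b_ n]%classic.
have Ipos n x : I n x -> 0 < x.
  by rewrite /I /= in_itv /= => /andP[+ _]; exact: lt_trans.
have ndI : nondecreasing_seq I.
  move=> n m nm; apply/subsetPset => x; rewrite /I /= !in_itv /= => /andP[h1 h2].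
  by rewrite (le_lt_trans (nda _ _ nm)) // (le_trans h2 (ndb _ _ nm)).
have mI n : measurable (I n) by exact: measurable_itv.
have mf n : measurable_fun (I n) (EFin \o f).
  apply/measurable_EFinP; apply: (measurable_funS (measurable_itv `]0%R, +oo[)).
    by move=> x /Ipos; rewrite /= in_itv /= andbT.
  apply: open_continuous_measurable_fun => // x; rewrite inE /= in_itv /= andbT.
  exact: cf.
have f0I n x : I n x -> (0 <= (f x)%:E)%E by move=> /Ipos /f0; rewrite lee_fin.
have c : (\int[leb]_(x in I n) (f x)%:E)%E @[n --> \oo] -->
    (\int[leb]_(x in \bigcup_n I n) (f x)%:E)%E.
  exact: ge0_nondecreasing_set_cvg_integral.
rewrite -(cvg_lim _ c) //; apply/cvg_lim => //.
under eq_cvg => n do rewrite /I FTC_oc //.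
apply: cvg_EFin => //; exact: nearW.
Qed.

Lemma FTC_0c (b l : R) : 0 < b -> F x @[x --> 0^'+] --> l ->
  (\int[leb]_(x in `]0%R, b]) (f x)%:E = (F b - l)%:E)%E.
Proof.
move=> b0 Fl; apply: (@FTC_exhaust _ (fun n => b / n.+1%:R) (fun _ => b)) => //.
- by move=> n; rewrite divr_gt0.
- by move=> n; rewrite ler_pdivrMr // ler_pMr // ler1n.
- by move=> n m nm; rewrite ler_pM2l // lef_pV2 ?posrE // ler_nat.
- apply/seteqP; split => x /=.
    move=> [n _] /=; rewrite !in_itv /= => /andP[h ->]; rewrite andbT.
    by apply: lt_trans h; rewrite divr_gt0.
  rewrite in_itv /= => /andP[x0 xb].
  exists (Num.truncn (b / x)) => //=; rewrite in_itv /= xb andbT.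
  rewrite ltr_pdivrMr // mulrC -ltr_pdivrMr //.
  exact: truncnS_gt.
- apply: cvgB; first exact: cvg_cst.
  apply: (cvg_at_rightP _ _ _).1 Fl _ _; split => [n|]; first by rewrite divr_gt0.
  rewrite -[X in _ --> X](mulr0 b); apply: cvgM; first exact: cvg_cst.
  exact: cvg_harmonic.
Qed.

Lemma FTC_0y (l L : R) : F x @[x --> 0^'+] --> l -> F x @[x --> +oo] --> L ->
  (\int[leb]_(x in `]0%R, +oo[) (f x)%:E = (L - l)%:E)%E.
Proof.
move=> Fl FL; apply: (@FTC_exhaust _ (fun n => n.+1%:R^-1) (fun n => n.+1%:R)) => //.
- by move=> n; rewrite (le_trans _ (_ : 1 <= _)) ?invf_le1 ?ler1n.
- by move=> n m nm; rewrite lef_pV2 ?posrE // ler_nat.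
- by move=> n m nm; rewrite ler_nat.
- apply/seteqP; split => x /=.
    move=> [n _] /=; rewrite !in_itv /= => /andP[h _]; rewrite andbT.
    by apply: lt_trans h; rewrite invr_gt0.
  rewrite in_itv /= andbT => x0.
  exists (maxn (Num.truncn x^-1) (Num.truncn x)) => //=; rewrite in_itv /=.
  apply/andP; split; last first.
    apply: le_trans (ltW (truncnS_gt x)) _.
    by rewrite ler_nat ltnS leq_maxr.
  rewrite -[ltRHS]invrK ltf_pV2 ?posrE ?invr_gt0 //.
  apply: lt_le_trans (truncnS_gt x^-1) _.
  by rewrite ler_nat ltnS leq_maxl.
- apply: cvgB.
    apply: (cvg_pinftyP _ _).1 FL _ _; apply/cvgryPge => r.
    near=> n; apply: le_trans (_ : n%:R <= _); last by rewrite ler_nat.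
    by near: n; exact: nbhs_infty_ger.
  apply: (cvg_at_rightP _ _ _).1 Fl _ _; split => [n|]; first by rewrite invr_gt0.
  exact: cvg_harmonic.
Unshelve. all: by end_near. Qed.

End fundamental_theorem.

(** * Energy bounds *)

Section energy.
Context {R : realType}.
Local Notation leb := (@lebesgue_measure R).
Implicit Types (u G : R -> R) (M : R).

(** The model for G x is the integral of u'(s) ^ 2 s over s in (0, x); the last
    condition is then the Cauchy-Schwarz inequality for the integral u y - u x of
    u'. As no derivative occurs, the condition passes to pointwise limits and to
    rearrangements. *)
Definition energy_bound u G M : Prop :=
  [/\ forall x : R, 0 < x -> 0 <= G x <= M,
      forall x y : R, 0 < x -> x <= y -> G x <= G y &
      forall x y : R, 0 < x -> x <= y ->
        (u y - u x) ^+ 2 <= (ln y - ln x) * (G y - G x)].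

(** The quadratic l^2 B - 2 l A + C is nonnegative for l > 0 if and only if its
    discriminant is nonpositive. *)
Lemma sqr_le_mul_of_young (A B C : R) : 0 <= A -> 0 <= B -> 0 <= C ->
  (forall l : R, 0 < l -> 2 * A <= l * B + C / l) -> A ^+ 2 <= B * C.
Proof.
move=> A0 B0 C0 H; have [->|An0] := eqVneq A 0; first by rewrite expr0n mulr_ge0.
have Ap : 0 < A by rewrite lt0r An0.
have [B00|Bn0] := eqVneq B 0.
  have l0 : 0 < C / A + 1 by rewrite ltr_wpDl // divr_ge0.
  have := H _ l0; rewrite B00 mulr0 add0r mul0r ler_pdivlMr // => h.
  have e : A * (C / A) = C by rewrite mulrC divfK.
  by nra.
have Bp : 0 < B by rewrite lt0r Bn0.
have := H _ (divr_gt0 Ap Bp); rewrite divfK //.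
have -> : C / (A / B) = C * B / A by rewrite invf_div mulrA.
move=> h; have : A <= C * B / A by lra.
by rewrite ler_pdivlMr // expr2 (mulrC B).
Qed.

Lemma young_of_sqr_le_mul (A B C l : R) : 0 <= A -> 0 <= B -> 0 <= C -> 0 < l ->
  A ^+ 2 <= B * C -> 2 * A <= l * B + C / l.
Proof.
move=> A0 B0 C0 l0 H.
have e : C = l * (C / l) by rewrite mulrC divfK // gt_eqF.
have c0 : 0 <= C / l by rewrite divr_ge0 // ltW.
set c := C / l in e c0 *; rewrite e in H.
have lB0 : 0 <= l * B by rewrite mulr_ge0 // ltW.
have L0 : 0 <= 2 * A by lra.
have R0 : 0 <= l * B + c by lra.
rewrite -(@ler_pXn2r _ 2) ?nnegrE //.
by have := sqr_ge0 (l * B - c); nra.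
Qed.

Lemma ln_mono (x y : R) : 0 < x -> x <= y -> ln x <= ln y.
Proof. by move=> x0 xy; rewrite ler_ln ?posrE // (lt_le_trans x0). Qed.

(** Unlike the Cauchy-Schwarz inequality, its Young form is additive in the
    interval, so that short intervals suffice. *)
Lemma le_increment_of_local (u H : R -> R) (a b d : R) : 0 < d ->
  (forall x y, a <= x -> x <= y -> y <= b -> y - x < d ->
    `|u y - u x| <= H y - H x) ->
  forall x y, a <= x -> x <= y -> y <= b -> `|u y - u x| <= H y - H x.
Proof.
move=> d0 loc x y ax xy yb.
have [n] : exists n : nat, y - x < n.+1%:R * (d / 2).
  exists (Num.truncn ((y - x) / (d / 2))); rewrite -ltr_pdivrMr ?divr_gt0 //.
  exact: truncnS_gt.
elim: n x ax xy => [|n IH] x ax xy h.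
  by apply: loc => //; move: h; rewrite mul1r; lra.
have [yx|yx] := ltP (y - x) d; first exact: loc.
have h1 : `|u (x + d / 2) - u x| <= H (x + d / 2) - H x by apply: loc; lra.
have h2 : `|u y - u (x + d / 2)| <= H y - H (x + d / 2).
  by apply: IH; [lra|lra|move: h; rewrite -natr1 mulrDl mul1r; lra].
have -> : u y - u x = (u y - u (x + d / 2)) + (u (x + d / 2) - u x) by ring.
by apply: le_trans (ler_normD _ _) _; lra.
Qed.

Lemma integral_inv_oc (a b : R) : 0 < a -> a <= b ->
  (\int[leb]_(x in `]a, b]) (x^-1)%:E = (ln b - ln a)%:E)%E.
Proof.
move=> a0 ab; apply: FTC_oc => // x x0.
by apply: inv_continuous; rewrite gt_eqF.
Qed.

(** By Young's inequality |u'| <= (l / x + u' ^ 2 x / l) / 2 for all l > 0. This is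
    integrated over intervals so short that u has variation at most 1 on them, and
    l is optimised at the end. *)
Lemma abs_continuous_energy u (D : R) : loc_abs_continuous u ->
  measurable_fun (`]0, +oo[%classic : set R) (derive1 u) ->
  (\int[leb]_(x in `]0%R, +oo[) (derive1 u x ^+ 2 * x)%:E = D%:E)%E ->
  exists G, energy_bound u G D.
Proof.
move=> acu mu iD.
pose k (x : R) : \bar R := (derive1 u x ^+ 2 * x)%:E.
have mk : measurable_fun (`]0, +oo[%classic : set R) k.
  apply/measurable_EFinP; apply: measurable_funM => //.
  exact: measurable_funX.
have k0 x : `]0, +oo[%classic x -> (0 <= k x)%E.
  by rewrite /= in_itv /= andbT => /ltW x0; rewrite lee_fin mulr_ge0 ?sqr_ge0.
have sub0 (a b : R) : 0 <= a -> `]a, b]%classic `<=` `]0, +oo[%classic.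
  by move=> a0 x /=; rewrite !in_itv /= andbT => /andP[ax _]; exact: le_lt_trans ax.
have mks (a b : R) : 0 <= a -> measurable_fun (`]a, b]%classic : set R) k.
  by move=> a0; apply: (measurable_funS (measurable_itv `]0%R, +oo[)) mk; exact: sub0.
have k0s (a b : R) : 0 <= a -> forall x, `]a, b]%classic x -> (0 <= k x)%E.
  by move=> a0 x /sub0 - /(_ a0) /k0.
have fin (a b : R) : 0 <= a -> (\int[leb]_(x in `]a, b]) k x)%E \is a fin_num.
  move=> a0; rewrite ge0_fin_numE; last by apply: integral_ge0; exact: k0s.
  apply: le_lt_trans (_ : (D%:E < _)%E); last exact: ltry.
  rewrite -iD; apply: ge0_subset_integral => //; exact: sub0.
pose G (x : R) : R := fine (\int[leb]_(t in `]0%R, x]) k t)%E.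
have GB (a b : R) : 0 < a -> a <= b ->
    (\int[leb]_(t in `]a, b]) k t)%E = (G b - G a)%:E.
  move=> a0 ab; rewrite /G EFinB !fineK ?fin //.
  have e : `]0, b]%classic = `]0, a]%classic `|` `]a, b]%classic :> set R.
    by rewrite -itv_bndbnd_setU // bnd_simp // ltW.
  rewrite [X in (_ = X - _)%E](_ : _ = \int[leb]_(x in `]0%R, a]) k x +
      \int[leb]_(x in `]a, b]) k x)%E.
    by rewrite [X in (_ = X - _)%E]addeC addeK // fin.
  rewrite e ge0_integral_setU //=.
  - by rewrite -e; exact: mks.
  - by move=> x [] h; [apply: (k0s 0 a)|apply: (k0s a b)]; rewrite ?(ltW a0).
  - apply/disj_setPLR => x /=; rewrite !in_itv /= => /andP[_ xa].
    by apply/negP; rewrite negb_and -leNgt xa.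
have Gm (x y : R) : 0 < x -> x <= y -> G x <= G y.
  move=> x0 xy; rewrite -subr_ge0 -lee_fin -GB //.
  by apply: integral_ge0; apply: k0s; exact: ltW.
exists G; split => // [x x0|x y x0 xy].
  rewrite fine_ge0 /=; last by apply: integral_ge0; exact: k0s.
  rewrite -lee_fin fineK ?fin // -iD; apply: ge0_subset_integral => //; exact: sub0.
rewrite -real_normK ?num_real //; apply: sqr_le_mul_of_young => //.
- by rewrite subr_ge0 ln_mono.
- by rewrite subr_ge0 Gm.
move=> l l0.
pose H z := (l * ln z + G z / l) / 2.
suff : `|u y - u x| <= H y - H x by rewrite /H; lra.
have [xey|xy'] := leP y x.
  by rewrite (le_anti (introT andP (conj xey xy))) !subrr normr0.
have acxy := acu _ _ x0 xy'.
have [d d0 Hd] := abs_continuous_family acxy ltr01.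
apply: (@le_increment_of_local u H x y d) => // a b xa ab by_ abd.
have a0 : 0 < a by exact: lt_le_trans xa.
move: ab; rewrite le_eqVlt => /predU1P[->|ab]; first by rewrite !subrr normr0.
rewrite -lee_fin.
pose j (t : R) : \bar R := (((l / 2) * t^-1)%:E + ((2 * l)^-1)%:E * k t)%E.
have jE : (\int[leb]_(t in `]a, b]) j t = (H b - H a)%:E)%E.
  rewrite /j ge0_integralD //=; last 4 first.
  - move=> t; rewrite in_itv /= => /andP[at_ _]; rewrite lee_fin mulr_ge0 //.
      by rewrite divr_ge0 // ltW.
    by rewrite invr_ge0 ltW // (lt_trans a0).
  - apply/measurable_EFinP; apply: measurable_funM => //.
    apply: (measurable_funS (measurable_itv `]0%R, +oo[)).
      by apply: sub0; exact: ltW.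
    apply: open_continuous_measurable_fun => // t; rewrite inE /= in_itv /= andbT => t0.
    by apply: inv_continuous; rewrite gt_eqF.
  - move=> t tab; apply: mule_ge0; last exact: (k0s a b (ltW a0) t tab).
    by rewrite lee_fin invr_ge0 mulr_ge0 // ltW.
  - apply: emeasurable_funM => //; apply: mks; exact: ltW.
  under eq_integral do rewrite EFinM.
  rewrite ge0_integralZl //=; last 3 first.
  - apply/measurable_EFinP.
    apply: (measurable_funS (measurable_itv `]0%R, +oo[)).
      by apply: sub0; exact: ltW.
    apply: open_continuous_measurable_fun => // t; rewrite inE /= in_itv /= andbT => t0.
    by apply: inv_continuous; rewrite gt_eqF.
  - move=> t; rewrite in_itv /= => /andP[at_ _]; rewrite lee_fin.
    by rewrite invr_ge0 ltW // (lt_trans a0).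
  - by rewrite lee_fin divr_ge0 // ltW.
  rewrite ge0_integralZl //=; last 3 first.
  - by apply: mks; exact: ltW.
  - exact: (k0s a b (ltW a0)).
  - by rewrite lee_fin invr_ge0 mulr_ge0 // ltW.
  rewrite integral_inv_oc ?GB ?ltW // -!EFinM -EFinD /H; congr EFin.
  by field; rewrite gt_eqF.
rewrite -jE; apply: abs_continuous_increment_le => //.
- move=> e /acxy[d' d'0 H']; exists d' => // n z w zw; apply: H' => i.
  by have [h1 h2 h3] := zw i; split => //; [exact: le_trans h1|exact: le_trans by_].
- move=> s fs; apply: ltW; apply: Hd; first exact: family_sub fs xa by_.
  apply: le_lt_trans abd.
  exact: (increments_le (fun _ _ => id) (ltW ab) fs).
- apply: emeasurable_funD; last by apply: emeasurable_funM => //; apply: mks; exact: ltW.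
  apply/measurable_EFinP; apply: measurable_funM => //.
  apply: (measurable_funS (measurable_itv `]0%R, +oo[)).
    by apply: sub0; exact: ltW.
  apply: open_continuous_measurable_fun => // t; rewrite inE /= in_itv /= andbT => t0.
  by apply: inv_continuous; rewrite gt_eqF.
- move=> t; rewrite in_itv /= => /andP[at_ _].
  have t0 : 0 < t := lt_trans a0 at_.
  rewrite /j /k -EFinM -EFinD lee_fin.
  have := @young_of_sqr_le_mul `|derive1 u t| t^-1 (derive1 u t ^+ 2 * t) l.
  rewrite invr_ge0 (ltW t0) mulr_ge0 ?sqr_ge0 ?(ltW t0) //.
  rewrite real_normK ?num_real // mulrCA mulVf ?gt_eqF // mulr1 lexx invfM.
  move=> /(_ (normr_ge0 _) isT isT l0 isT).
  set A := `|_|; set B := derive1 u t ^+ 2 * t; rewrite mulrC => h.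
  by move: h; rewrite !(mulrC (l / 2)); lra.
- move=> t; rewrite in_itv /= => tab; rewrite /j adde_ge0 //.
    rewrite lee_fin mulr_ge0 ?divr_ge0 ?(ltW l0) //.
    by case/andP : tab => at_ _; rewrite invr_ge0 ltW // (lt_trans a0).
  apply: mule_ge0; first by rewrite lee_fin invr_ge0 mulr_ge0 // ltW.
  by apply: (k0s a b (ltW a0)); rewrite /= in_itv.
Qed.

End energy.

(** * The layer-cake formula *)

Section layer_cake.
Context {R : realType}.
Local Notation leb := (@lebesgue_measure R).
Local Notation pos := (`]0, +oo[%classic : set R).
Implicit Types (f g w : R -> R).

(** The distribution function of f. The measure enters through its density w, so
    that functions can be compared for different weights. *)
Definition level_mass w f (y : R) : \bar R :=
  (\int[leb]_(x in `]0%R, +oo[ `&` [set x | (y < f x)%R]) (w x)%:E)%E.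

(** Tonelli's theorem on the region under the graph of f. *)
Let layer_cakeT f w : measurable_fun setT f -> measurable_fun setT w ->
  (forall x, 0 <= f x) -> (forall x, 0 <= w x) ->
  (\int[leb]_x (f x * w x)%:E =
   \int[leb]_(y in `]0%R, +oo[) \int[leb]_(x in [set x | (y < f x)%R]) (w x)%:E)%E.
Proof.
move=> mf mw f0 w0.
pose h (p : R * R) : \bar R := (\1_[set q : R * R | 0 < q.2 < f q.1] p * w p.1)%:E.
have mA : measurable [set q : measurableTypeR R * measurableTypeR R | 0 < q.2 < f q.1].
  rewrite (_ : [set _ | _] = (fun q => 0 < q.2) @^-1` [set true] `&`
     (fun q => q.2 < f q.1) @^-1` [set true]); last first.
    by apply/seteqP; split => q /= => [/andP[-> ->]|[-> ->]].
  apply: measurableI; rewrite -[X in measurable X]setTI.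
    exact: measurable_fun_ltr.
  apply: measurable_fun_ltr => //.
  exact: (measurableT_comp mf measurable_fst).
have mh : measurable_fun [set: measurableTypeR R * measurableTypeR R] h.
  apply/measurable_EFinP; apply: measurable_funM; first exact: measurable_indic.
  exact: (measurableT_comp mw measurable_fst).
have h0 p : (0 <= h p)%E by rewrite lee_fin mulr_ge0.
have hE x y : h (x, y) = ((w x)%:E * (\1_`]0, f x[ y)%:E)%E.
  by rewrite /h !indicE -EFinM mulrC; congr (_ * _)%:E.
have hx x : (\int[leb]_y h (x, y) = (f x * w x)%:E)%E.
  under eq_integral do rewrite hE.
  rewrite ge0_integralZl //=; last 2 first.
  - apply/measurable_EFinP; exact: measurable_indic.
  - by rewrite lee_fin.
  rewrite integral_indic //= setIT (_ : leb _ = if 0 < f x then (f x)%:E else 0%E); last first.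
    by rewrite lebesgue_measure_itv /= lte_fin; case: ifP => // _; rewrite sube0.
  have := f0 x; rewrite le_eqVlt => /predU1P[<-|->].
    by rewrite ltxx mul0r mule0.
  by rewrite -EFinM mulrC.
transitivity (\int[leb]_x \int[leb]_y h (x, y))%E.
  by apply: eq_integral => x _; rewrite hx.
transitivity (\int[leb]_y \int[leb]_x h (x, y))%E; first exact: fubini_tonelli.
rewrite [RHS]integral_mkcond; apply: eq_integral => y _.
rewrite patchE; case: ifPn; rewrite ?inE ?notin_setE /= in_itv /= andbT => y0.
  rewrite [RHS]integral_mkcond; apply: eq_integral => x _.
  rewrite hE patchE indicE; case: ifPn; rewrite ?inE ?notin_setE /= => yf.
    by rewrite mem_set /= ?in_itv /= ?y0 ?yf // mule1.
  by rewrite memNset ?mule0 //= in_itv /= y0 /=.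
apply: integral0_eq => x _; rewrite hE indicE memNset ?mule0 //= in_itv /=.
by move=> /andP[].
Qed.

Lemma layer_cake f w : measurable_fun pos f -> measurable_fun pos w ->
  (forall x, 0 < x -> 0 <= f x) -> (forall x, 0 < x -> 0 <= w x) ->
  (\int[leb]_(x in `]0%R, +oo[) (f x * w x)%:E =
   \int[leb]_(y in `]0%R, +oo[) level_mass w f y)%E.
Proof.
move=> mf mw f0 w0.
have mpos : measurable pos by exact: measurable_itv.
have ge0 g : (forall x, 0 < x -> 0 <= g x) -> forall x, 0 <= (g \_ pos) x.
  move=> g0 x; rewrite patchE; case: ifPn => //; rewrite inE /= in_itv /= andbT.
  exact: g0.
have mr g : measurable_fun pos g -> measurable_fun setT (g \_ pos).
  by move=> mg; apply/(measurable_restrictT _ _).1.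
rewrite [LHS]integral_mkcond.
transitivity (\int[leb]_x ((f \_ pos) x * (w \_ pos) x)%:E)%E.
  apply: eq_integral => x _; rewrite !patchE; case: ifPn => //.
  by rewrite mul0r.
rewrite (layer_cakeT (mr _ mf) (mr _ mw) (ge0 _ f0) (ge0 _ w0)).
apply: eq_integral => y; rewrite inE /= in_itv /= andbT => y0.
rewrite /level_mass (_ : [set x | _] = pos `&` [set x | y < f x]).
  by apply: eq_integral => x; rewrite inE patchE => -[xp _]; rewrite mem_set.
apply/seteqP; split => [x|x [xp] /=]; last by rewrite patchE mem_set.
rewrite /= patchE; case: ifPn; first by rewrite inE.
by rewrite ltNge ltW.
Qed.

(** The superlevel sets of a power of f are superlevel sets of f, so that by the
    layer-cake formula the distribution function determines all moments. *)
Lemma eq_level_mass_integral w w' f g : measurable_fun pos f ->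
  measurable_fun pos g -> measurable_fun pos w -> measurable_fun pos w' ->
  (forall x, 0 < x -> 0 <= f x) -> (forall x, 0 < x -> 0 <= g x) ->
  (forall x, 0 < x -> 0 <= w x) -> (forall x, 0 < x -> 0 <= w' x) ->
  (forall y, 0 < y -> level_mass w f y = level_mass w' g y) ->
  forall n, (\int[leb]_(x in `]0%R, +oo[) (f x ^+ n.+1 * w x)%:E =
             \int[leb]_(x in `]0%R, +oo[) (g x ^+ n.+1 * w' x)%:E)%E.
Proof.
move=> mf mg mw mw' f0 g0 w0 w'0 E n.
rewrite layer_cake ?layer_cake //; try exact: measurable_funX.
- apply: eq_integral => y; rewrite inE /= in_itv /= andbT => y0.
  have pE h z : 0 <= h z -> (y < h z ^+ n.+1) = (y `^ n.+1%:R^-1 < h z).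
    move=> h0; have e : y = (y `^ n.+1%:R^-1) ^+ n.+1.
      rewrite -powR_mulrn ?powR_ge0 // -powRrM mulVf ?pnatr_eq0 //.
      by rewrite powRr1 // ltW.
    by rewrite {1}e ltr_pXn2r ?nnegrE ?powR_ge0.
  have lE h v : (forall x, 0 < x -> 0 <= h x) ->
      level_mass v (fun x => h x ^+ n.+1) y = level_mass v h (y `^ n.+1%:R^-1).
    move=> h0; rewrite /level_mass; congr integral; apply/seteqP.
    by split => x [] /=; rewrite in_itv /= andbT => x0; rewrite pE ?h0.
  by rewrite lE // lE // E // powR_gt0.
- by move=> x x0; rewrite exprn_ge0 // g0.
- by move=> x x0; rewrite exprn_ge0 // f0.
Qed.

End layer_cake.

(** * Continuity and crossing points *)

Section crossings.
Context {R : realType}.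
Implicit Types (u G : R -> R).
Local Notation pos := (`]0, +oo[%classic : set R).

Lemma measurable_fun_pos u : (forall x : R, 0 < x -> {for x, continuous u}) ->
  measurable_fun pos u.
Proof.
move=> cu; apply: open_continuous_measurable_fun => // x.
by rewrite inE /= in_itv /= andbT; exact: cu.
Qed.

(** A bound on the energy makes u Hoelder continuous of order 1/2 in ln x. *)
Lemma energy_continuous u G M : energy_bound u G M ->
  forall x : R, 0 < x -> {for x, continuous u}.
Proof.
move=> [GM Gm uG] x x0; apply/cvgrPdist_le => e e0.
have M0 : 0 <= M by have /andP[] := GM _ x0; exact: le_trans.
have d0 : 0 < e ^+ 2 / (M + 1) by rewrite divr_gt0 ?exprn_gt0 // ltr_wpDl.
have /cvgrPdist_lt /(_ _ d0) lnx := continuous_ln x0.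
near=> y; have y0 : 0 < y by near: y; exact: lt_nbhsr.
have ly : `|ln x - ln y| < e ^+ 2 / (M + 1) by near: y; exact: lnx.
rewrite -(@ler_pXn2r _ 2) ?nnegrE ?(ltW e0) // real_normK ?num_real //.
have K : (u x - u y) ^+ 2 <= `|ln x - ln y| * M.
  have [xy|yx] := leP x y.
    have := uG _ _ x0 xy; rewrite -sqrrN opprB => h; apply: le_trans h _.
    have := ln_mono x0 xy; rewrite distrC => l; rewrite ger0_norm ?subr_ge0 //.
    apply: ler_wpM2l; rewrite ?subr_ge0 //.
    by have /andP[gx _] := GM _ x0; have /andP[_ gy] := GM _ y0; lra.
  have := uG _ _ y0 (ltW yx) => h; apply: le_trans h _.
  have l := ln_mono y0 (ltW yx); rewrite ger0_norm ?subr_ge0 //.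
  apply: ler_wpM2l; rewrite ?subr_ge0 //.
  by have /andP[gx _] := GM _ y0; have /andP[_ gy] := GM _ x0; lra.
apply: le_trans K _; move: ly; rewrite ltr_pdivlMr ?ltr_wpDl // => ly.
by have := normr_ge0 (ln x - ln y); lra.
Unshelve. all: by end_near. Qed.

Variable u : R -> R.
Hypothesis cu : forall x : R, 0 < x -> {for x, continuous u}.

Let near_lt x c : 0 < x -> u x < c ->
  exists2 d : R, 0 < d & forall y, x - d < y < x + d -> u y < c.
Proof.
move=> x0 uc; have h := cu x0.
have [d /= d0 H] := h _ (lt_nbhsl uc); exists d => // y yd; apply: H => /=.
by rewrite ltr_norml; lra.
Qed.

Let near_gt x c : 0 < x -> c < u x ->
  exists2 d : R, 0 < d & forall y, x - d < y < x + d -> c < u y.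
Proof.
move=> x0 uc; have h := cu x0.
have [d /= d0 H] := h _ (lt_nbhsr uc); exists d => // y yd; apply: H => /=.
by rewrite ltr_norml; lra.
Qed.

Lemma last_crossing x0 c : 0 < x0 -> c <= u x0 ->
  (\forall x \near +oo, u x < c) ->
  exists s, [/\ x0 <= s, u s = c & forall x, s < x -> u x < c].
Proof.
move=> x00 ux0 [N [_ uN]]; pose S := [set x | 0 < x /\ c <= u x].
have SN : ubound S N.
  by move=> x [_ cx]; rewrite leNgt; apply/negP => /uN; rewrite ltNge cx.
have Sx0 : S x0 by [].
have hS : has_sup S by split; [exists x0 | exists N].
have sx0 : x0 <= sup S by apply: ub_le_sup => //; exists N.
have s0 : 0 < sup S by exact: lt_le_trans sx0.
exists (sup S); split => [//||x sx]; last first.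
  rewrite ltNge; apply/negP => cx; have : x <= sup S.
    by apply: ub_le_sup; [exists N | split => //; exact: lt_trans sx].
  by rewrite leNgt sx.
apply/eqP; rewrite eq_le; apply/andP; split; rewrite leNgt; apply/negP.
  move=> /(near_gt s0)[d d0 H].
  have : sup S + d / 2 <= sup S.
    apply: ub_le_sup; first by exists N.
    by split; [lra | apply/ltW/H; lra].
  by lra.
move=> /(near_lt s0)[d d0 H].
have [x Sx sx] := sup_adherent d0 hS.
have xs : x <= sup S by apply: ub_le_sup => //; exists N.
by case: Sx => _; rewrite leNgt H //; lra.
Qed.

Lemma first_crossing s x1 c : 0 < s -> c < u s -> s <= x1 -> u x1 <= c ->
  exists b, [/\ s < b, u b = c & forall x, s < x -> x < b -> c < u x].
Proof.
move=> s0 us sx1 ux1; pose S := [set x | s <= x /\ u x <= c].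
have Ss : lbound S s by move=> x [].
have hS : has_inf S by split; [exists x1 | exists s].
have sS : s <= inf S by apply: lb_le_inf => //; exists x1.
have i0 : 0 < inf S by exact: lt_le_trans sS.
have out x : s <= x -> x < inf S -> c < u x.
  move=> sx xi; rewrite ltNge; apply/negP => ux.
  have : inf S <= x by apply: ge_inf => //; exists s.
  by rewrite leNgt xi.
have uc : u (inf S) <= c.
  rewrite leNgt; apply/negP => /(near_gt i0)[d d0 H].
  have [x Sx sx] := inf_adherent d0 hS.
  have xs : inf S <= x by apply: ge_inf => //; exists s.
  by case: Sx => _; rewrite leNgt H //; lra.
have sb : s < inf S.
  by rewrite lt_neqAle sS andbT; apply: contraTneq uc => <-; rewrite -ltNge.
exists (inf S); split => // [|x sx]; last by apply: out; exact: ltW.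
apply/eqP; rewrite eq_le uc /= leNgt; apply/negP => /(near_lt i0)[d d0 H].
have := out (Num.max s (inf S - d / 2)); rewrite le_max lexx gt_max sb /=.
have -> : inf S - d / 2 < inf S by lra.
move=> /(_ isT isT); rewrite ltNge ltW // H //.
by rewrite gt_max lt_max; apply/andP; split; [apply/orP; right|]; lra.
Qed.

End crossings.

(** * Rearrangement *)

Section rearrangement.
Context {R : realType}.
Local Notation leb := (@lebesgue_measure R).
Local Notation pos := (`]0, +oo[%classic : set R).
Variables (u w : R -> R).
Hypothesis cu : forall x : R, 0 < x -> {for x, continuous u}.
Hypothesis u0 : forall x : R, 0 < x -> 0 <= u x.
Hypothesis mw : measurable_fun pos w.
Hypothesis w0 : forall x : R, 0 < x -> 0 <= w x.
Hypothesis int_u : (\int[leb]_(x in `]0%R, +oo[) (u x ^+ 2 * w x)%:E < +oo)%E.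

Let mu_ := level_mass w u.

Let mpos : measurable pos. Proof. exact: measurable_itv. Qed.

Let measurable_level y : measurable (pos `&` [set x | y < u x]).
Proof.
rewrite (_ : _ `&` _ = pos `&` u @^-1` `]y, +oo[%classic).
  exact: (measurable_fun_pos cu mpos (measurable_itv `]y, +oo[)).
apply/seteqP; split => x [xp /= yu]; split => //=; last first.
  by move: yu; rewrite in_itv /= andbT.
by rewrite in_itv /= yu.
Qed.

Let measurable_fun_w (A : set R) : A `<=` pos -> measurable_fun A (EFin \o w).
Proof.
by move=> Ap; apply/measurable_EFinP; apply: measurable_funS mw.
Qed.

Let w0E x : pos x -> (0 <= (w x)%:E)%E.
Proof. by rewrite /= in_itv /= andbT lee_fin => /w0. Qed.

Lemma level_mass_nonincreasing y z : y <= z -> (mu_ z <= mu_ y)%E.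
Proof.
move=> yz; apply: ge0_subset_integral => //; try exact: measurable_level.
- by apply: measurable_fun_w => x [].
- by move=> x [/w0E].
- by move=> x [xp /= zu]; split => //=; exact: le_lt_trans yz zu.
Qed.

(** Markov's inequality, which makes the level masses finite. *)
Lemma level_mass_markov y : 0 < y ->
  ((y ^+ 2)%:E * mu_ y <=
   \int[leb]_(x in `]0%R, +oo[) (u x ^+ 2 * w x)%:E)%E.
Proof.
move=> y0; rewrite /mu_ /level_mass -ge0_integralZl //; last 4 first.
- exact: measurable_level.
- by apply: measurable_fun_w => x [].
- by move=> x [/w0E].
- by rewrite lee_fin sqr_ge0.
have mu2 : measurable_fun pos (fun x => (u x ^+ 2 * w x)%:E).
  apply/measurable_EFinP; apply: measurable_funM => //.
  by apply: measurable_funX; exact: measurable_fun_pos.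
have u2 x : pos x -> (0 <= (u x ^+ 2 * w x)%:E)%E.
  by move=> /w0E; rewrite !lee_fin => ?; rewrite mulr_ge0 ?sqr_ge0.
apply: (@le_trans _ _ (\int[leb]_(x in pos `&` [set x | (y < u x)%R])
    (u x ^+ 2 * w x)%:E)%E); last first.
  by apply: ge0_subset_integral => //; exact: measurable_level.
apply: ge0_le_integral => //; first exact: measurable_level.
- by move=> x [/w0E h _]; rewrite mule_ge0 // lee_fin sqr_ge0.
- by apply: emeasurable_funM => //; apply: measurable_fun_w => x [].
- by apply: measurable_funS mu2 => // x [].
- move=> x [xp /= yu]; rewrite -EFinM lee_fin ler_wpM2r //.
    by have := w0E xp; rewrite lee_fin.
  by rewrite ler_pXn2r ?nnegrE ?(ltW y0) ?(ltW yu) // (le_trans (ltW y0)) // ltW.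
Qed.

Let mu_ge0 y : (0 <= mu_ y)%E.
Proof. by apply: integral_ge0 => x [/w0E]. Qed.

Let mu_fin y : 0 < y -> mu_ y \is a fin_num.
Proof.
move=> y0; rewrite ge0_fin_numE //.
have := le_lt_trans (level_mass_markov y0) int_u.
have : (0 <= mu_ y)%E by [].
case: (mu_ y) => [r _ _||]; rewrite ?ltry //.
by move=> _; rewrite gt0_muley ?ltxx // lte_fin exprn_gt0.
Qed.

(** The superlevel sets for the levels y + 1/n exhaust the one for y: the
    distribution function is right continuous. *)
Lemma level_mass_right_lt y t : (t%:E < mu_ y)%E ->
  exists2 z, y < z & (t%:E < mu_ z)%E.
Proof.
move=> tmu; pose E (n : nat) := pos `&` [set x | y + n.+1%:R^-1 < u x].
have EU : \bigcup_n E n = pos `&` [set x | y < u x].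
  apply/seteqP; split => x.
    by move=> [n _ [xp /= h]]; split => //=; apply: lt_trans h; rewrite ltrDl invr_gt0.
  move=> [xp /= yu]; have d0 : 0 < u x - y by rewrite subr_gt0.
  exists (Num.truncn (u x - y)^-1) => //; split => //=.
  rewrite -ltrBrDl -[ltRHS]invrK ltf_pV2 ?posrE ?invr_gt0 //.
  exact: truncnS_gt.
have ndE : nondecreasing_seq E.
  move=> n m nm; apply/subsetPset => x [xp /= h]; split => //=.
  by apply: le_lt_trans h; rewrite lerD2l lef_pV2 ?posrE // ler_nat.
have c : (\int[leb]_(x in E n) (w x)%:E)%E @[n --> \oo] -->
    (\int[leb]_(x in \bigcup_n E n) (w x)%:E)%E.
  apply: ge0_nondecreasing_set_cvg_integral => // [n|n|n x [/w0E//]].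
    exact: measurable_level.
  by apply: measurable_fun_w => x [].
rewrite EU in c.
have [[n Hn]|H] := pselect (exists n, t%:E < \int[leb]_(x in E n) (w x)%:E)%E.
  by exists (y + n.+1%:R^-1); first by rewrite ltrDl invr_gt0.
move: tmu; rewrite ltNge => /negP[]; rewrite /mu_ /level_mass -(cvg_lim _ c) //.
apply: lime_le; first by apply/cvg_ex; eexists; exact: c.
by apply: nearW => n; rewrite leNgt; apply/negP => h; apply: H; exists n.
Qed.

(** The nonincreasing rearrangement with respect to the measure of density w. *)
Definition rearrangement (t : R) : R :=
  sup [set y | 0 <= y /\ (t%:E < level_mass w u y)%E].

Lemma rearrangement_gt y t : 0 <= y -> 0 < t ->
  (y < rearrangement t) = (t%:E < mu_ y)%E.
Proof.
move=> y0 t0; pose S := [set y | 0 <= y /\ (t%:E < mu_ y)%E].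
have ubS : has_ubound S.
  pose a := (\int[leb]_(x in `]0%R, +oo[) (u x ^+ 2 * w x)%:E)%E.
  have aoo : (a < +oo)%E := int_u.
  have a0 : (0 <= a)%E.
    by apply: integral_ge0 => x /w0E; rewrite !lee_fin => ?; rewrite mulr_ge0 ?sqr_ge0.
  exists (fine a / t + 1) => z [z0 tz].
  have [z1|z1] := leP z 1; first by rewrite (le_trans z1) // lerDr divr_ge0 ?fine_ge0 // ltW.
  have zp : 0 < z by exact: lt_trans z1.
  apply: le_trans (_ : z ^+ 2 <= _); first by rewrite expr2 ler_peMl // ltW.
  apply: le_trans (_ : fine a / t <= _); last by rewrite lerDl.
  rewrite ler_pdivlMr // -lee_fin fineK ?ge0_fin_numE //.
  apply: le_trans (level_mass_markov zp).
  by rewrite EFinM lee_pmul2l ?lte_fin ?exprn_gt0 // ltW.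
apply/idP/idP => [yv|tmu].
  have S0 : S !=set0.
    apply/set0P/negP => /eqP S0; move: yv; rewrite /rearrangement.
    by rewrite (_ : [set _ | _] = set0) // sup0 ltNge y0.
  have [z [z0 tz] yz] := sup_gt S0 yv.
  by apply: lt_le_trans tz _; apply: level_mass_nonincreasing; exact: ltW.
have [z yz tz] := level_mass_right_lt tmu.
apply: (lt_le_trans yz); apply: ub_le_sup => //.
by split => //; rewrite (le_trans y0) // ltW.
Qed.

Lemma rearrangement_ge0 t : 0 <= rearrangement t.
Proof.
rewrite /rearrangement; set S := [set _ | _].
have [->|/set0P[y Sy]] := eqVneq S set0; first by rewrite sup0.
have [hS|hS] := pselect (has_ubound S); last by rewrite sup_out // => -[].
by apply: le_trans (ub_le_sup hS Sy); case: Sy.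
Qed.

Lemma rearrangement_nonincreasing s t : 0 < s -> s <= t ->
  rearrangement t <= rearrangement s.
Proof.
move=> s0 st; have t0 : 0 < t by exact: lt_le_trans st.
rewrite leNgt; apply/negP => h.
have := h; rewrite rearrangement_gt ?rearrangement_ge0 // => tm.
have : (s%:E < mu_ (rearrangement s))%E by apply: le_lt_trans tm; rewrite lee_fin.
by rewrite -rearrangement_gt ?rearrangement_ge0 // ltxx.
Qed.

Lemma level_mass_rearrangement y : 0 < y ->
  level_mass (fun=> 1) rearrangement y = mu_ y.
Proof.
move=> y0; rewrite /level_mass.
rewrite (_ : _ `&` _ = `]0, fine (mu_ y)[%classic); last first.
  apply/seteqP; split => t; rewrite /= !in_itv /= andbT.
    move=> [t0]; rewrite t0 rearrangement_gt ?(ltW y0) //=.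
    by rewrite -[X in (_ < X)%E]fineK ?mu_fin // lte_fin.
  move=> /andP[t0 tm]; split => //; rewrite rearrangement_gt ?(ltW y0) //.
  by rewrite -[X in (_ < X)%E]fineK ?mu_fin // lte_fin.
rewrite integral_cst //= mul1e.
rewrite lebesgue_measure_itv /= lte_fin; case: ifP => [_|/negbT].
  by rewrite sube0 fineK // mu_fin.
rewrite -leNgt => h; rewrite -[RHS]fineK ?mu_fin //; congr EFin.
by apply/eqP; rewrite eq_le h fine_ge0.
Qed.

Variables (G : R -> R) (M k m : R).
Hypothesis uG : energy_bound u G M.
Hypothesis u_oo : u x @[x --> +oo] --> (0 : R).
Hypotheses (k0 : 0 < k) (m0 : 0 < m).
Hypothesis int_w : forall x, 0 < x ->
  (\int[leb]_(t in `]0%R, x]) (w t)%:E = (k * x `^ m)%:E)%E.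

Let v := rearrangement.

(** The energy that u has spent when it takes a value at least v t for the last
    time; divided by m, it serves for the rearrangement. *)
Let H (t : R) : R := sup [set G x | x in [set x | 0 < x /\ v t <= u x]].

Let has_sup_H t x : 0 < x -> v t <= u x ->
  has_sup [set G x | x in [set x | 0 < x /\ v t <= u x]].
Proof.
move=> x0 vx; split; first by exists (G x), x.
by exists M => _ [z [z0 _] <-]; case: uG => /(_ z z0)/andP[].
Qed.

Let H_ge0 t : 0 <= H t.
Proof.
rewrite /H; set S := [set _ | _ in _].
have [->|/set0P[z [x [x0 vx] _]]] := eqVneq S set0; first by rewrite sup0.
apply: (@le_trans _ _ (G x)); first by case: uG => /(_ x x0)/andP[].
by apply: ub_le_sup; [case: (has_sup_H x0 vx) | exists x].
Qed.

Let M0 : 0 <= M.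
Proof. by case: uG => /(_ 1 ltr01)/andP[+ +] _ _; exact: le_trans. Qed.

Let H_le t c : 0 <= c -> (forall x, 0 < x -> v t <= u x -> G x <= c) -> H t <= c.
Proof.
move=> c0 Hc; rewrite /H; set S := [set _ | _ in _].
have [->|/set0P S0] := eqVneq S set0; first by rewrite sup0.
by apply: ge_sup => // _ [x [x0 vx] <-]; exact: Hc.
Qed.

Let H_ge t x : 0 < x -> v t <= u x -> G x <= H t.
Proof. by move=> x0 vx; apply: ub_le_sup; [case: (has_sup_H x0 vx) | exists x]. Qed.

Let near_u c : 0 < c -> \forall x \near +oo, u x < c.
Proof.
move=> c0; have /cvgrPdist_lt /(_ _ c0) := u_oo; apply: filterS => x.
by rewrite sub0r normrN; apply: le_lt_trans; exact: ler_norm.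
Qed.

(** After taking the value y1 for the last time, u descends to y2 on ]s, b[. This
    interval has mass at most t - t', and the mass of ]0, s] is at least t'. As the
    mass of ]0, x] is k x ^ m, this gives m ln (b / s) <= ln (t / t'). *)
Let energy_step t t' y1 y2 : 0 < t' -> t' <= t ->
  v t < y2 -> y2 < y1 -> y1 < v t' ->
  (y1 - y2) ^+ 2 <= (ln t - ln t') * ((H t - H t') / m).
Proof.
move=> t'0 t't vy2 y21 y1v; have t0 : 0 < t := lt_le_trans t'0 t't.
have y20 : 0 < y2 := le_lt_trans (rearrangement_ge0 t) vy2.
have y10 : 0 < y1 := lt_trans y20 y21.
have mu1 : (t'%:E < mu_ y1)%E by rewrite -rearrangement_gt ?(ltW y10).
have mu2 : (mu_ y2 <= t%:E)%E.
  by rewrite leNgt -rearrangement_gt ?(ltW y20) // -leNgt ltW.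
have [x0 [x00 x0u]] : exists x0, 0 < x0 /\ y1 < u x0.
  apply: contrapT => N; move: mu1; rewrite /mu_ /level_mass.
  rewrite (_ : _ `&` _ = set0) ?integral_set0 ?lte_fin ?ltNge ?(ltW t'0) //.
  apply/seteqP; split => // x [/=]; rewrite in_itv /= andbT => xp xu.
  by apply: N; exists x.
have [s [x0s us slast]] := last_crossing cu x00 (ltW x0u) (near_u y10).
have s0 : 0 < s := lt_le_trans x00 x0s.
have [x1 [sx1 ux1]] : exists x1, s <= x1 /\ u x1 <= y2.
  have [N [_ HN]] := near_u y20; exists (Num.max s (N + 1)); split.
    by rewrite le_max lexx.
  by apply/ltW/HN; rewrite lt_max ltrDl ltr01 orbT.
have us2 : y2 < u s by rewrite us.
have [b [sb ub bfirst]] := first_crossing cu s0 us2 sx1 ux1.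
have b0 : 0 < b := lt_trans s0 sb.
have sm0 : 0 < s `^ m by rewrite powR_gt0.
have mass1 : t' <= k * s `^ m.
  rewrite -lee_fin -int_w //; apply: le_trans (ltW mu1) _.
  apply: ge0_subset_integral => //; first exact: measurable_level.
  - by apply: measurable_fun_w => x /=; rewrite !in_itv /= andbT => /andP[].
  - by move=> x /=; rewrite in_itv /= => /andP[x_gt _]; rewrite lee_fin w0.
  - move=> x [/=]; rewrite !in_itv /= andbT => -> /= xu.
    by rewrite leNgt; apply/negP => /slast; rewrite ltNge ltW.
have mass2 : t' + (k * b `^ m - k * s `^ m) <= t.
  have sbpos : `]s, b]%classic `<=` pos.
    by move=> x /=; rewrite !in_itv /= andbT => /andP[/(lt_trans s0)].
  have e1 : (\int[leb]_(x in `]s, b[) (w x)%:E = (k * b `^ m - k * s `^ m)%:E)%E.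
    rewrite integral_itv_bndo_bndc; last first.
      apply: measurable_fun_w => x /=; rewrite !in_itv /= andbT.
      by move=> /andP[/(lt_trans s0)].
    have e : `]0, b]%classic = `]0, s]%classic `|` `]s, b]%classic :> set R.
      by rewrite -itv_bndbnd_setU // bnd_simp // ltW.
    have := int_w b0; rewrite e ge0_integral_setU //=; first last.
    - apply/disj_setPLR => x /=; rewrite !in_itv /= => /andP[_ xa].
      by apply/negP; rewrite negb_and -leNgt xa.
    - move=> x [] /=; rewrite in_itv /= => /andP[h _]; rewrite lee_fin w0 //.
      exact: lt_trans h.
    - rewrite -e; apply: measurable_fun_w => x /=.
      by rewrite !in_itv /= andbT => /andP[].
    by rewrite int_w // EFinB => <-; rewrite [X in (_ = X - _)%E]addeC addeK.
  rewrite -lee_fin EFinD -e1; apply: le_trans mu2.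
  apply: le_trans (leeD (ltW mu1) (lexx _)) _.
  rewrite /mu_ /level_mass -ge0_integral_setU //=; first last.
  - apply/disj_setPLR => x [_ /= xu] /=; apply/negP; rewrite in_itv /=.
    by apply/negP => /andP[/slast]; rewrite ltNge ltW.
  - move=> x [[/w0E//]|] /=; rewrite in_itv /= => /andP[h _]; rewrite lee_fin w0 //.
    exact: lt_trans h.
  - apply: measurable_fun_w => x [[]//|] /=; rewrite !in_itv /= andbT.
    by move=> /andP[/(lt_trans s0)].
  - exact: measurable_level.
  apply: ge0_subset_integral => //.
  - by apply: measurableU => //; exact: measurable_level.
  - exact: measurable_level.
  - by apply: measurable_fun_w => x [].
  - by move=> x [/w0E].
  - move=> x [[xp /= xu]|/=]; first by split => //=; exact: lt_trans xu.
    rewrite in_itv /= => /andP[sx xb]; split => /=; last exact: bfirst.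
    by rewrite in_itv /= andbT (lt_trans s0).
have lnm : m * (ln b - ln s) <= ln t - ln t'.
  have bm0 : 0 < b `^ m by rewrite powR_gt0.
  have K : b `^ m * t' <= t * s `^ m.
    rewrite -(ler_pM2l k0); nra.
  have := ln_mono (mulr_gt0 bm0 t'0) K.
  by rewrite !lnM ?posrE // !ln_powR; lra.
have Gs : H t' <= G s.
  apply: H_le => [|x xp vx]; first by case: uG => /(_ s s0)/andP[].
  case: uG => _ Gm _; apply: Gm => //; rewrite leNgt; apply/negP => /slast.
  by rewrite ltNge (le_trans _ vx) // ltW.
have Gb : G b <= H t by apply: H_ge => //; rewrite ub ltW.
case: uG => _ Gm /(_ s b s0 (ltW sb)); rewrite ub us -sqrrN opprB => E.
apply: le_trans E _; rewrite mulrA ler_pdivlMr // mulrAC.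
have GsGb := Gm _ _ s0 (ltW sb); have lsb := ln_mono s0 (ltW sb).
apply: (@le_trans _ _ ((ln t - ln t') * (G b - G s))).
  by apply: ler_wpM2r; [rewrite subr_ge0 | rewrite mulrC].
by apply: ler_wpM2l; [rewrite subr_ge0 ln_mono | lra].
Qed.

(** A Polya-Szego inequality: [energy_step] is applied to levels that tend to v t'
    and v t. *)
Lemma rearrangement_energy : exists G', energy_bound v G' (M / m).
Proof.
exists (fun t => H t / m).
have Hm t' t : 0 < t' -> t' <= t -> H t' <= H t.
  move=> t'0 t't; apply: H_le => // x x0 vx; apply: H_ge => //.
  by apply: le_trans vx; exact: rearrangement_nonincreasing.
split => [t t0|t' t t'0 t't|t' t t'0 t't].
- rewrite divr_ge0 ?(ltW m0) //= ler_pM2r ?invr_gt0 //; apply: H_le => // x x0 _.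
  by case: uG => /(_ x x0)/andP[].
- by rewrite ler_pM2r ?invr_gt0 // Hm.
rewrite -mulrBl; set c := _ * _.
have c0 : 0 <= c.
  by rewrite mulr_ge0 ?divr_ge0 ?subr_ge0 ?ln_mono ?Hm // ltW.
have vm : v t <= v t' := rearrangement_nonincreasing t'0 t't.
rewrite -sqrrN opprB -[leRHS]sqr_sqrtr // ler_pXn2r ?nnegrE ?subr_ge0 //.
apply/ler_addgt0Pr => e e0.
have [h|h] := leP (v t' - v t) e.
  by apply: le_trans h _; rewrite lerDr sqrtr_ge0.
pose y1 := v t' - e / 3; pose y2 := v t + e / 3.
have := @energy_step t t' y1 y2 t'0 t't.
rewrite /y1 /y2 => /(_ _ _ _) K.
have {}K : (v t' - e / 3 - (v t + e / 3)) ^+ 2 <= c by apply: K; lra.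
have : v t' - e / 3 - (v t + e / 3) <= Num.sqrt c.
  by rewrite -(@ler_pXn2r _ 2) ?nnegrE ?sqrtr_ge0 ?sqr_sqrtr //; lra.
by lra.
Qed.

Lemma rearrangement_integral n :
  (\int[leb]_(t in `]0%R, +oo[) (v t ^+ n.+1)%:E =
   \int[leb]_(x in `]0%R, +oo[) (u x ^+ n.+1 * w x)%:E)%E.
Proof.
have [G' vG'] := rearrangement_energy.
rewrite (@eq_level_mass_integral _ w (fun=> 1) u v) //.
- by apply: eq_integral => t _; rewrite mulr1.
- exact: measurable_fun_pos.
- by apply: measurable_fun_pos; exact: energy_continuous vG'.
- by move=> x _; exact: rearrangement_ge0.
- by move=> y y0; rewrite level_mass_rearrangement.
Qed.

End rearrangement.

(** * An integrable majorant *)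

Section dominating_function.
Context {R : realType}.
Local Notation leb := (@lebesgue_measure R).
Local Notation pos := (`]0, +oo[%classic : set R).

Lemma energy_holder (u G : R -> R) M x y : energy_bound u G M -> 0 < x -> 0 < y ->
  (u x - u y) ^+ 2 <= M * `|ln x - ln y|.
Proof.
move=> [GM Gm uG]; wlog xy : x y / x <= y.
  move=> W x0 y0; have [xy|/ltW yx] := leP x y; first exact: W.
  by rewrite -sqrrN opprB distrC; exact: W.
move=> x0 y0; rewrite -sqrrN opprB distrC ger0_norm ?subr_ge0 ?ln_mono //.
apply: le_trans (uG _ _ x0 xy) _; rewrite mulrC; apply: ler_wpM2r.
  by rewrite subr_ge0 ln_mono.
by have /andP[gx _] := GM _ x0; have /andP[_ gy] := GM _ y0; lra.
Qed.

(** The derivative of sqrt t / (1 + sqrt t): integrable, of order t^(-1/2) at 0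
    and t^(-3/2) at infinity. *)
Definition dominating (t : R) : R := (2 * Num.sqrt t * (1 + Num.sqrt t) ^+ 2)^-1.

Lemma dominating_ge0 t : 0 <= dominating t.
Proof. by rewrite invr_ge0 !mulr_ge0 ?sqrtr_ge0 ?sqr_ge0. Qed.

Lemma dominating_continuous (x : R) : 0 < x -> {for x, continuous dominating}.
Proof.
move=> x0; have s0 : 0 < Num.sqrt x by rewrite sqrtr_gt0.
apply: cvgV; first by rewrite mulf_neq0 ?mulf_neq0 ?expf_neq0 ?gt_eqF // ltr_wpDl.
apply: cvgM; first by apply: cvgM; [exact: cvg_cst|exact: sqrt_continuous].
have c1 : (1 + Num.sqrt z) @[z --> x] --> 1 + Num.sqrt x.
  by apply: cvgD; [exact: cvg_cst|exact: sqrt_continuous].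
by under eq_fun do rewrite expr2; rewrite expr2; exact: cvgM.
Qed.

Lemma integral_dominating :
  (\int[leb]_(t in `]0%R, +oo[) (dominating t)%:E = 1%:E)%E.
Proof.
pose F (t : R) : R := - (1 + Num.sqrt t)^-1.
have dF (x : R) : 0 < x -> is_derive x 1 F (dominating x).
  move=> x0; have s0 : 0 < Num.sqrt x by rewrite sqrtr_gt0.
  have d := is_derive1_sqrt x0.
  have n0 : 1 + Num.sqrt x != 0 by rewrite gt_eqF // ltr_wpDl.
  have dS : is_derive x 1 (fun t => 1 + Num.sqrt t) (0 + (2 * Num.sqrt x)^-1).
    exact: is_deriveD.
  have dV := @is_deriveV _ (fun t => 1 + Num.sqrt t) x _ 1 n0 dS.
  apply: is_derive_eq (is_deriveN dV) _.
  rewrite add0r /dominating scaleNr opprK.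
  by rewrite [RHS]invfM [RHS]mulrC.
have Foo : F x @[x --> +oo] --> (0 : R).
  apply/cvgrPdist_le => e e0; near=> x.
  have x0 : 0 < x by near: x; apply: nbhs_pinfty_gt; exact: num_real.
  have xe : e^-1 ^+ 2 < x by near: x; apply: nbhs_pinfty_gt; exact: num_real.
  rewrite sub0r opprK ger0_norm ?invr_ge0 ?addr_ge0 ?sqrtr_ge0 //.
  have p0 : 0 < 1 + Num.sqrt x by rewrite ltr_wpDr ?sqrtr_ge0.
  rewrite -[leRHS]invrK lef_pV2 ?posrE ?invr_gt0 //.
  apply: (@le_trans _ _ (Num.sqrt x)); last by rewrite lerDr.
  rewrite -[leLHS]ger0_norm ?invr_ge0 ?(ltW e0) // -sqrtr_sqr ler_sqrt ?ltW //.
have F0 : F x @[x --> 0^'+] --> (-1 : R).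
  rewrite -[X in _ --> X]opprK opprK -[X in - X]invr1 -[X in X^-1]addr0 -[X in 1 + X](sqrtr0 R).
  apply: cvg_at_right_filter; apply: cvgN; apply: cvgV.
    by rewrite sqrtr0 addr0 oner_neq0.
  by apply: cvgD; [exact: cvg_cst|exact: sqrt_continuous].
rewrite (FTC_0y dF dominating_continuous (fun x _ => dominating_ge0 x) F0 Foo).
by congr EFin; ring.
Unshelve. all: by end_near. Qed.

End dominating_function.

(** * Admissible competitors *)

Section admissible.
Context {R : realType}.
Local Notation leb := (@lebesgue_measure R).
Local Notation pos := (`]0, +oo[%classic : set R).

(** Rearrangement and scaling reduce every element of W12 to such a competitor. *)
Definition admissible (v G : R -> R) : Prop :=
  [/\ forall t, 0 < t -> 0 <= v t,
      forall s t, 0 < s -> s <= t -> v t <= v s,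
      energy_bound v G 1 &
      (\int[leb]_(t in `]0%R, +oo[) (v t ^+ 2)%:E <= 1)%E].

Definition quartic (v : R -> R) : \bar R :=
  (\int[leb]_(t in `]0%R, +oo[) (v t ^+ 4)%:E)%E.

Lemma quartic_ge0 v : (0 <= quartic v)%E.
Proof. by apply: integral_ge0 => t _; rewrite lee_fin exprn_even_ge0. Qed.

Lemma admissible_continuous v G : admissible v G ->
  forall x : R, 0 < x -> {for x, continuous v}.
Proof. by case=> _ _ + _; exact: energy_continuous. Qed.

Lemma admissible_measurable_exp v G n : admissible v G ->
  measurable_fun pos (fun t => (v t ^+ n)%:E).
Proof.
move=> av; apply/measurable_EFinP; apply: measurable_funX.
by apply: measurable_fun_pos; exact: admissible_continuous av.
Qed.

Lemma admissible_sqr_le v G t : admissible v G -> 0 < t -> t * v t ^+ 2 <= 1.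
Proof.
move=> av t0; case: (av) => v0 vm _ v2.
rewrite -lee_fin; apply: le_trans v2.
have -> : (t * v t ^+ 2)%:E = (\int[leb]_(x in `]0%R, t]) (v t ^+ 2)%:E)%E.
  rewrite integral_cst // mulrC EFinM; congr (_ * _)%E.
  by rewrite /= lebesgue_measure_itv /= lte_fin t0 sube0.
have st : `]0, t]%classic `<=` pos.
  by move=> x /=; rewrite !in_itv /= andbT => /andP[].
apply: (@le_trans _ _ (\int[leb]_(x in `]0%R, t]) (v x ^+ 2)%:E)%E).
  apply: ge0_le_integral => //.
  - by move=> x _; rewrite lee_fin sqr_ge0.
  - apply: (measurable_funS _ st) => //; exact: admissible_measurable_exp av.
  - move=> x /=; rewrite in_itv /= => /andP[x0 xt]; rewrite lee_fin.
    by rewrite ler_pXn2r ?nnegrE ?v0 // vm.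
apply: ge0_subset_integral => //; first exact: admissible_measurable_exp av.
by move=> x _; rewrite lee_fin sqr_ge0.
Qed.

Lemma sqr_ln_le (t : R) : 0 < t -> t <= 1 -> ln t ^+ 2 * Num.sqrt t <= 16.
Proof.
move=> t0 t1; set z := Num.sqrt (Num.sqrt t).
have z0 : 0 < z by rewrite !sqrtr_gt0.
have zE : z ^+ 2 = Num.sqrt t by rewrite sqr_sqrtr // sqrtr_ge0.
have tE : t = z ^+ 4 by rewrite (_ : 4 = 2 * 2)%N // exprM zE sqr_sqrtr // ltW.
have l0 : ln t <= 0 by exact: ln_le0.
have lt_ : ln t = 4 * ln z by rewrite [in LHS]tE lnXn // mulr_natl.
have h : - ln z <= z^-1.
  rewrite -lnV ?posrE //; have : ln (1 + (z^-1 - 1)) <= z^-1 - 1.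
    by apply: le_ln1Dx; rewrite ltrBrDr addNr invr_gt0.
  by rewrite subrKC; lra.
have hz : - ln t * z <= 4.
  have : - ln z * z <= 1 by rewrite -ler_pdivlMr // mul1r.
  by rewrite lt_; nra.
have hz0 : 0 <= - ln t * z by rewrite mulr_ge0 ?oppr_ge0 // ltW.
rewrite -zE (_ : ln t ^+ 2 * z ^+ 2 = (- ln t * z) ^+ 2); last by ring.
by nra.
Qed.

(** Near 0 the energy bound gives logarithmic growth; at infinity monotonicity
    and the square integral give decay like t^(-1/2). The constant is
    8 * 8 * (1 + 16), the last term coming from [sqr_ln_le]. *)
Lemma admissible_quartic_le v G t : admissible v G -> 0 < t ->
  v t ^+ 4 <= 1088 * dominating t.
Proof.
move=> av t0; case: (av) => v0 vm ev v2; rewrite /dominating.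
set s := Num.sqrt t; have s0 : 0 < s by rewrite sqrtr_gt0.
have sE : s ^+ 2 = t by rewrite sqr_sqrtr // ltW.
have s1p : 0 < 1 + s by lra.
have d0 : 0 < 2 * s * (1 + s) ^+ 2 by rewrite ?mulr_gt0 ?exprn_gt0.
rewrite ler_pdivlMr //.
have vt0 := v0 _ t0.
have [t1|t1] := leP t 1; last first.
  have s1 : 1 < s by rewrite -(@ltr_pXn2r _ 2) ?nnegrE ?(ltW s0) ?expr1n ?sE.
  have h : s ^+ 2 * v t ^+ 2 <= 1 by rewrite sE; exact: admissible_sqr_le av t0.
  set q := v t in vt0 h *.
  have sq1 : (s * q) ^+ 2 <= 1 by rewrite exprMn.
  have q1 : (s * q) ^+ 4 <= 1.
    by rewrite (_ : 4 = 2 * 2)%N // exprM -[leRHS](expr1n _ 2) ler_pXn2r ?nnegrE ?sqr_ge0.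
  apply: (@le_trans _ _ (8 * (s * q) ^+ 4)); last by lra.
  have -> : 8 * (s * q) ^+ 4 = q ^+ 4 * (8 * s ^+ 4) by ring.
  apply: ler_wpM2l; first by rewrite exprn_ge0.
  have -> : 8 * s ^+ 4 = 2 * s * (4 * s ^+ 3) by ring.
  apply: ler_wpM2l; first by rewrite mulr_ge0 // ltW.
  have s2 : (1 + s) ^+ 2 <= 4 * s ^+ 2 by nra.
  by apply: le_trans s2 _; rewrite ler_pM2l // [leRHS]exprS ler_peMl ?sqr_ge0 // ltW.
have s1 : s <= 1.
  by rewrite leNgt; apply/negP => s1; have : s ^+ 2 <= 1; [rewrite sE|nra].
have v1 : 0 <= v 1 <= 1.
  rewrite v0 //=; have := admissible_sqr_le av ltr01; rewrite mul1r => h.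
  by rewrite -(@ler_pXn2r _ 2) ?nnegrE ?expr1n ?v0.
have l0 : ln t <= 0 by exact: ln_le0.
pose r := Num.sqrt (- ln t).
have r0 : 0 <= r by exact: sqrtr_ge0.
have r2 : r ^+ 2 = - ln t by rewrite sqr_sqrtr ?oppr_ge0.
have vr : v t <= 1 + r.
  have := energy_holder ev t0 ltr01; rewrite ln1 subr0 mul1r ler0_norm // -r2 => h.
  have : `|v t - v 1| <= r.
    by rewrite -(@ler_pXn2r _ 2) ?nnegrE // real_normK ?num_real.
  by move=> /(le_trans (ler_norm _)); move/andP : v1 => [_ ]; lra.
have v4 : v t ^+ 4 <= 8 * (1 + r ^+ 4).
  apply: (@le_trans _ _ ((1 + r) ^+ 4)); first by rewrite ler_pXn2r ?nnegrE ?addr_ge0.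
  have p2 : (1 + r) ^+ 2 <= 2 * (1 + r ^+ 2) by have := sqr_ge0 (1 - r); lra.
  have p4 : ((1 + r) ^+ 2) ^+ 2 <= (2 * (1 + r ^+ 2)) ^+ 2.
    by rewrite ler_pXn2r ?nnegrE ?sqr_ge0 // mulr_ge0 // addr_ge0 ?sqr_ge0.
  rewrite -[leLHS]/((1 + r) ^+ (2 * 2)) exprM.
  by have := sqr_ge0 (1 - r ^+ 2); lra.
have r4 : r ^+ 4 * s <= 16.
  by rewrite (_ : 4 = 2 * 2)%N // exprM r2 sqrrN; exact: sqr_ln_le.
apply: (@le_trans _ _ (v t ^+ 4 * (8 * s))).
  apply: ler_wpM2l; first by rewrite exprn_ge0.
  have : (1 + s) ^+ 2 <= 4 by nra.
  by nra.
apply: (@le_trans _ _ (8 * (1 + r ^+ 4) * (8 * s))).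
  by apply: ler_wpM2r => //; rewrite mulr_ge0 // ltW.
by lra.
Qed.

Lemma admissible_quartic_dominated : exists2 C : R, 0 <= C &
  forall v G t, admissible v G -> 0 < t -> v t ^+ 4 <= C * dominating t.
Proof.
exists 1088; first exact: ler0n.
by move=> v G t; exact: admissible_quartic_le.
Qed.

Lemma admissible_quartic_bounded : exists C : R,
  forall v G, admissible v G -> (quartic v <= C%:E)%E.
Proof.
have [C C0 HC] := admissible_quartic_dominated; exists C => v G av.
rewrite -[leRHS]mule1 -[X in (_ <= _ * X)%E]integral_dominating.
have md : measurable_fun pos (fun t => (@dominating R t)%:E).
  apply/measurable_EFinP; apply: measurable_fun_pos; exact: dominating_continuous.
rewrite -ge0_integralZl //; last first.
  by move=> t _; rewrite lee_fin dominating_ge0.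
apply: ge0_le_integral => //.
- by move=> t _; rewrite lee_fin exprn_even_ge0.
- exact: admissible_measurable_exp av.
- exact: emeasurable_funM.
- move=> t /=; rewrite in_itv /= andbT => t0; rewrite -EFinM lee_fin.
  exact: HC av t0.
Qed.

End admissible.

(** * Existence of a maximizer *)

Section maximizer.
Context {R : realType}.
Local Notation leb := (@lebesgue_measure R).
Local Notation pos := (`]0, +oo[%classic : set R).

Lemma bounded_ultralimit (U : set_system nat) (f : nat -> R) (a b : R) :
  UltraFilter U -> (forall n, a <= f n <= b) ->
  exists L : R, f n @[n --> U] --> L.
Proof.
move=> UU fab; pose S := [set y | U [set n | y <= f n]].
have Sa : S a by apply: filterS filterT => n _ /=; case/andP: (fab n).
have Sb : ubound S b.
  move=> y /filter_ex[n /= yf]; case/andP: (fab n) => _; exact: le_trans.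
have hS : has_sup S by split; [exists a | exists b].
exists (sup S); apply/cvgrPdist_le => e e0.
have [y Sy ye] := sup_adherent e0 hS.
have [Se|nSe] := in_ultra_setVsetC [set n | sup S + e <= f n] UU.
  have : sup S + e <= sup S by apply: ub_le_sup => //; exists b.
  by lra.
move: Sy nSe; apply: filterS2 => n /= yn /negP; rewrite -ltNge => fn.
by rewrite ler_norml; lra.
Qed.

Lemma cvg_pow (T : Type) (F : set_system T) (f : T -> R) (l : R) (n : nat) :
  Filter F -> f x @[x --> F] --> l -> f x ^+ n @[x --> F] --> l ^+ n.
Proof. by move=> FF fl; exact: (cvg_comp _ _ fl (@exprn_continuous R n l)). Qed.

(** A sequence that contains all rationals. *)
Let point_ (j : nat) : R := ratr (odflt (0 : rat) (unpickle j)).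

Let point_dense (t e : R) : 0 < t -> 0 < e ->
  exists j, 0 < point_ j /\ `|ln t - ln (point_ j)| < e.
Proof.
move=> t0 e0; have /cvgrPdist_lt /(_ _ e0) lnt := continuous_ln t0.
have [d /= d0 H] : \forall y \near t, 0 < y /\ `|ln t - ln y| < e.
  by near=> y; split; near: y; [exact: lt_nbhsr | exact: lnt].
have [q] := @rat_in_itvoo _ t (t + d) (ltr_pwDr d0 (lexx t)).
rewrite in_itv /= => /andP[tq qd]; exists (pickle q).
rewrite /point_ pickleK /=; apply: H => /=.
by rewrite ltr_norml; lra.
Unshelve. all: by end_near. Qed.

(** Limits along an ultrafilter exist at every point, and inherit the conditions,
    the last one by Fatou's lemma. The subsequence converges on the positive
    rationals, hence everywhere, since functions of bounded energy are
    equicontinuous. *)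
Lemma admissible_compact (v_ G_ : nat -> R -> R) :
  (forall n, admissible (v_ n) (G_ n)) ->
  exists (v G : R -> R) (phi : nat -> nat), [/\ admissible v G,
    forall n, (n <= phi n)%N &
    forall t, 0 < t -> v_ (phi n) t @[n --> \oo] --> v t].
Proof.
move=> av; have [U [UU Uoo]] := ultraFilterLemma (_ : ProperFilter (nbhs (\oo%classic : set_system nat))).
have limv t : 0 < t -> exists L : R, v_ n t @[n --> U] --> L.
  move=> t0; apply: (@bounded_ultralimit _ _ 0 (1 + t^-1)) => n.
  have [v0 _ _ _] := av n; rewrite v0 //=.
  have := admissible_sqr_le (av n) t0; rewrite mulrC -ler_pdivlMr // mul1r.
  have := sqr_ge0 (v_ n t - 1); have : 0 < t^-1 by rewrite invr_gt0.
  by have := v0 _ t0; nra.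
have limG t : 0 < t -> exists L : R, G_ n t @[n --> U] --> L.
  move=> t0; apply: (@bounded_ultralimit _ _ 0 1) => n.
  by have [_ _ [+ _ _] _] := av n; apply.
have pick (f : nat -> R -> R) :
    (forall t, 0 < t -> exists L : R, f n t @[n --> U] --> L) ->
    exists g : R -> R, forall t, 0 < t -> f n t @[n --> U] --> g t.
  move=> lim; have [|g Hg] := @choice R R (fun t L => 0 < t -> f n t @[n --> U] --> L).
    move=> t; have [t0|t0] := pselect (0 < t); last by exists 0.
    by have [L HL] := lim t t0; exists L.
  by exists g.
have [v Hv] := pick _ limv; have [G HG] := pick _ limG.
have v0 t : 0 < t -> 0 <= v t.
  move=> t0; apply: (@ler_cvg_to _ U _ _ (fun=> 0) _ _ _ (cvg_cst _) (Hv t t0)).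
  by apply: nearW => n; have [+ _ _ _] := av n; apply.
have vm s t : 0 < s -> s <= t -> v t <= v s.
  move=> s0 st; have t0 : 0 < t by exact: lt_le_trans st.
  apply: (ler_cvg_to (Hv t t0) (Hv s s0)).
  by apply: nearW => n; have [_ + _ _] := av n; apply.
have ev : energy_bound v G 1.
  split => [x x0|x y x0 xy|x y x0 xy].
  - apply/andP; split.
      apply: (@ler_cvg_to _ U _ _ (fun=> 0) _ _ _ (cvg_cst _) (HG x x0)).
      by apply: nearW => n; have [_ _ [/(_ x x0)/andP[]]] := av n.
    apply: (@ler_cvg_to _ U _ _ _ (fun=> 1) _ _ (HG x x0) (cvg_cst _)).
    by apply: nearW => n; have [_ _ [/(_ x x0)/andP[]]] := av n.
  - have y0 : 0 < y by exact: lt_le_trans xy.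
    apply: (ler_cvg_to (HG x x0) (HG y y0)).
    by apply: nearW => n; have [_ _ [_ + _] _] := av n; apply.
  - have y0 : 0 < y by exact: lt_le_trans xy.
    have c1 : (v_ n y - v_ n x) ^+ 2 @[n --> U] --> (v y - v x) ^+ 2.
      by apply: cvg_pow; apply: cvgB; exact: Hv.
    have c2 : (ln y - ln x) * (G_ n y - G_ n x) @[n --> U] -->
        (ln y - ln x) * (G y - G x).
      by apply: cvgM; [exact: cvg_cst | apply: cvgB; exact: HG].
    apply: (ler_cvg_to c1 c2).
    by apply: nearW => n; have [_ _ [_ _ +] _] := av n; apply.
have cv : forall x : R, 0 < x -> {for x, continuous v} := energy_continuous ev.
have ex n : exists k, (n <= k)%N /\
    forall j, (j < n)%N -> 0 < point_ j -> `|v (point_ j) - v_ k (point_ j)| < n.+1%:R^-1.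
  suff : U [set k | (n <= k)%N /\
    forall j, (j < n)%N -> 0 < point_ j -> `|v (point_ j) - v_ k (point_ j)| < n.+1%:R^-1].
    by move=> /filter_ex[k []]; exists k.
  apply: filterI; first by apply: Uoo; exists n.
  elim: {1}n => [|m IH]; first by apply: filterS filterT.
  have : U [set k | 0 < point_ m -> `|v (point_ m) - v_ k (point_ m)| < n.+1%:R^-1].
    have [p0|p0] := pselect (0 < point_ m); last by apply: filterS filterT => k _ /p0.
    have /cvgrPdist_lt /(_ n.+1%:R^-1) := Hv _ p0.
    by rewrite invr_gt0 ltr0Sn => /(_ isT); apply: filterS => k h _.
  move: IH; apply: filterS2 => k IH Hm j; rewrite ltnS leq_eqVlt.
  by move=> /orP[/eqP ->//|]; exact: IH.
have [phi Hphi] := choice ex.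
have cvg_v t : 0 < t -> v_ (phi n) t @[n --> \oo] --> v t.
  move=> t0; apply/cvgrPdist_le => e e0; have e3 : 0 < e / 3 by lra.
  have e9 : 0 < (e / 3) ^+ 2 by rewrite exprn_gt0.
  have [j [p0 pj]] := point_dense t0 e9.
  have close w H : energy_bound w H 1 -> `|w t - w (point_ j)| <= e / 3.
    move=> ew; rewrite -(@ler_pXn2r _ 2) ?nnegrE ?(ltW e3) //.
    rewrite real_normK ?num_real //; apply: le_trans (energy_holder ew t0 p0) _.
    by rewrite mul1r ltW.
  near=> n.
  have [_ /(_ j _ p0)] := Hphi n => /(_ _)/ltW h1.
  have {}h1 : `|v (point_ j) - v_ (phi n) (point_ j)| <= e / 3.
    apply: le_trans (h1 _) _; first by near: n; exact: nbhs_infty_gt.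
    rewrite -[leRHS]invrK lef_pV2 ?posrE ?invr_gt0 //.
    apply: le_trans (_ : n%:R <= _); last by rewrite ler_nat.
    by near: n; exact: nbhs_infty_ger.
  have h2 := close _ _ ev.
  have [_ _ evn _] := av (phi n); have h3 := close _ _ evn.
  move: h1 h2 h3; rewrite !ler_norml; lra.
exists v, G, phi; split => // [|n]; last by have [] := Hphi n.
split => //.
pose f n t := (v_ (phi n) t ^+ 2)%:E.
have mf n : measurable_fun pos (f n) := admissible_measurable_exp 2 (av (phi n)).
have f0 n t : pos t -> (0 <= f n t)%E by rewrite lee_fin sqr_ge0.
apply: (@le_trans _ _ (\int[leb]_(t in `]0%R, +oo[) limn_einf (f ^~ t))%E).
  rewrite le_eqVlt; apply/orP; left; apply/eqP; apply: eq_integral => t.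
  rewrite inE /= in_itv /= andbT => t0.
  have c : f n t @[n --> \oo] --> (v t ^+ 2)%:E.
    apply: cvg_EFin; first exact: nearW.
    exact: cvg_pow (cvg_v _ t0).
  by have [-> _] := cvg_limn_einf_sup c.
apply: le_trans (fatou leb (measurable_itv `]0%R, +oo[) mf f0) _.
rewrite limn_einf_lim; apply: lime_le; first exact: is_cvg_einfs.
apply: nearW => n; apply: (@le_trans _ _ (\int[leb]_(t in `]0%R, +oo[) f n t)%E).
  by apply: ereal_inf_lbound; exists n => /=.
by have [_ _ _] := av (phi n).
Unshelve. all: by end_near. Qed.

(** The quartic integral is continuous along a convergent maximizing sequence by
    dominated convergence. *)
Lemma quartic_maximizer : exists v G : R -> R, [/\ admissible v G,
  quartic v \is a fin_num &
  forall v' G', admissible v' G' -> (quartic v' <= quartic v)%E].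
Proof.
pose S : set (\bar R) := [set q | exists v G : R -> R, admissible v G /\ q = quartic v].
have [C HC] := @admissible_quartic_bounded R.
have S0 : admissible (fun=> 0 : R) (fun=> 0).
  split => //; last by under eq_integral do rewrite expr0n; rewrite integral0 lee_fin.
  by split => [x _|//|x y _ _]; rewrite ?lexx ?ler01 // !subrr mulr0 expr0n.
have supC : (ereal_sup S <= C%:E)%E.
  by apply: ge_ereal_sup => _ [v [G [av ->]]]; exact: HC av.
have sup_fin : ereal_sup S \is a fin_num.
  have : (0 <= ereal_sup S)%E.
    apply: (@le_trans _ _ (quartic (fun=> 0 : R))); first exact: quartic_ge0.
    by apply: ereal_sup_ubound; exists (fun=> 0), (fun=> 0).
  by move=> h; rewrite ge0_fin_numE //; exact: le_lt_trans supC (ltry _).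
have near_max n : exists vG : (R -> R) * (R -> R), admissible vG.1 vG.2 /\
    (ereal_sup S - (n.+1%:R^-1)%:E < quartic vG.1)%E.
  have n0 : 0 < n.+1%:R^-1 :> R by rewrite invr_gt0.
  have [_ [v [G [av ->]]] h] := ub_ereal_sup_adherent n0 sup_fin.
  by exists (v, G).
have [vG HvG] := choice near_max.
have [|v [G [phi [av phi_ge cvg_v]]]] := @admissible_compact (fun n => (vG n).1) (fun n => (vG n).2).
  by move=> n; have [] := HvG n.
have [D D0 HD] := @admissible_quartic_dominated R.
pose f n t := ((vG (phi n)).1 t ^+ 4)%:E.
have cvg_q : (\int[leb]_(t in `]0%R, +oo[) f n t)%E @[n --> \oo] --> quartic v.
  have avn n : admissible (vG (phi n)).1 (vG (phi n)).2 by have [] := HvG (phi n).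
  have [|||||_ _ +] := @dominated_convergence _ _ _ leb pos (measurable_itv `]0%R, +oo[)
    f (fun t => (v t ^+ 4)%:E) (fun t => (D * dominating t)%:E).
  - by move=> n; exact: admissible_measurable_exp (avn n).
  - exact: admissible_measurable_exp av.
  - apply: aeW => t; rewrite /= in_itv /= andbT => t0.
    apply: cvg_EFin; first exact: nearW.
    exact: cvg_pow (cvg_v _ t0).
  - apply/integrableP; split.
      apply/measurable_EFinP; apply: measurable_funM => //.
      by apply: measurable_fun_pos; exact: dominating_continuous.
    under eq_integral => t _.
      rewrite /= ger0_norm ?mulr_ge0 ?dominating_ge0 // EFinM; over.
    rewrite ge0_integralZl //=; first by rewrite integral_dominating mule1 ltry.
      apply/measurable_EFinP; apply: measurable_fun_pos; exact: dominating_continuous.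
    by move=> t _; rewrite lee_fin dominating_ge0.
  - apply: aeW => t n; rewrite /= in_itv /= andbT => t0; rewrite lee_fin.
    by rewrite ger0_norm ?exprn_even_ge0 //; exact: HD (avn n) t0.
  - by [].
have sup_q : (ereal_sup S <= quartic v)%E.
  apply/lee_addgt0Pr => e e0; rewrite -(cvg_lim _ cvg_q) //.
  rewrite -leeBlDr //; apply: lime_ge; first by apply/cvg_ex; eexists; exact: cvg_q.
  near=> n; apply: le_trans (ltW (HvG (phi n)).2).
  apply: leeB => //; rewrite lee_fin -[leRHS]invrK lef_pV2 ?posrE ?invr_gt0 //.
  apply: le_trans (_ : n%:R <= _).
    by near: n; exact: nbhs_infty_ger.
  by rewrite ler_nat; apply: leq_trans (phi_ge n) _.
exists v, G; split => // [|v' G' av'].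
  rewrite ge0_fin_numE ?quartic_ge0 //; exact: le_lt_trans (HC _ _ av) (ltry _).
by apply: le_trans sup_q; apply: ereal_sup_ubound; exists v', G'.
Unshelve. all: by end_near. Qed.

End maximizer.

(** * The weighted inequality *)

Section weighted_inequality.
Context {R : realType}.
Local Notation leb := (@lebesgue_measure R).
Local Notation pos := (`]0, +oo[%classic : set R).

Lemma powR_continuous (m x : R) : 0 < x -> {for x, continuous (@powR R ^~ m)}.
Proof.
move=> x0; apply/differentiable_continuous/derivable1_diffP.
by have [] := is_derive1_powR m x0.
Qed.

Lemma powR_cvg0 (m : R) : 0 < m -> x `^ m @[x --> 0^'+] --> (0 : R).
Proof.
move=> m0; apply/cvgrPdist_le => e e0; near=> x.
have x0 : 0 < x by near: x; exact: nbhs_right_gt.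
have xe : x < e `^ m^-1 by near: x; apply: nbhs_right_lt; rewrite powR_gt0.
rewrite sub0r normrN ger0_norm ?powR_ge0 //.
have -> : e = (e `^ m^-1) `^ m.
  by rewrite -powRrM mulVf ?gt_eqF // powRr1 // ltW.
by apply: ge0_ler_powR; rewrite ?nnegrE ?powR_ge0 ?ltW.
Unshelve. all: by end_near. Qed.

Lemma integral_powR_oc (k theta x : R) : 0 <= k -> 0 <= theta -> 0 < x ->
  (\int[leb]_(t in `]0%R, x]) (k * ((1 + theta) * t `^ theta))%:E =
   (k * x `^ (1 + theta))%:E)%E.
Proof.
move=> k0 th0 x0; have m0 : 0 < 1 + theta by lra.
rewrite (@FTC_0c _ (fun t => k * ((1 + theta) * t `^ theta))
  (fun t => k * t `^ (1 + theta)) _ _ _ x 0) ?subr0 //.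
- move=> t t0; have := is_derive1_powR (1 + theta) t0.
  rewrite [1 + theta - 1]addrAC subrr add0r => d.
  exact: is_deriveZ.
- move=> t t0; apply: cvgM; first exact: cvg_cst.
  by apply: cvgM; [exact: cvg_cst|exact: powR_continuous].
- by move=> t t0; rewrite !mulr_ge0 ?powR_ge0 // ltW.
- by rewrite -[X in _ --> X](mulr0 k); apply: cvgM; [exact: cvg_cst|exact: powR_cvg0].
Qed.

Variable Q : R.
Hypothesis quartic_le : forall v G : R -> R, admissible v G -> (quartic v <= Q%:E)%E.

(** The rearrangement of a multiple of u for a multiple of x^theta dx is
    admissible; the two factors are chosen to normalise M and a. *)
Lemma quartic_weighted_le (theta : R) (u G : R -> R) (M a : R) :
  0 <= theta -> energy_bound u G M -> 0 < M -> 0 < a ->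
  (forall x, 0 < x -> 0 <= u x) -> u x @[x --> +oo] --> (0 : R) ->
  (\int[leb]_(x in `]0%R, +oo[) (u x ^+ 2 * x `^ theta)%:E <= a%:E)%E ->
  (\int[leb]_(x in `]0%R, +oo[) (u x ^+ 4 * x `^ theta)%:E <=
    (Q * (M * a / (1 + theta)))%:E)%E.
Proof.
move=> th0 uG M0 a0 u0 uoo int_a; pose m := 1 + theta.
have m0 : 0 < m by rewrite /m; lra.
pose c := Num.sqrt (m / M).
have c0 : 0 < c by rewrite sqrtr_gt0 divr_gt0.
have c2 : c ^+ 2 = m / M by rewrite sqr_sqrtr // divr_ge0 // ltW.
pose k := M / (m ^+ 2 * a).
have k0 : 0 < k by rewrite divr_gt0 // mulr_gt0 // exprn_gt0.
pose w (x : R) := k * (m * x `^ theta).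
pose cu x := c * u x; pose cG x := c ^+ 2 * G x.
have c20 : 0 <= c ^+ 2 by exact: sqr_ge0.
have ecu : energy_bound cu cG m.
  have [GM Gm uE] := uG; split => [x x0|x y x0 xy|x y x0 xy].
  - have /andP[h1 h2] := GM _ x0; rewrite mulr_ge0 //=.
    have -> : m = c ^+ 2 * M by rewrite c2 divfK // gt_eqF.
    exact: ler_wpM2l.
  - by apply: ler_wpM2l => //; exact: Gm.
  - have -> : (cu y - cu x) ^+ 2 = c ^+ 2 * (u y - u x) ^+ 2 by rewrite /cu; ring.
    rewrite /cG -mulrBr [leRHS]mulrCA; apply: ler_wpM2l => //; exact: uE.
have cont := energy_continuous uG.
have contc : forall x : R, 0 < x -> {for x, continuous cu} := energy_continuous ecu.
have mpow : measurable_fun pos (fun x => x `^ theta).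
  by apply: measurable_fun_pos => x; exact: powR_continuous.
have mw : measurable_fun pos w by do 2 apply: measurable_funM => //.
have w0 x : 0 < x -> 0 <= w x.
  move=> _; apply: mulr_ge0; first exact: ltW.
  by apply: mulr_ge0; [exact: ltW|exact: powR_ge0].
have cu0 x : 0 < x -> 0 <= cu x by move=> x0; rewrite mulr_ge0 ?u0 // ltW.
have intE n : (\int[leb]_(x in `]0%R, +oo[) (cu x ^+ n * w x)%:E =
    (c ^+ n * (k * m))%:E * \int[leb]_(x in `]0%R, +oo[) (u x ^+ n * x `^ theta)%:E)%E.
  rewrite -ge0_integralZl //.
  - by apply: eq_integral => x _; rewrite -EFinM /cu /w exprMn; congr EFin; ring.
  - apply/measurable_EFinP; apply: measurable_funM => //; apply: measurable_funX.
    exact: measurable_fun_pos.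
  - move=> x /=; rewrite in_itv /= andbT => x0; rewrite lee_fin.
    by rewrite mulr_ge0 ?powR_ge0 // exprn_ge0 // u0.
  - rewrite lee_fin; apply: mulr_ge0; first by apply: exprn_ge0; exact: ltW.
    by apply: mulr_ge0; exact: ltW.
have int2 : (\int[leb]_(x in `]0%R, +oo[) (cu x ^+ 2 * w x)%:E <= 1)%E.
  rewrite intE; apply: (@le_trans _ _ ((c ^+ 2 * (k * m))%:E * a%:E)%E).
    apply: lee_wpmul2l => //; rewrite lee_fin; apply: mulr_ge0 => //.
    by apply: mulr_ge0; exact: ltW.
  rewrite -EFinM lee_fin c2 /k le_eqVlt; apply/orP; left; apply/eqP.
  by field; rewrite !gt_eqF.
have int2oo := le_lt_trans int2 (ltry 1).
have cuoo : cu x @[x --> +oo] --> (0 : R).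
  by rewrite -[X in _ --> X](mulr0 c); apply: cvgM; [exact: cvg_cst|].
have int_w x : 0 < x -> (\int[leb]_(t in `]0%R, x]) (w t)%:E = (k * x `^ m)%:E)%E.
  by move=> x0; apply: integral_powR_oc => //; exact: ltW.
have [G' vG'] := rearrangement_energy contc mw w0 int2oo ecu cuoo k0 m0 int_w.
rewrite divff ?gt_eqF // in vG'.
have moment := rearrangement_integral contc cu0 mw w0 int2oo ecu cuoo k0 m0 int_w.
have av : admissible (rearrangement cu w) G'.
  split => //.
  - by move=> t _; exact: rearrangement_ge0.
  - exact: (rearrangement_nonincreasing contc mw w0 int2oo).
  - by rewrite (moment 1).
have := quartic_le av; rewrite /quartic.
rewrite (moment 3) intE.
have kc : c ^+ 4 * (k * m) = m / (M * a).
  rewrite -[_ ^+ 4]/(_ ^+ (2 * 2)) exprM c2 /k.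
  by field; rewrite !gt_eqF.
have kc0 : 0 < m / (M * a) by rewrite divr_gt0 // mulr_gt0.
rewrite kc => h; have -> : Q * (M * a / (1 + theta)) = (m / (M * a))^-1 * Q.
  by rewrite invf_div mulrC.
by rewrite EFinM lee_pdivlMl.
Qed.

End weighted_inequality.

(** * A trial function *)

Section trial.
Context {R : realType}.
Local Notation leb := (@lebesgue_measure R).
Local Notation pos := (`]0, +oo[%classic : set R).

Lemma nondecreasing_of_derive (f df : R -> R) :
  (forall x : R, 0 < x -> is_derive x 1 f (df x)) ->
  (forall x, 0 < x -> 0 <= df x) ->
  forall x y, 0 < x -> x <= y -> f x <= f y.
Proof.
move=> fD df0 x y x0 xy.
apply: (@ger0_derive1_ndecr _ f x y) => // [z|z|].
- by rewrite in_itv /= => /andP[/(lt_trans x0)/fD[]].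
- rewrite in_itv /= => /andP[/(lt_trans x0) z0 _].
  by rewrite derive1E (@derive_val _ _ _ _ _ _ _ (fD z z0)) df0.
- apply: continuous_in_subspaceT => z; rewrite inE /= in_itv /= => /andP[xz _].
  apply/differentiable_continuous/derivable1_diffP.
  by have [] := fD z (lt_le_trans x0 xz).
Qed.

(** By Young's inequality the functions l ln x + G x / l - 2 u x and
    l ln x + G x / l + 2 u x are nondecreasing for every l > 0. *)
Lemma energy_bound_of_derive (u du G dG : R -> R) M :
  (forall x : R, 0 < x -> is_derive x 1 u (du x)) ->
  (forall x : R, 0 < x -> is_derive x 1 G (dG x)) ->
  (forall x, 0 < x -> x * du x ^+ 2 <= dG x) ->
  (forall x, 0 < x -> 0 <= G x <= M) -> energy_bound u G M.
Proof.
move=> uD GD duG GM.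
have dG0 x : 0 < x -> 0 <= dG x.
  by move=> x0; apply: le_trans (duG x x0); rewrite mulr_ge0 ?sqr_ge0 // ltW.
have Gm := nondecreasing_of_derive GD dG0.
split => // x y x0 xy.
rewrite -real_normK ?num_real //; apply: sqr_le_mul_of_young => //.
- by rewrite subr_ge0 ln_mono.
- by rewrite subr_ge0 Gm.
move=> l l0.
have mono (s : R) : s ^+ 2 = 1 ->
    l * ln x + l^-1 * G x - 2 * s * u x <= l * ln y + l^-1 * G y - 2 * s * u y.
  move=> s2; apply: (@nondecreasing_of_derive
    (fun z => l * ln z + l^-1 * G z - 2 * s * u z)
    (fun z => l * z^-1 + l^-1 * dG z - 2 * s * du z)) => // [z z0|z z0].
    have d1 := @is_deriveZ _ _ _ _ l _ _ _ (is_derive1_ln z0).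
    have d2 := @is_deriveZ _ _ _ _ l^-1 _ _ _ (GD z z0).
    have d3 := @is_deriveZ _ _ _ _ (2 * s) _ _ _ (uD z z0).
    exact: (is_deriveB (is_deriveD d1 d2) d3).
  have := @young_of_sqr_le_mul _ `|du z| z^-1 (dG z) l.
  rewrite normr_ge0 invr_ge0 (ltW z0) dG0 // => /(_ isT isT isT l0).
  rewrite real_normK ?num_real // mulrC ler_pdivlMr // mulrC => /(_ (duG z z0)).
  have : s * du z <= `|du z|.
    apply: le_trans (ler_norm _) _; rewrite normrM.
    have : `|s| ^+ 2 = 1 by rewrite real_normK ?num_real.
    by move=> /eqP; rewrite sqrp_eq1 // => /eqP ->; rewrite mul1r.
  by rewrite (mulrC l^-1); lra.
have h1 := mono 1 (expr1n _ _).
have h2 : l * ln x + l^-1 * G x + 2 * u x <= l * ln y + l^-1 * G y + 2 * u y.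
  by have := mono (- 1); rewrite sqrrN expr1n => /(_ erefl); lra.
rewrite mulrBl !(mulrC (G _)).
by case: (ler0P (u y - u x)) => _; move: h1 h2; lra.
Qed.

Lemma is_derive_shifted_powV (n : nat) (x : R) : 0 < x ->
  is_derive x 1 (fun t : R => (1 + t) ^- n.+1) (- (n.+1%:R * (1 + x) ^- n.+2)).
Proof.
move=> x0; have n0 : 1 + x != 0 by rewrite gt_eqF // ltr_wpDl.
have n1 : (1 + x) ^+ n.+1 != 0 by rewrite expf_neq0.
have d1 : is_derive x 1 (fun t : R => 1 + t) (0 + 1) by exact: is_deriveD.
have d2 : is_derive x 1 (fun t : R => (1 + t) ^+ n.+1) (n.+1%:R * (1 + x) ^+ n).
  rewrite (_ : (fun t : R => _) = (fun t : R => 1 + t) ^+ n.+1); last first.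
    by apply/funext => t; rewrite exprfctE.
  apply: is_derive_eq (is_deriveX n.+1 d1) _.
  by rewrite add0r /GRing.scale /= mulr1.
have d3 := @is_deriveV _ (fun t : R => (1 + t) ^+ n.+1) x _ 1 n1 d2.
apply: is_derive_eq d3 _; rewrite /GRing.scale /=.
rewrite 2![(1 + x) ^+ _.+1]exprSr [(1 + x) ^+ n.+1]exprSr.
have q0 : (1 + x) ^+ n != 0 by rewrite expf_neq0.
set q := (1 + x) ^+ n in q0 *;
set N := n.+1%:R; field.
by rewrite n0 q0.
Qed.

Lemma shifted_powV_cvgy (n : nat) : (1 + x) ^- n.+1 @[x --> +oo] --> (0 : R).
Proof.
apply/cvgrPdist_le => e e0; near=> x.
have x0 : 0 < x by near: x; apply: nbhs_pinfty_gt; exact: num_real.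
have xe : e^-1 < x by near: x; apply: nbhs_pinfty_gt; exact: num_real.
have p0 : 0 < 1 + x by lra.
have pn : 0 < (1 + x) ^+ n.+1 by rewrite exprn_gt0.
rewrite sub0r normrN ger0_norm ?invr_ge0 ?(ltW pn) //.
rewrite -[leRHS]invrK lef_pV2 ?posrE ?invr_gt0 //.
apply: (@le_trans _ _ (1 + x)); first by lra.
by rewrite exprS ler_peMr ?(ltW p0) // exprn_ege1 // lerDl ltW.
Unshelve. all: by end_near. Qed.

Lemma integral_shifted_powV (n : nat) :
  (\int[leb]_(t in `]0%R, +oo[) ((1 + t) ^- n.+2)%:E = (n.+1%:R^-1)%:E)%E.
Proof.
have n0 : n.+1%:R != 0 :> R by rewrite pnatr_eq0.
pose F (t : R) : R := - n.+1%:R^-1 * (1 + t) ^- n.+1.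
have dF (x : R) : 0 < x -> is_derive x 1 F ((1 + x) ^- n.+2).
  move=> x0; apply: is_derive_eq (is_deriveZ (- n.+1%:R^-1) (is_derive_shifted_powV n x0)) _.
  by rewrite /GRing.scale /= mulrNN mulrA mulVf // mul1r.
have cont (k : nat) (x : R) : 0 <= x -> {for x, continuous (fun t : R => (1 + t) ^- k)}.
  move=> x0; apply: cvgV; first by rewrite expf_neq0 // gt_eqF // ltr_wpDr.
  by apply: cvg_pow; apply: cvgD; [exact: cvg_cst | exact: cvg_id].
rewrite (@FTC_0y _ (fun t : R => (1 + t) ^- n.+2) F dF _ _ (- n.+1%:R^-1) (- n.+1%:R^-1 * 0)).
- by rewrite mulr0 sub0r opprK.
- by move=> x /ltW; exact: cont.
- by move=> x x0; rewrite invr_ge0 exprn_ge0 // addr_ge0 // ltW.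
- apply: cvg_at_right_filter.
  have -> : - n.+1%:R^-1 = F 0 by rewrite /F addr0 expr1n invr1 mulr1.
  by apply: cvgM; [exact: cvg_cst | apply: cont].
- by apply: cvgM; [exact: cvg_cst | exact: shifted_powV_cvgy].
Qed.

Variable Q : R.
Hypothesis quartic_le : forall v G : R -> R, admissible v G -> (quartic v <= Q%:E)%E.

(** The trial function (1 + t)^(-2) has energy 1/5, square integral 1/3 and
    quartic integral 1/7, so that Q >= 15/7. *)
Lemma quartic_bound_gt2 : 2 < Q.
Proof.
pose u (t : R) : R := (1 + t) ^- 2.
pose du (t : R) : R := - (2 * (1 + t) ^- 3).
(* G is the primitive of x du(x)^2 that vanishes at 0. *)
pose G (t : R) : R := 1 / 5 - (1 + t) ^- 4 + 4 / 5 * (1 + t) ^- 5.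
pose dG (t : R) : R := 4 * (1 + t) ^- 5 - 4 * (1 + t) ^- 6.
have p0 (t : R) : 0 < t -> 1 + t != 0 by move=> t0; rewrite gt_eqF // ltr_wpDl.
have uG : energy_bound u G (1 / 5).
  apply: (@energy_bound_of_derive u du G dG) => t t0.
  - exact: (is_derive_shifted_powV 1 t0).
  - have d4 := is_derive_shifted_powV 3 t0.
    have d5 := is_deriveZ (4 / 5) (is_derive_shifted_powV 4 t0).
    have dB : is_derive t 1 (fun s : R => 1 / 5 - (1 + s) ^- 4)
        (0 - - (4 * (1 + t) ^- 5)) by exact: is_deriveB.
    apply: is_derive_eq (is_deriveD dB d5) _.
    by rewrite /dG /GRing.scale /=; field; rewrite p0.
  - rewrite /du /dG le_eqVlt; apply/orP; left; apply/eqP.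
    by field; rewrite p0.
  - have z0 : 0 < (1 + t)^-1 by rewrite invr_gt0; lra.
    have z1 : (1 + t)^-1 < 1 by rewrite invf_lt1; lra.
    rewrite /G -!exprVn; set z := _^-1 in z0 z1 *.
    have e : 1 / 5 - z ^+ 4 + 4 / 5 * z ^+ 5 =
        (1 - z) ^+ 2 * (1 + 2 * z + 3 * z ^+ 2 + 4 * z ^+ 3) / 5 by field.
    have zn n : 0 <= z ^+ n by rewrite exprn_ge0 // ltW.
    have z5 : z ^+ 5 <= z ^+ 4 by rewrite exprS ler_piMl // ltW.
    apply/andP; split; last by have := zn 4; lra.
    rewrite e; apply: mulr_ge0; last by lra.
    apply: mulr_ge0; first exact: sqr_ge0.
    by have := zn 2; have := zn 3; lra.
have intE n k : (n = k.+2)%N -> (\int[leb]_(t in `]0%R, +oo[)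
    ((1 + t) ^- n * t `^ 0)%:E = (k.+1%:R^-1)%:E)%E.
  move=> ->; rewrite -integral_shifted_powV; apply: eq_integral => t _.
  by rewrite powRr0 mulr1.
have uX n : (fun t => (u t ^+ n * t `^ 0)%:E) = (fun t => ((1 + t) ^- (2 * n) * t `^ 0)%:E).
  by apply/funext => t; rewrite /u exprVn -exprM.
have u2 : (\int[leb]_(t in `]0%R, +oo[) (u t ^+ 2 * t `^ 0)%:E = (3^-1)%:E)%E.
  by rewrite uX (intE _ 2).
have u4 : (\int[leb]_(t in `]0%R, +oo[) (u t ^+ 4 * t `^ 0)%:E = (7^-1)%:E)%E.
  by rewrite uX (intE _ 6).
have := @quartic_weighted_le _ _ quartic_le 0 u G (1 / 5) 3^-1.
rewrite u2 u4 !lexx => /(_ isT uG) H.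
have h5 : (0 : R) < 1 / 5 by lra.
have h3 : (0 : R) < 3^-1 by lra.
have u0 x : 0 < x -> 0 <= u x.
  by move=> x0; rewrite invr_ge0 exprn_ge0 // addr_ge0 // ltW.
have := H h5 h3 u0 (shifted_powV_cvgy 1) isT.
by rewrite lee_fin addr0 divr1; lra.
Qed.

End trial.

(** * Positivity of the maximizer *)

Section positivity.
Context {R : realType}.
Local Notation leb := (@lebesgue_measure R).
Local Notation pos := (`]0, +oo[%classic : set R).

Lemma sqr_add_le_mul_add (A B h1 h2 g1 g2 : R) :
  0 <= h1 -> 0 <= h2 -> 0 <= g1 -> 0 <= g2 ->
  A ^+ 2 <= h1 * g1 -> B ^+ 2 <= h2 * g2 ->
  (A + B) ^+ 2 <= (h1 + h2) * (g1 + g2).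
Proof.
move=> h10 h20 g10 g20 HA HB.
rewrite -real_normK ?num_real //; apply: sqr_le_mul_of_young;
  rewrite ?addr_ge0 // => l l0.
have := @young_of_sqr_le_mul _ `|A| h1 g1 l (normr_ge0 _) h10 g10 l0.
rewrite real_normK ?num_real // => /(_ HA).
have := @young_of_sqr_le_mul _ `|B| h2 g2 l (normr_ge0 _) h20 g20 l0.
rewrite real_normK ?num_real // => /(_ HB).
by have := ler_normD A B; rewrite mulrDr mulrDl; lra.
Qed.

(** Energy is additive over the two sides of c. *)
Lemma energy_bound_glue (u G H : R -> R) (c M N : R) : 0 < c ->
  (forall x, 0 < x -> x <= c -> 0 <= G x <= M) ->
  (forall x y, 0 < x -> x <= y -> y <= c -> G x <= G y /\
     (u y - u x) ^+ 2 <= (ln y - ln x) * (G y - G x)) ->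
  (forall x, c <= x -> 0 <= H x <= N) ->
  (forall x y, c <= x -> x <= y -> H x <= H y /\
     (u y - u x) ^+ 2 <= (ln y - ln x) * (H y - H x)) ->
  energy_bound u (fun x => if x <= c then G x else G c + (H x - H c)) (G c + (N - H c)).
Proof.
move=> c0 GM uG HN uH.
have := GM _ c0 (lexx c); have := HN _ (lexx c) => /andP[Hc0 HcN] /andP[Gc0 GcM].
split => [x x0|x y x0 xy|x y x0 xy].
- case: (leP x c) => [xc|/ltW cx].
    have /andP[-> _] /= := GM _ x0 xc.
    by have [+ _] := uG _ _ x0 xc (lexx c); lra.
  have /andP[_ h1] := HN _ cx; have [h2 _] := uH _ _ (lexx c) cx.
  by apply/andP; lra.
- case: (leP y c) => [yc|/ltW cy].
    by rewrite (le_trans xy yc); have [] := uG _ _ x0 xy yc.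
  case: (leP x c) => [xc|/ltW cx].
    have [h1 _] := uG _ _ x0 xc (lexx c); have [h2 _] := uH _ _ (lexx c) cy; lra.
  by have [h2 _] := uH _ _ cx xy; lra.
- case: (leP y c) => [yc|/ltW cy].
    by rewrite (le_trans xy yc); have [] := uG _ _ x0 xy yc.
  case: (leP x c) => [xc|/ltW cx]; last first.
    have [h1 h2] := uH _ _ cx xy; apply: le_trans h2 _.
    by rewrite le_eqVlt; apply/orP; left; apply/eqP; congr (_ * _); ring.
  have [g1 g2] := uG _ _ x0 xc (lexx c); have [h1 h2] := uH _ _ (lexx c) cy.
  have -> : u y - u x = (u c - u x) + (u y - u c) by ring.
  have -> : ln y - ln x = (ln c - ln x) + (ln y - ln c) by ring.
  have -> : G c + (H y - H c) - G x = (G c - G x) + (H y - H c) by ring.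
  by apply: sqr_add_le_mul_add; rewrite ?subr_ge0 // ln_mono.
Qed.

(** Cutting v off after c, logarithmically in the variable: the energy spent on
    the way from v c to 0 becomes e ^ 2 / L. *)
Lemma energy_bound_log_cutoff (c L e : R) : 0 < c -> 0 < L ->
  let z x := Num.min 1 ((ln x - ln c) / L) in
  forall x y, c <= x -> x <= y ->
    e ^+ 2 / L * z x <= e ^+ 2 / L * z y /\
    (e * (1 - z y) - e * (1 - z x)) ^+ 2 <=
      (ln y - ln x) * (e ^+ 2 / L * z y - e ^+ 2 / L * z x).
Proof.
move=> c0 L0 z x y cx xy; have x0 : 0 < x := lt_le_trans c0 cx.
have lxy := ln_mono x0 xy.
have zz : 0 <= z y - z x <= (ln y - ln x) / L.
  have e1 : (ln y - ln x) / L = (ln y - ln c) / L - (ln x - ln c) / L.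
    by rewrite -mulrBl; congr (_ / _); ring.
  have d0 : 0 <= (ln y - ln x) / L by rewrite divr_ge0 ?subr_ge0 // ltW.
  rewrite /z; case: (leP 1 ((ln y - ln c) / L)); case: (leP 1 ((ln x - ln c) / L));
    by rewrite e1 in d0 *; lra.
have /andP[z0 z1] := zz.
have eL : 0 <= e ^+ 2 / L by rewrite divr_ge0 ?sqr_ge0 // ltW.
split; first by rewrite ler_wpM2l //; lra.
rewrite -[in leRHS]mulrBr.
have -> : (e * (1 - z y) - e * (1 - z x)) ^+ 2 = e ^+ 2 * (z y - z x) * (z y - z x) by ring.
have -> : (ln y - ln x) * (e ^+ 2 / L * (z y - z x)) =
    e ^+ 2 * (z y - z x) * ((ln y - ln x) / L) by ring.
by apply: ler_wpM2l => //; rewrite mulr_ge0 ?sqr_ge0.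
Qed.

Variables (Q : R) (v G : R -> R).
Hypothesis quartic_le : forall v' G' : R -> R, admissible v' G' -> (quartic v' <= Q%:E)%E.
Hypothesis av : admissible v G.
Hypothesis qv : quartic v = Q%:E.
Hypothesis Q0 : 0 < Q.

Let cv := admissible_continuous av.

(** If v vanishes at T, cutting off at c < T with value e = v c saves the energy
    e ^ 2 / (ln T - ln c). The cutoff ends at 2 T, so that its own energy is at most
    e ^ 2 / ln 2; the square integral grows by at most 2 T e ^ 2 and the quartic one
    loses at most T e ^ 4. For c close to T the saved energy outweighs this. *)
Let cutoff_inequality (c T : R) : 0 < c -> c < T -> 0 < v c -> v T = 0 ->
  Q <= Q * ((1 - v c ^+ 2 * ((ln T - ln c)^-1 - (ln 2)^-1)) *
            (1 + 2 * T * v c ^+ 2)) + v c ^+ 4 * T.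
Proof.
move=> c0 cT e0 vT; set e := v c in e0 *; have T0 := lt_trans c0 cT.
have [v0 vm [GM Gm uG] v2] := av.
have ln20 : 0 < ln 2 :> R by rewrite ln_gt0 // ltr1n.
have dT : 0 < ln T - ln c by rewrite subr_gt0 ltr_ln ?posrE.
pose L := ln 2 + ln T - ln c; have L0 : 0 < L by rewrite /L; lra.
pose z x := Num.min 1 ((ln x - ln c) / L).
have zc : z c = 0 by rewrite /z subrr mul0r; apply/min_idPr; exact: ler01.
have z01 x : c <= x -> 0 <= z x <= 1.
  move=> cx; have h : 0 <= (ln x - ln c) / L.
    by apply: divr_ge0; [rewrite subr_ge0 ln_mono|exact: ltW].
  by rewrite /z le_min ler01 h ge_min lexx.
pose w x := if x <= c then v x else e * (1 - z x).
pose H x := e ^+ 2 / L * z x.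
have wr x : c <= x -> w x = e * (1 - z x).
  rewrite /w => cx; case: (leP x c) => // xc.
  by rewrite (le_anti (introT andP (conj xc cx))) zc subr0 mulr1.
have eL : 0 < e ^+ 2 / L by rewrite divr_gt0 // exprn_gt0.
pose M := G c + (e ^+ 2 / L - H c).
have ew : energy_bound w (fun x => if x <= c then G x else G c + (H x - H c)) M.
  apply: (@energy_bound_glue w G H c 1 (e ^+ 2 / L)) => // [x x0 _|x y x0 xy yc|x cx|x y cx xy].
  - exact: GM.
  - by rewrite /w (le_trans xy yc) yc; split; [exact: Gm|exact: uG].
  - have /andP[h1 h2] := z01 _ cx.
    by rewrite /H mulr_ge0 ?(ltW eL) //= ler_piMr // ltW.
  - have cy := le_trans cx xy.
    have := @energy_bound_log_cutoff c L e c0 L0 x y cx xy.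
    by rewrite -/(z _) -/(z _) -(wr _ cx) -(wr _ cy).
have Hc : H c = 0 by rewrite /H zc mulr0.
have M0 : 0 < M by rewrite /M Hc subr0 ltr_wpDl //; have /andP[] := GM _ c0.
have z2T x : 2 * T <= x -> z x = 1.
  move=> Tx; rewrite /z; apply/min_idPl; rewrite ler_pdivlMr // mul1r /L.
  have := ln_mono (mulr_gt0 (ltr0n _ 2) T0) Tx.
  by rewrite lnM ?posrE // ; lra.
have w0 x : 0 < x -> 0 <= w x.
  move=> x0; rewrite /w; case: (leP x c) => [_|/ltW cx]; first exact: v0.
  by rewrite mulr_ge0 ?(ltW e0) // subr_ge0; have /andP[] := z01 _ cx.
have woo : w x @[x --> +oo] --> (0 : R).
  apply: cvg_near_cst; near=> x.
  have Tx : 2 * T <= x by near: x; apply: nbhs_pinfty_ge; exact: num_real.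
  by rewrite wr ?z2T ?subrr ?mulr0 //; lra.
have we x : c <= x -> 0 <= w x <= e.
  move=> cx; rewrite w0 ?(lt_le_trans c0) //= wr // ler_piMr ?(ltW e0) //.
  by have /andP[] := z01 _ cx; lra.
have cw : forall x : R, 0 < x -> {for x, continuous w} := energy_continuous ew.
have mwn n : measurable_fun pos (fun x => (w x ^+ n)%:E).
  by apply/measurable_EFinP; apply: measurable_funX; exact: measurable_fun_pos.
have mind (S k : R) : measurable_fun pos (fun x : R => (k * \1_`]0, S] x)%:E).
  apply/measurable_EFinP; apply: measurable_funM; first exact: measurable_cst.
  by apply: measurable_indic; exact: measurable_itv.
have int_ind (S k : R) : 0 < S -> 0 <= k ->
    (\int[leb]_(x in `]0%R, +oo[) (k * \1_`]0, S] x)%:E = (k * S)%:E)%E.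
  move=> S0 k0; under eq_integral do rewrite EFinM.
  rewrite ge0_integralZl //=; last first.
    by apply/measurable_EFinP; apply: measurable_indic; exact: measurable_itv.
  rewrite integral_indic //=.
  rewrite (_ : _ `&` _ = `]0, S]%classic); last first.
    apply/seteqP; split => x; first by case.
    by move=> x0S; split => //; move: x0S; rewrite /= !in_itv /= andbT => /andP[].
  rewrite EFinM; congr (_ * _)%E.
  by rewrite (_ : leb _ = S%:E) // lebesgue_measure_itv /= lte_fin S0 sube0.
have wE n : (\int[leb]_(x in `]0%R, +oo[) (w x ^+ n * x `^ 0)%:E =
    \int[leb]_(x in `]0%R, +oo[) (w x ^+ n)%:E)%E.
  by apply: eq_integral => x _; rewrite powRr0 mulr1.
have int2 : (\int[leb]_(x in `]0%R, +oo[) (w x ^+ 2 * x `^ 0)%:E <=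
    (1 + 2 * T * e ^+ 2)%:E)%E.
  rewrite wE; apply: (@le_trans _ _ (\int[leb]_(x in `]0%R, +oo[)
      ((v x ^+ 2)%:E + (e ^+ 2 * \1_`]0, (2 * T)%R] x)%:E))%E).
    apply: ge0_le_integral => //.
    - by move=> x _; rewrite lee_fin sqr_ge0.
    - exact: mwn.
    - by apply: emeasurable_funD; [exact: admissible_measurable_exp av|exact: mind].
    - move=> x /=; rewrite in_itv /= andbT => x0.
      rewrite -EFinD lee_fin indicE.
      have [xc|/ltW cx] := leP x c; first by rewrite /w xc lerDl mulr_ge0 ?sqr_ge0.
      have [xT|Tx] := leP x (2 * T).
        rewrite mem_set /= ?in_itv /= ?x0 // mulr1.
        have /andP[h1 h2] := we _ cx; rewrite ler_wpDl ?sqr_ge0 //.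
        by rewrite ler_pXn2r ?nnegrE // ltW.
      rewrite wr // z2T ?(ltW Tx) // subrr mulr0 expr0n /=.
      by apply: addr_ge0; [exact: sqr_ge0|apply: mulr_ge0 => //; exact: sqr_ge0].
  rewrite ge0_integralD //; last 4 first.
  - by move=> x _; rewrite lee_fin sqr_ge0.
  - exact: admissible_measurable_exp av.
  - by move=> x _; rewrite lee_fin mulr_ge0 ?sqr_ge0.
  - exact: mind.
  rewrite int_ind ?sqr_ge0 ?mulr_gt0 // EFinD; apply: leeD => //.
  by rewrite lee_fin mulrC.
have int4 : (Q%:E <= \int[leb]_(x in `]0%R, +oo[) (w x ^+ 4 * x `^ 0)%:E +
    (e ^+ 4 * T)%:E)%E.
  rewrite wE -qv -int_ind ?exprn_ge0 ?(ltW e0) //.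
  rewrite -ge0_integralD //; last 4 first.
  - by move=> x _; rewrite lee_fin exprn_even_ge0.
  - exact: mwn.
  - by move=> x _; rewrite lee_fin mulr_ge0 ?exprn_even_ge0.
  - exact: mind.
  apply: ge0_le_integral => //.
  - by move=> x _; rewrite lee_fin exprn_even_ge0.
  - exact: admissible_measurable_exp av.
  - by apply: emeasurable_funD; [exact: mwn|exact: mind].
  - move=> x /=; rewrite in_itv /= andbT => x0.
    rewrite -EFinD lee_fin indicE.
    have w40 : 0 <= w x ^+ 4 by rewrite exprn_even_ge0.
    have [xc|/ltW cx] := leP x c.
      by rewrite /w xc lerDl mulr_ge0 ?exprn_even_ge0.
    have [xT|Tx] := leP x T.
      rewrite mem_set /= ?in_itv /= ?x0 // mulr1 ler_wpDl //.
      by rewrite ler_pXn2r ?nnegrE ?v0 ?(ltW e0) // vm.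
    have -> : v x = 0.
      by apply: le_anti; rewrite v0 // andbT -vT vm // ltW.
    by rewrite expr0n; apply: addr_ge0 => //; apply: mulr_ge0; rewrite ?exprn_even_ge0.
have a0 : 0 < 1 + 2 * T * e ^+ 2.
  by rewrite ltr_wpDr // !mulr_ge0 ?sqr_ge0 // ltW.
have := @quartic_weighted_le _ _ quartic_le 0 w _ M _ (lexx 0) ew M0 a0 w0 woo int2.
rewrite addr0 divr1 => U.
have := le_trans int4 (leeD U (lexx _)); rewrite -EFinD lee_fin => F.
apply: le_trans F _; rewrite lerD2r ler_wpM2l ?(ltW Q0) //.
apply: ler_wpM2r; first exact: ltW.
rewrite /M Hc subr0.
have h1 : e ^+ 2 / (ln T - ln c) <= G T - G c.
  rewrite ler_pdivrMr // mulrC; have := uG _ _ c0 (ltW cT).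
  by rewrite vT sub0r sqrrN.
have /andP[_ GT1] := GM _ T0.
have h2 : e ^+ 2 / L <= e ^+ 2 / ln 2.
  by rewrite ler_pM2l ?exprn_gt0 // lef_pV2 ?posrE // /L; lra.
by rewrite mulrBr; lra.
Unshelve. all: by end_near. Qed.

(** At the first zero T of v, the point c < T of [cutoff_inequality] is taken so
    close to T that the inequality fails. *)
Lemma maximizer_gt0 t : 0 < t -> 0 < v t.
Proof.
move=> t0; have [v0 vm _ _] := av.
rewrite lt0r v0 // andbT; apply/eqP => vt.
have [s [s0 vs]] : exists s, 0 < s /\ 0 < v s.
  apply: contrapT => N; move: Q0; rewrite -lte_fin -qv /quartic.
  rewrite (eq_integral (fun=> 0%E)) ?integral0 ?ltxx // => x.
  rewrite inE /= in_itv /= andbT => x0.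
  have -> : v x = 0; last by rewrite expr0n.
  apply/eqP; rewrite eq_le v0 // andbT leNgt; apply/negP => vx.
  by apply: N; exists x.
have st : s <= t.
  by rewrite leNgt; apply/negP => ts; have := vm _ _ t0 (ltW ts); rewrite vt leNgt vs.
have vt0 : v t <= 0 by rewrite vt.
have [T [sT vT posT]] := first_crossing cv s0 vs st vt0.
have T0 := lt_trans s0 sT.
have ln20 : 0 < ln 2 :> R by rewrite ln_gt0 // ltr1n.
have dsT : 0 < ln T - ln s by rewrite subr_gt0 ltr_ln ?posrE.
pose B := 2 * T + v s ^+ 2 * T / Q.
have B0 : 0 < B by rewrite ltr_wpDr ?mulr_gt0 // !mulr_ge0 ?sqr_ge0 ?invr_ge0 // ltW.
pose D := B + (ln 2)^-1 + (ln T - ln s)^-1.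
have i1 : 0 < (ln T - ln s)^-1 by rewrite invr_gt0.
have i2 : 0 < (ln 2)^-1 :> R by rewrite invr_gt0.
have D0 : 0 < D by rewrite /D; lra.
pose c := T * expR (- D^-1).
have c0 : 0 < c by rewrite mulr_gt0 ?expR_gt0.
have lnc : ln T - ln c = D^-1.
  by rewrite lnM ?posrE ?expR_gt0 // expRK; ring.
have cT : c < T by rewrite -ltr_ln ?posrE // -subr_gt0 lnc invr_gt0.
have sc : s < c.
  rewrite -ltr_ln ?posrE //; have : D^-1 < ln T - ln s.
    by rewrite -[ltRHS]invrK ltf_pV2 ?posrE // /D; lra.
  by rewrite -lnc; lra.
have := @cutoff_inequality c T c0 cT (posT _ sc cT) vT; rewrite lnc invrK.
have e0 := posT _ sc cT; have es := vm _ _ s0 (ltW sc).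
set e := v c in e0 es *; pose K := D - (ln 2)^-1.
rewrite -/K => F.
have KB : B < K by rewrite /K /D; lra.
have e20 : 0 < e ^+ 2 by rewrite exprn_gt0.
have e2s : e ^+ 2 <= v s ^+ 2 by rewrite ler_pXn2r ?nnegrE ?(ltW e0) ?(ltW vs).
have K0 : 0 < K by exact: lt_trans KB.
have F2 : Q * (e ^+ 2 * (K - 2 * T)) <= e ^+ 2 * (e ^+ 2 * T).
  have : 0 <= Q * (e ^+ 2 * K * (2 * T * e ^+ 2)).
    by rewrite !mulr_ge0 // ltW.
  have e4 : e ^+ 4 = e ^+ 2 * e ^+ 2 by rewrite -exprD.
  by move: F; rewrite e4; set E := e ^+ 2; lra.
have F3 : Q * (K - 2 * T) <= v s ^+ 2 * T.
  move: F2; rewrite mulrCA ler_pM2l // => /le_trans; apply.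
  by rewrite ler_pM2r.
have : K - 2 * T <= v s ^+ 2 * T / Q by rewrite ler_pdivlMr // mulrC.
by move: KB; rewrite /B; lra.
Qed.

End positivity.

(** * From the normalised problem to the weighted one *)

Section change_of_exponent.
Context {R : realType}.
Local Notation leb := (@lebesgue_measure R).
Local Notation pos := (`]0, +oo[%classic : set R).

(** The form u'^2 x dx is invariant under powers of x up to a factor, since these
    act on ln x by scaling. *)
Lemma energy_bound_powR (v G : R -> R) (M m : R) : 0 < m -> energy_bound v G M ->
  energy_bound (fun x => v (x `^ m)) (fun x => m * G (x `^ m)) (m * M).
Proof.
move=> m0 [GM Gm vG]; split => [x x0|x y x0 xy|x y x0 xy].
- have /andP[h1 h2] := GM (x `^ m) (powR_gt0 _ x0).
  by rewrite mulr_ge0 ?(ltW m0) //= ler_wpM2l // ltW.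
- have y0 : 0 < y := lt_le_trans x0 xy.
  rewrite ler_wpM2l ?(ltW m0) // Gm ?powR_gt0 //.
  by apply: ge0_ler_powR; rewrite ?nnegrE ?(ltW m0) ?(ltW x0) ?(ltW y0).
- have y0 : 0 < y := lt_le_trans x0 xy.
  have xym : x `^ m <= y `^ m by apply: ge0_ler_powR; rewrite ?nnegrE ?(ltW m0) ?(ltW x0) ?(ltW y0).
  apply: le_trans (vG _ _ (powR_gt0 _ x0) xym) _.
  rewrite !ln_powR le_eqVlt; apply/orP; left; apply/eqP; ring.
Qed.

(** The superlevel sets of v are intervals ]0, b[ and those of v (x ^ m) the
    intervals ]0, b ^ (1 / m)[, so that the distribution functions agree. *)
Lemma integral_powR_moment (v G : R -> R) (theta : R) (n : nat) : 0 <= theta ->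
  admissible v G ->
  (\int[leb]_(x in `]0%R, +oo[)
     (v (x `^ (1 + theta)) ^+ n.+1 * ((1 + theta) * x `^ theta))%:E =
   \int[leb]_(t in `]0%R, +oo[) (v t ^+ n.+1)%:E)%E.
Proof.
move=> th0 av; have [v0 vm ev _] := av; pose m := 1 + theta.
have m0 : 0 < m by rewrite /m; lra.
have cv := energy_continuous ev.
have cu := energy_continuous (energy_bound_powR m0 ev).
have mpow : measurable_fun pos (fun x => x `^ theta).
  by apply: measurable_fun_pos => x; exact: powR_continuous.
have w0 x : 0 < x -> 0 <= m * x `^ theta.
  by move=> _; apply: mulr_ge0; [exact: ltW|exact: powR_ge0].
have mw : measurable_fun pos (fun x => m * x `^ theta) by apply: measurable_funM.
transitivity (\int[leb]_(t in `]0%R, +oo[) (v t ^+ n.+1 * 1)%:E)%E; last first.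
  by apply: eq_integral => t _; rewrite mulr1.
apply: eq_level_mass_integral => //.
- exact: measurable_fun_pos.
- exact: measurable_fun_pos.
- by move=> x x0; rewrite v0 // powR_gt0.
move=> y y0.
have pw a b : 0 < a -> 0 < b -> (a `^ m < b) = (a < b `^ m^-1).
  move=> a0 b0; have i0 : 0 < m^-1 by rewrite invr_gt0.
  apply/idP/idP => h.
    have -> : a = (a `^ m) `^ m^-1 by rewrite -powRrM mulfV ?gt_eqF // powRr1 // ltW.
    by apply: gt0_ltr_powR; rewrite ?nnegrE ?powR_ge0 // ltW.
  have -> : b = (b `^ m^-1) `^ m by rewrite -powRrM mulVf ?gt_eqF // powRr1 // ltW.
  by apply: gt0_ltr_powR; rewrite ?nnegrE ?powR_ge0 // ltW.
have [[t0 [t00 yt0]]|N] := pselect (exists t0, 0 < t0 /\ y < v t0); last first.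
  rewrite /level_mass.
  rewrite (_ : _ `&` _ = set0) ?integral_set0; last first.
    apply/seteqP; split => // x [/=]; rewrite in_itv /= andbT => x0 yv.
    by apply: N; exists (x `^ m); rewrite powR_gt0.
  rewrite (_ : _ `&` _ = set0) ?integral_set0 //.
  apply/seteqP; split => // x [/=]; rewrite in_itv /= andbT => x0 yv.
  by apply: N; exists x.
have [t1 [t01 vt1]] : exists t1, t0 <= t1 /\ v t1 <= y.
  pose t1 := Num.max t0 (y ^- 2).
  have t10 : 0 < t1 by rewrite lt_max t00.
  exists t1; split; first by rewrite le_max lexx.
  rewrite -(@ler_pXn2r _ 2) ?nnegrE ?v0 ?(ltW y0) //.
  have := admissible_sqr_le av t10; rewrite mulrC -ler_pdivlMr // mul1r => /le_trans; apply.
  rewrite -[leRHS]invrK lef_pV2 ?posrE ?invr_gt0 ?exprn_gt0 //.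
  by rewrite le_max lexx orbT.
have [b [t0b vb bfirst]] := first_crossing cv t00 yt0 t01 vt1.
have b0 : 0 < b := lt_trans t00 t0b.
have vyE t : 0 < t -> (y < v t) = (t < b).
  move=> tp; apply/idP/idP => [|tb].
    by apply: contraTT; rewrite -!leNgt => bt; rewrite -vb vm.
  have [tt0|t0t] := leP t t0; last exact: bfirst.
  by apply: lt_le_trans yt0 _; exact: vm.
have e1 : pos `&` [set x | y < v x] = `]0, b[%classic.
  apply/seteqP; split => x /=; rewrite !in_itv /= andbT.
    by move=> [x0]; rewrite vyE // x0.
  by move=> /andP[x0 xb]; rewrite vyE.
have e2 : pos `&` [set x | y < v (x `^ m)] = `]0, b `^ m^-1[%classic.
  apply/seteqP; split => x /=; rewrite !in_itv /= andbT.
    by move=> [x0]; rewrite vyE ?powR_gt0 // x0 /= pw.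
  by move=> /andP[x0 xb]; rewrite vyE ?powR_gt0 // pw.
rewrite /level_mass e1 e2 [RHS](_ : _ = b%:E); last first.
  by rewrite integral_cst // mul1e /= lebesgue_measure_itv /= lte_fin b0 sube0.
rewrite integral_itv_bndo_bndc; last first.
  apply/measurable_EFinP; apply: measurable_funS mw => // x /=.
  by rewrite !in_itv /= andbT => /andP[].
have := @integral_powR_oc _ 1 theta _ ler01 th0 (powR_gt0 m^-1 b0).
under eq_integral do rewrite mul1r.
by move=> ->; rewrite mul1r -powRrM mulVf ?gt_eqF // powRr1 // ltW.
Qed.

End change_of_exponent.

Section energy_absolute_continuity.
Context {R : realType}.

(** By Young's inequality the variation of u over a family is at most a multiple l
    of its length plus the total increment of G divided by l. *)
Lemma energy_loc_abs_continuous (u G : R -> R) (M : R) :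
  energy_bound u G M -> loc_abs_continuous u.
Proof.
move=> [GM Gm uG] a b a0 ab e e0.
have M0 : 0 <= M by have /andP[] := GM _ a0; exact: le_trans.
pose l := (M + 1) / e; have l0 : 0 < l by rewrite divr_gt0 // ltr_wpDl.
exists (a * e / l) => [|n x y xy dis len].
  by rewrite divr_gt0 // mulr_gt0.
pose s := [seq (x i, y i) | i <- enum 'I_n & x i < y i].
have fs : family a b s.
  apply/andP; split.
    apply/allP => p /mapP[i _ ->] /=; have [-> -> ->] := xy i.
    by [].
  rewrite pairwise_map.
  apply: (@sub_in_pairwise _ [pred i | x i < y i] [rel i j | i != j]).
  - move=> i j; rewrite !inE => xi xj ij; rewrite /separated /=.
    rewrite leNgt [X in _ || X]leNgt -negb_and; apply/negP => /andP[ji ij'].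
    have := (trivIsetP.1 dis) i j I I ij; rewrite -subset0.
    pose c := (Num.max (x i) (x j) + Num.min (y i) (y j)) / 2.
    have mm : Num.max (x i) (x j) < Num.min (y i) (y j).
      by rewrite gt_max !lt_min xi xj ji ij'.
    have : Num.max (x i) (x j) < c /\ c < Num.min (y i) (y j) by rewrite /c; lra.
    rewrite gt_max lt_min => -[/andP[c1 c2] /andP[c3 c4]] /(_ c); apply.
    by split; rewrite /= in_itv /= ?c1 ?c2 ?c3 ?c4.
  - by apply/allP => i; rewrite mem_filter => /andP[].
  - by rewrite -uniq_pairwise filter_uniq // enum_uniq.
have sumE (f : R -> R -> R) : (forall z, f z z = 0) ->
    \sum_(i < n) f (x i) (y i) = \sum_(p <- s) f p.1 p.2.
  move=> f0; rewrite /s big_map big_filter big_enum_cond /= [RHS]big_mkcond /=.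
  apply: eq_bigr => i _; case: ifPn => //; rewrite -leNgt => yx.
  by have [_ h _] := xy i; rewrite (le_anti (introT andP (conj yx h))) f0.
have sG : increments (fun z => G (Num.max a z)) s <= M.
  apply: le_trans (increments_le (a := a) (b := b) _ (ltW ab) fs) _.
    move=> z z' zz'; apply: Gm; first by rewrite lt_max a0.
    by rewrite ge_max !le_max lexx /= zz' orbT.
  rewrite maxxx (max_idPr (ltW ab)).
  have /andP[h1 h2] := GM _ (lt_trans a0 ab); have /andP[h3 h4] := GM _ a0; lra.
have slen : increments id s < a * e / l.
  by rewrite /increments -(sumE (fun z z' => z' - z)) // => z; rewrite subrr.
rewrite (sumE (fun z z' => `|u z' - u z|)); last by move=> z; rewrite subrr normr0.
have le2 : \sum_(p <- s) `|u p.2 - u p.1| <=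
    (l / a * increments id s + increments (fun z => G (Num.max a z)) s / l) / 2.
  rewrite /increments mulr_sumr !mulr_suml -big_split mulr_suml /= !big_seq.
  apply: ler_sum => p ps; case/andP : fs => /allP /(_ _ ps) /and3P[ap pp pb] _.
  have p0 : 0 < p.1 := lt_le_trans a0 ap.
  rewrite (max_idPr ap) (max_idPr (le_trans ap pp)).
  have ln1 : ln p.2 - ln p.1 <= (p.2 - p.1) / a.
    have p20 : 0 < p.2 := lt_le_trans p0 pp.
    rewrite -ln_div ?posrE //.
    have -> : p.2 / p.1 = 1 + (p.2 - p.1) / p.1 by field; rewrite gt_eqF.
    apply: (@le_trans _ _ ((p.2 - p.1) / p.1)).
      by apply: le_ln1Dx; rewrite (lt_le_trans (ltrN10 _)) // divr_ge0 ?subr_ge0 // ltW.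
    by rewrite ler_wpM2l ?subr_ge0 // lef_pV2.
  have := @young_of_sqr_le_mul _ `|u p.2 - u p.1| (ln p.2 - ln p.1) (G p.2 - G p.1) l.
  rewrite normr_ge0 !subr_ge0 ln_mono // Gm // l0 real_normK ?num_real //.
  move=> /(_ isT isT isT isT (uG _ _ p0 pp)) h.
  have : l * (ln p.2 - ln p.1) <= l / a * (p.2 - p.1).
    by rewrite -mulrA (mulrC a^-1) ler_pM2l.
  by lra.
apply: le_lt_trans le2 _.
have h1 : l / a * increments id s < e.
  have la : 0 < l / a by exact: divr_gt0.
  rewrite -ltr_pdivlMl //.
  by rewrite (_ : (l / a)^-1 * e = a * e / l) // invf_div mulrAC.
have h2 : increments (fun z => G (Num.max a z)) s / l <= e.
  by rewrite ler_pdivrMr // /l mulrC divfK ?gt_eqF // (le_trans sG) // lerDl.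
by lra.
Qed.

End energy_absolute_continuity.

(** * Measurability of the derivative *)

Section measurable_derivative.
Context {R : realType}.
Local Notation leb := (@lebesgue_measure R).
Local Notation pos := (`]0, +oo[%classic : set R).

Let quotient (u : R -> R) (x h : R) : R := h^-1 * (u (h + x) - u x).

Let derivable_quotient (u : R -> R) (x : R) :
  derivable u x 1 <-> cvg (quotient u x h @[h --> 0^']).
Proof.
have E : (fun h : R => h^-1 *: ((u \o shift x) (h *: 1) - u x)) = quotient u x.
  by apply/funext => h; rewrite /quotient /= /GRing.scale /= mulr1.
by rewrite /derivable E.
Qed.

Lemma derive1_not_derivable (u : R -> R) (x : R) :
  ~ derivable u x 1 -> derive1 u x = 0.
Proof.
move=> /derivable_quotient nd; rewrite /derive1 /lim /lim_in getPN // => l Hl.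
by apply: nd; apply/cvg_ex; exists l.
Qed.

Lemma derive1_cvg (u : R -> R) (x : R) : derivable u x 1 ->
  n.+1%:R * (u (n.+1%:R^-1 + x) - u x) @[n --> \oo] --> derive1 u x.
Proof.
move=> /derivable_quotient du.
have c : quotient u x h @[h --> 0^'] --> derive1 u x by exact: du.
have := (cvg_at_rightP _ _ _).1 (cvg_dnbhs_at_right c) (fun n => n.+1%:R^-1).
rewrite /quotient => H; under eq_fun do rewrite -[X in X * _]invrK.
by apply: H; split; [move=> n; rewrite invr_gt0 | exact: cvg_harmonic].
Qed.

Variable u : R -> R.
Hypothesis cu : forall x : R, 0 < x -> {for x, continuous u}.

Let rational (k : nat) : R := ratr (odflt (0 : rat) (unpickle k)).

Let small (n : nat) (h : R) := (h != 0) && (`|h| < n.+1%:R^-1).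

(** Extended by 0, u is measurable on the whole line. *)
Let u0 := u \_ pos.

Let near_u0 (x : R) : 0 < x -> forall h, `|h| < x -> u0 (h + x) = u (h + x).
Proof.
move=> x0 h; rewrite ltr_norml => /andP[hx _].
by rewrite /u0 patchE mem_set //= in_itv /= andbT; lra.
Qed.

(** As u is continuous, rational increments decide on differentiability. This
    makes the set of points where u is differentiable a countable combination of
    measurable sets. *)
Let diff_cauchy (x : R) := forall j : nat, exists n : nat, forall k l : nat,
  small n (rational k) -> small n (rational l) ->
  `|quotient u0 x (rational k) - quotient u0 x (rational l)| <= j.+1%:R^-1.

Let quotient_continuous (x h : R) : 0 < x -> h != 0 -> `|h| < x ->
  {for h, continuous (quotient u x)}.
Proof.
move=> x0 h0 hx; apply: cvgM; first exact: inv_continuous.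
apply: cvgB; last exact: cvg_cst.
have hx0 : 0 < h + x by move: hx; rewrite ltr_norml => /andP[]; lra.
apply: (@continuous_comp _ _ _ (fun z => z + x) u); last exact: cu.
by apply: cvgD; [exact: cvg_id|exact: cvg_cst].
Qed.

Let rational_dense (a b : R) : a < b -> exists k, a < rational k < b.
Proof.
move=> /rat_in_itvoo[q]; rewrite in_itv /= => qab; exists (pickle q).
by rewrite /rational pickleK.
Qed.

Let approx (x h e : R) (n : nat) : 0 < x -> n.+1%:R^-1 < x -> small n h -> 0 < e ->
  exists k, small n (rational k) /\
    `|quotient u x h - quotient u0 x (rational k)| < e.
Proof.
move=> x0 nx /andP[h0 hn] e0; have hx := lt_trans hn nx.
have /cvgrPdist_lt /(_ _ e0) ch := quotient_continuous x0 h0 hx.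
have [d /= d0 H] : \forall z \near h, [/\ `|quotient u x h - quotient u x z| < e,
    z != 0 & `|z| < n.+1%:R^-1].
  near=> z; split; near: z => //.
  - by apply: open_nbhs_nbhs; split => //; exact: open_neq.
  - have : (fun z : R => `|z|) z @[z --> h] --> `|h| by apply: norm_continuous.
    move=> /cvgr_lt /(_ _ hn); exact.
have [k /andP[hk kd]] := @rational_dense h (h + d) (ltr_pwDr d0 (lexx h)).
have [|h1 h2 h3] := H (rational k) _; first by rewrite /= ltr_norml; lra.
exists k; split; first by rewrite /small h2.
rewrite /quotient (near_u0 x0 (lt_trans h3 nx)).
by rewrite {1}/u0 patchE mem_set //= in_itv /= x0.
Unshelve. all: by end_near. Qed.

Let derivable_cauchy (x : R) : 0 < x -> derivable u x 1 <-> diff_cauchy x.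
Proof.
move=> x0; rewrite derivable_quotient; split.
  move=> /cvg_ex[l /cvgrPdist_lt Hl] j.
  have e0 : 0 < j.+1%:R^-1 / 2 :> R by rewrite divr_gt0 // invr_gt0.
  have [d /= d0 H] := Hl _ e0.
  have m0 : 0 < Num.min d x by rewrite lt_min d0.
  exists (Num.truncn (Num.min d x)^-1) => k k'.
  have small_lt h : small (Num.truncn (Num.min d x)^-1) h ->
      `|l - quotient u0 x h| < j.+1%:R^-1 / 2.
    move=> /andP[h0 hn]; have : `|h| < Num.min d x.
      apply: lt_trans hn _; rewrite -[ltRHS]invrK ltf_pV2 ?posrE ?invr_gt0 //.
      exact: truncnS_gt.
    rewrite lt_min => /andP[hd hx]; rewrite /quotient (near_u0 x0 hx).
    rewrite [u0 x]/u0 patchE mem_set /=; last by rewrite in_itv /= x0.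
    by apply: H => //=; rewrite sub0r normrN.
  move=> /small_lt; set p := quotient _ _ _; move=> h1.
  move=> /small_lt; set q := quotient _ _ _; move=> h2.
  move: h1 h2; set i := j.+1%:R^-1; rewrite !ltr_norml ler_norml.
  by move=> /andP[? ?] /andP[? ?]; apply/andP; split; lra.
move=> D; apply: cauchy_cvg; apply: cauchy_exP => e e0.
pose j := Num.truncn (3 / e).
have je : j.+1%:R^-1 < e / 3.
  by rewrite -[ltRHS]invrK invf_div ltf_pV2 ?posrE ?divr_gt0 // truncnS_gt.
have [n0 Hn0] := D j.
pose n := maxn n0 (Num.truncn x^-1).
have nx : n.+1%:R^-1 < x.
  rewrite -[ltRHS]invrK ltf_pV2 ?posrE ?invr_gt0 //.
  by apply: lt_le_trans (truncnS_gt _) _; rewrite ler_nat ltnS leq_maxr.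
have sn h : small n h -> small n0 h.
  move=> /andP[h0 hn]; rewrite /small h0 /=; apply: lt_le_trans hn _.
  by rewrite lef_pV2 ?posrE // ler_nat ltnS leq_maxl.
have n2 : small n (n.+2%:R^-1).
  rewrite /small invr_neq0 ?pnatr_eq0 //= ger0_norm ?invr_ge0 //.
  by rewrite ltf_pV2 ?posrE // ltr_nat.
exists (quotient u x n.+2%:R^-1).
suff : \forall h \near (0 : R)^',
    `|quotient u x n.+2%:R^-1 - quotient u x h| < e by [].
near=> h.
have sh : small n h.
  have h0 : h != 0 by near: h; exact: nbhs_dnbhs_neq.
  by rewrite /small h0 /=; near: h; apply: dnbhs0_lt; rewrite invr_gt0.
have e3 : 0 < e / 3 by lra.
have [k [sk hk]] := approx x0 nx n2 e3.
have [k' [sk' hk']] := approx x0 nx sh e3.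
have := Hn0 k k' (sn _ sk) (sn _ sk'); move: hk hk' je.
set i := j.+1%:R^-1; rewrite !ltr_norml ler_norml.
by move=> /andP[? ?] /andP[? ?] ? /andP[? ?]; apply/andP; split; lra.
Unshelve. all: by end_near. Qed.

Lemma measurable_fun_derive1 : measurable_fun pos (derive1 u).
Proof.
have mpos : measurable pos by exact: measurable_itv.
have mu0 : measurable_fun setT u0.
  by apply/(measurable_restrictT _ _).1 => //; exact: measurable_fun_pos.
have mq h : measurable_fun pos (fun x => quotient u0 x h).
  apply: measurable_funM; first exact: measurable_cst.
  apply: measurable_funB; apply: measurable_funTS => //.
  apply: (measurableT_comp mu0); apply: measurable_funD => //.
pose B (j n k l : nat) : set R :=
  if small n (rational k) && small n (rational l) then
    pos `&` [set x | `|quotient u0 x (rational k) - quotient u0 x (rational l)| <= j.+1%:R^-1]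
  else pos.
have mB j n k l : measurable (B j n k l).
  rewrite /B; case: ifP => // _.
  have mf : measurable_fun pos
      (fun x => `|quotient u0 x (rational k) - quotient u0 x (rational l)| <= j.+1%:R^-1).
    apply: measurable_fun_ler => //; apply: measurableT_comp => //.
    exact: measurable_funB.
  exact: (mf mpos [set true] I).
pose D := pos `&` [set x | diff_cauchy x].
have mD : measurable D.
  rewrite (_ : D = \bigcap_j \bigcup_n \bigcap_k \bigcap_l B j n k l).
    apply: bigcapT_measurable => j; apply: bigcupT_measurable => n.
    by apply: bigcapT_measurable => k; exact: bigcapT_measurable.
  apply/seteqP; split => x.
    move=> [xp Dx] j _; have [n Hn] := Dx j; exists n => // k _ l _.
    rewrite /B; case: ifP => // /andP[sk sl]; split => //=; exact: Hn.
  move=> H; have xp : pos x.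
    by have [n _ /(_ 0%N I 0%N I)] := H 0%N I; rewrite /B; case: ifP => _ [].
  split => // j; have [n _ Hn] := H j I; exists n => k l sk sl.
  by have := Hn k I l I; rewrite /B sk sl => -[].
pose f (n : nat) (x : R) : R := n.+1%:R * (u0 (n.+1%:R^-1 + x) - u x) * \1_D x.
have mu : measurable_fun pos u by exact: measurable_fun_pos.
apply: (@measurable_fun_cvg _ _ _ pos f) => [n|x xp].
  apply: measurable_funM; last exact: measurable_indic.
  apply: measurable_funM; first exact: measurable_cst.
  apply: measurable_funB => //; apply: measurable_funTS => //.
  by apply: (measurableT_comp mu0); apply: measurable_funD.
have x0 : 0 < x by move: xp; rewrite /= in_itv /= andbT.
have [Dx|nDx] := pselect (diff_cauchy x); last first.
  rewrite derive1_not_derivable; last by move/(derivable_cauchy x0).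
  rewrite /f indicE memNset; last by move=> [].
  by under eq_fun do rewrite mulr0; exact: cvg_cst.
have du : derivable u x 1 by exact/(derivable_cauchy x0).
have := derive1_cvg du; apply: cvg_trans; apply: near_eq_cvg.
near=> n; rewrite /f indicE mem_set ?mulr1; last by split.
rewrite near_u0 // ger0_norm ?invr_ge0 //.
have h : (Num.truncn x^-1 <= n)%N by near: n; exact: nbhs_infty_ge.
rewrite -[ltRHS]invrK ltf_pV2 ?posrE ?invr_gt0 //.
by apply: lt_le_trans (truncnS_gt _) _; rewrite ler_nat ltnS.
Unshelve. all: by end_near. Qed.

End measurable_derivative.

(** * The Dirichlet integral of a function of bounded energy *)

Section dirichlet_integral.
Context {R : realType}.
Local Notation leb := (@lebesgue_measure R).
Local Notation pos := (`]0, +oo[%classic : set R).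

(** Translations preserve the lengths of intervals, hence Lebesgue measure. *)
Lemma integral_translation (f : R -> \bar R) (h : R) :
  measurable_fun setT f -> (forall x, (0 <= f x)%E) ->
  (\int[leb]_x f (x + h)%R = \int[leb]_x f x)%E.
Proof.
move=> mf f0.
have mh : measurable_fun [set: measurableTypeR R] (fun x : measurableTypeR R => x + h : measurableTypeR R).
  exact: measurable_funD.
pose phi (x : measurableTypeR R) : measurableTypeR R := x + h.
pose nu_ : {measure set (measurableTypeR R) -> \bar R} := pushforward leb phi.
pose nu := nu_ mh.
have E A : measurable A -> leb A = nu A.
  apply: lebesgue_measure_unique => X /ocitvP[->|[[a b] /= ab ->]].
    by rewrite !measure0.
  rewrite /nu /= /pushforward.
  rewrite (_ : _ @^-1` _ = `]a - h, b - h]%classic); last first.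
    by apply/seteqP; split => x; rewrite /phi /= !in_itv /= ltrBlDr lerBrDr.
  rewrite !lebesgue_measure_itv /= !lte_fin ab ltrD2r ab.
  by rewrite -!EFinB; congr EFin; ring.
transitivity (\int[nu]_x f x)%E.
  by rewrite /nu (ge0_integral_pushforward mh).
by apply: eq_measure_integral => A mA _; first [exact: E | symmetry; exact: E].
Qed.

(** Over ]0, N] the integral of the difference is at most that of G over
    ]N, N + h]. *)
Lemma integral_difference_le (G : R -> R) (M h : R) : 0 < h ->
  (forall x : R, 0 < x -> 0 <= G x <= M) ->
  (forall x y : R, 0 < x -> x <= y -> G x <= G y) ->
  measurable_fun pos G -> measurable_fun pos (fun x => G (x + h)) ->
  (\int[leb]_(x in `]0%R, +oo[) (G (x + h) - G x)%:E <= (h * M)%:E)%E.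
Proof.
move=> h0 GM Gm mG mGh.
have M0 : 0 <= M by have /andP[] := GM _ ltr01; exact: le_trans.
have gap x : 0 < x -> 0 <= G (x + h) - G x.
  by move=> x0; rewrite subr_ge0 Gm // lerDl ltW.
pose I (N : nat) : set R := `]0, N%:R]%classic.
have Ipos N : I N `<=` pos by move=> x; rewrite /I /= !in_itv /= andbT => /andP[].
have mI N : measurable (I N) by exact: measurable_itv.
have bound N : (\int[leb]_(x in I N) (G (x + h) - G x)%:E <= (h * M)%:E)%E.
  have mIN := mI N.
  have posx (c x : R) : `]0, c]%classic x -> 0 < x by rewrite /= in_itv /= => /andP[].
  have posI (x : R) : I N x -> 0 < x by exact: posx.
  have mGI (c : R) : measurable_fun (`]0, c]%classic : set R) (fun x => (G x)%:E).
    apply/measurable_EFinP; apply: measurable_funS mG => // x /posx.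
    by rewrite /= in_itv /= andbT.
  have intG : (\int[leb]_(x in I N) (G x)%:E)%E \is a fin_num.
    rewrite ge0_fin_numE; last first.
      by apply: integral_ge0 => x /posI /GM /andP[]; rewrite lee_fin.
    apply: le_lt_trans (_ : (\int[leb]_(x in I N) (cst M%:E) x < +oo)%E).
      apply: ge0_le_integral => //.
      - by move=> x /posI /GM /andP[]; rewrite lee_fin.
      - exact: mGI.
      - by move=> x /posI /GM /andP[]; rewrite lee_fin.
    rewrite integral_cst //= lebesgue_measure_itv /=; case: ifP => _.
      by rewrite sube0 -EFinM ltry.
    by rewrite mule0 ltry.
  have shift_le : (\int[leb]_(x in I N) (G (x + h))%:E <=
      \int[leb]_(x in I N) (G x)%:E + (h * M)%:E)%E.
    pose f : R -> \bar R := (EFin \o G) \_ `]h, (N%:R + h)%R].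
    have sub : `]h, (N%:R + h)%R]%classic `<=` pos.
      by move=> x /=; rewrite !in_itv /= andbT => /andP[/(lt_trans h0)].
    have f0 x : (0 <= f x)%E.
      apply: erestrict_ge0 => {}x /sub; rewrite /= in_itv /= andbT lee_fin.
      by move=> /GM /andP[].
    have mf : measurable_fun setT f.
      apply/(measurable_restrictT _ _).1; first exact: measurable_itv.
      by apply/measurable_EFinP; apply: measurable_funS mG.
    have -> : (\int[leb]_(x in I N) (G (x + h))%:E = \int[leb]_x f (x + h)%R)%E.
      rewrite integral_mkcond; apply: eq_integral => x _; rewrite /f !patchE.
      have -> : (x + h \in `]h, (N%:R + h)%R]%classic) = (x \in I N).
        by apply/idP/idP; rewrite !inE /I /= !in_itv /= => /andP[? ?];
          apply/andP; split; lra.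
      by [].
    rewrite integral_translation // /f -integral_mkcond.
    apply: (@le_trans _ _ (\int[leb]_(x in `]0%R, (N%:R + h)%R]) (G x)%:E)%E).
      apply: ge0_subset_integral => //.
      - exact: mGI.
      - by move=> x /posx /GM /andP[]; rewrite lee_fin.
      - by move=> x /=; rewrite !in_itv /= => /andP[hx ->]; rewrite (lt_trans h0).
    have e : `]0, (N%:R + h)%R]%classic = I N `|` `]N%:R, (N%:R + h)%R]%classic :> set R.
      by rewrite -itv_bndbnd_setU // bnd_simp // lerDl ltW.
    have posN x : `]N%:R, (N%:R + h)%R]%classic x -> 0 < x.
      by rewrite /= in_itv /= => /andP[+ _]; apply: le_lt_trans.
    rewrite e ge0_integral_setU //=; first last.
    - apply/disj_setPLR => x; rewrite /I /= !in_itv /= => /andP[_ xa].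
      by apply/negP; rewrite negb_and -leNgt xa.
    - by move=> x [/posI|/posN] /GM /andP[]; rewrite lee_fin.
    - by rewrite -e; exact: mGI.
    apply: leeD => //; apply: (@le_trans _ _
        (\int[leb]_(x in `]N%:R, (N%:R + h)%R]) (cst M%:E) x)%E).
      apply: ge0_le_integral => //.
      - by move=> x /posN /GM /andP[]; rewrite lee_fin.
      - apply/measurable_EFinP; apply: measurable_funS mG => // x /posN.
        by rewrite /= in_itv /= andbT.
      - by move=> x /posN /GM /andP[_]; rewrite lee_fin.
    rewrite integral_cst //= lebesgue_measure_itv /= lte_fin ltrDl h0.
    by rewrite -EFinB -EFinM lee_fin le_eqVlt; apply/orP; left; apply/eqP; ring.
  have split : (\int[leb]_(x in I N) (G (x + h))%:E =
      \int[leb]_(x in I N) (G (x + h) - G x)%:E + \int[leb]_(x in I N) (G x)%:E)%E.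
    rewrite -ge0_integralD //.
    - by apply: eq_integral => x _; rewrite -EFinD subrK.
    - by move=> x /posI /gap; rewrite lee_fin.
    - apply/measurable_EFinP; apply: measurable_funB.
        by apply: measurable_funS mGh.
      by apply: measurable_funS mG.
    - by move=> x /posI /GM /andP[]; rewrite lee_fin.
    - exact: mGI.
  by move: shift_le; rewrite split addeC leeD2lE.
have posU : pos = \bigcup_N I N.
  apply/seteqP; split => x; last by move=> [N _ /Ipos].
  rewrite /= in_itv /= andbT => x0; exists (Num.truncn x).+1 => //.
  by rewrite /I /= in_itv /= x0 ltW // truncnS_gt.
have c : (\int[leb]_(x in I N) (G (x + h) - G x)%:E)%E @[N --> \oo] -->
    (\int[leb]_(x in \bigcup_N I N) (G (x + h) - G x)%:E)%E.
  apply: ge0_nondecreasing_set_cvg_integral => //.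
  - move=> n m nm; apply/subsetPset => x; rewrite /I /= !in_itv /= => /andP[-> xn].
    by rewrite (le_trans xn) // ler_nat.
  - move=> N; apply/measurable_EFinP; apply: measurable_funB.
      by apply: measurable_funS mGh.
    by apply: measurable_funS mG.
  - by move=> N x /Ipos; rewrite /= in_itv /= andbT lee_fin; exact: gap.
rewrite posU -(cvg_lim _ c) //; apply: lime_le; first by apply/cvg_ex; eexists; exact: c.
by apply: nearW.
Qed.

(** The energy inequality bounds x (u (x + h) - u x) ^ 2 / h ^ 2 by
    (G (x + h) - G x) / h. Fatou's lemma applies as h tends to 0, since derive1 u is
    0 where the difference quotients do not converge. *)
Lemma energy_dirichlet_le (u G : R -> R) (M : R) : energy_bound u G M ->
  (\int[leb]_(x in `]0%R, +oo[) (derive1 u x ^+ 2 * x)%:E <= M%:E)%E.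
Proof.
move=> uG; have [GM Gm uE] := uG; have cu := energy_continuous uG.
pose h (n : nat) : R := n.+1%:R^-1.
have h0 n : 0 < h n by rewrite invr_gt0.
pose f (n : nat) (x : R) : R := (n.+1%:R * (u (h n + x) - u x)) ^+ 2 * x.
have mpos : measurable pos by exact: measurable_itv.
have mshift (n : nat) (g : R -> R) : (forall x : R, 0 < x -> {for x, continuous g}) ->
    measurable_fun pos (fun x => g (h n + x)).
  move=> cg; apply: measurable_fun_pos => x x0.
  apply: (@continuous_comp _ _ _ (fun z => h n + z) g); last by apply: cg; rewrite addr_gt0.
  by apply: cvgD; [exact: cvg_cst|exact: cvg_id].
have mu : measurable_fun pos u by exact: measurable_fun_pos.
have mf n : measurable_fun pos (EFin \o f n).
  apply/measurable_EFinP; apply: measurable_funM => //; apply: measurable_funX.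
  apply: measurable_funM; first exact: measurable_cst.
  by apply: measurable_funB => //; exact: mshift.
have f0 n x : pos x -> (0 <= (EFin \o f n) x)%E.
  by rewrite /= in_itv /= andbT lee_fin => /ltW x0; rewrite mulr_ge0 ?sqr_ge0.
(* G extended by 0 to the left of 0 is monotone, hence measurable. *)
have mG : measurable_fun [set: R] (G \_ pos).
  apply: nondecreasing_measurable => // x y xy; rewrite !patchE.
  case: ifPn => [|_]; case: ifPn => //; rewrite ?inE ?notin_setE /= ?in_itv /= ?andbT.
  - by move=> y0 x0; exact: Gm.
  - by move=> y0 x0; case: y0; exact: lt_le_trans xy.
  - by move=> y0; have /andP[] := GM _ y0.
have restrictE x : pos x -> (G \_ pos) x = G x by move=> xp; rewrite patchE mem_set.
have mGpos : measurable_fun pos G.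
  by apply: eq_measurable_fun (measurable_funTS mG) => x /set_mem; exact: restrictE.
have mGh n : measurable_fun pos (fun x => G (x + h n)).
  apply: (@eq_measurable_fun _ _ _ _ pos (fun x => (G \_ pos) (x + h n))).
    move=> x; rewrite inE /= in_itv /= andbT => x0; apply: restrictE.
    by rewrite /= in_itv /= andbT addr_gt0.
  by apply: measurable_funTS; apply: (measurableT_comp mG); exact: measurable_funD.
have bound n : (\int[leb]_(x in `]0%R, +oo[) (f n x)%:E <= M%:E)%E.
  apply: (@le_trans _ _ (\int[leb]_(x in `]0%R, +oo[)
      ((h n)^-1%:E * (G (x + h n) - G x)%:E))%E).
    apply: ge0_le_integral => //.
    - exact: f0.
    - exact: mf.
    - apply: emeasurable_funM; first exact: measurable_cst.
      apply/measurable_EFinP. exact: (measurable_funB (mGh n) mGpos).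
    - move=> x; rewrite /= in_itv /= andbT => x0.
      rewrite -EFinM lee_fin /f exprMn -mulrA /h invrK.
      rewrite [X in X * _ <= _]expr2 -mulrA ler_pM2l // -/(h n).
      have xh : x <= h n + x by rewrite lerDr ltW.
      have ln1 : ln (h n + x) - ln x <= h n / x.
        rewrite -ln_div ?posrE ?addr_gt0 //.
        have -> : (h n + x) / x = 1 + h n / x by rewrite mulrDl divff ?gt_eqF // addrC.
        apply: le_ln1Dx; rewrite (lt_le_trans (ltrN10 _)) // divr_ge0 // ltW //.
      have gg : 0 <= G (h n + x) - G x by rewrite subr_ge0 Gm.
      have := uE _ _ x0 xh => /le_trans /(_ (ler_wpM2r gg ln1)) K.
      rewrite -ler_pdivlMl // -/(h n) [x + h n]addrC.
      apply: le_trans (ler_wpM2r (ltW x0) K) _.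
      by rewrite le_eqVlt; apply/orP; left; apply/eqP; rewrite mulrAC divfK // gt_eqF.
  rewrite ge0_integralZl //=; last 3 first.
  - by apply/measurable_EFinP; exact: (measurable_funB (mGh n) mGpos).
  - move=> x; rewrite /= in_itv /= andbT => x0.
    by rewrite lee_fin subr_ge0 Gm // lerDl ltW.
  - by rewrite lee_fin invr_ge0 ltW.
  rewrite -[leRHS]mul1e -[1%E](_ : (h n)^-1%:E * (h n)%:E = _)%E; last first.
    by rewrite -EFinM mulVf // gt_eqF.
  rewrite -muleA; apply: lee_wpmul2l; first by rewrite lee_fin invr_ge0 ltW.
  by rewrite -EFinM; exact: integral_difference_le.
apply: (@le_trans _ _ (\int[leb]_(x in `]0%R, +oo[) limn_einf (fun n => (f n x)%:E))%E).
  apply: ge0_le_integral => //.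
  - move=> x; rewrite /= in_itv /= andbT => x0.
    by rewrite lee_fin mulr_ge0 ?sqr_ge0 // ltW.
  - apply/measurable_EFinP; apply: measurable_funM => //; apply: measurable_funX.
    exact: measurable_fun_derive1.
  - apply: measurableT_comp => //; apply: measurable_fun_limn_esup => n.
    by apply: measurableT_comp => //; exact: mf.
  - move=> x xp; have x0 : 0 < x by move: xp; rewrite /= in_itv /= andbT.
    have [du|nd] := pselect (derivable u x 1).
      have c : (f n x)%:E @[n --> \oo] --> (derive1 u x ^+ 2 * x)%:E.
        apply: cvg_EFin; first exact: nearW.
        apply: cvgM; last exact: cvg_cst.
        exact: cvg_pow (derive1_cvg du).
      by have [-> _] := cvg_limn_einf_sup c.
    rewrite derive1_not_derivable // expr0n mul0r limn_einf_lim.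
    apply: lime_ge; first exact: is_cvg_einfs.
    by apply: nearW => n; apply: le_ereal_inf_tmp => _ [k _ <-]; exact: f0.
apply: le_trans (fatou leb mpos mf f0) _.
rewrite limn_einf_lim; apply: lime_le; first exact: is_cvg_einfs.
apply: nearW => n; apply: le_trans (bound n).
by apply: ereal_inf_lbound; exists n => /=.
Qed.

End dirichlet_integral.

(** * The Gamma function and the weighted norms *)

Section weighted_norms.
Context {R : realType}.
Local Notation leb := (@lebesgue_measure R).
Local Notation pos := (`]0, +oo[%classic : set R).

Let gamma_integrand (s t : R) : R := t `^ (s - 1) * expR (- t).

Let gamma_integrand_continuous (s x : R) : 0 < x -> {for x, continuous (gamma_integrand s)}.
Proof.
move=> x0; apply: cvgM; first exact: powR_continuous.
apply: (@continuous_comp _ _ _ (fun z : R => - z) expR); last exact: continuous_expR.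
by apply: cvgN; exact: cvg_id.
Qed.

Let gamma_integrand_ge0 (s t : R) : 0 <= gamma_integrand s t.
Proof. by rewrite mulr_ge0 ?powR_ge0 ?expR_ge0. Qed.

Lemma Gamma1 : Gamma 1 = 1 :> R.
Proof.
rewrite /Gamma /Rintegral; pose F (t : R) : R := - expR (- t).
have dF (t : R) : 0 < t -> is_derive t 1 F (expR (- t)).
  move=> _; have d : is_derive t 1 (-%R : R -> R) (- 1) by exact: is_deriveN.
  have := is_derive1_comp (is_derive_expR (- t)) d.
  move=> /is_deriveN; rewrite mulrN1 opprK; exact.
have cexp (t : R) : {for t, continuous (fun z : R => expR (- z))}.
  apply: (@continuous_comp _ _ _ (fun z : R => - z) expR); last exact: continuous_expR.
  by apply: cvgN; exact: cvg_id.
rewrite (_ : (\int[_]_(x in _) _)%E = 1%:E) //.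
transitivity (\int[leb]_(t in `]0%R, +oo[) (expR (- t))%:E)%E.
  apply: eq_integral => t; rewrite inE /= in_itv /= andbT => t0.
  by rewrite subrr powRr0 mul1r.
rewrite (@FTC_0y _ (fun t => expR (- t)) F dF _ _ (- 1) 0) ?sub0r ?opprK //.
- apply: cvgN; apply: cvg_at_right_filter.
  by rewrite -[X in _ --> X]expR0 -[X in expR X](oppr0 R); exact: cexp.
- by rewrite -[X in _ --> X](oppr0 R); apply: cvgN; exact: cvgr_expR.
Qed.

(** The integrand is compared with a multiple of the integrable function
    [dominating]; a power of t is absorbed by the exponential series. *)
Let gamma_integrand_le (s : R) : 2^-1 <= s ->
  exists C : R, 0 <= C /\ forall t, 0 < t -> gamma_integrand s t <= C * dominating t.
Proof.
move=> s2; pose N := Num.truncn `|s - 1|; pose C : R := 8 * N.+3`!%:R.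
have f1 : 1 <= (N.+3`!)%:R :> R by rewrite ler1n fact_gt0.
exists C; split => [|t t0]; first by rewrite /C mulr_ge0 // (le_trans ler01).
have r0 : 0 < Num.sqrt t by rewrite sqrtr_gt0.
have rr : Num.sqrt t ^+ 2 = t by rewrite sqr_sqrtr // ltW.
have w0 : 0 < 2 * Num.sqrt t * (1 + Num.sqrt t) ^+ 2.
  by rewrite !mulr_gt0 ?exprn_gt0 // ltr_wpDl.
rewrite /dominating ler_pdivlMr // /C.
have [t1|/ltW t1] := leP t 1.
  have r1 : Num.sqrt t <= 1 by rewrite -sqrtr1 ler_wsqrtr.
  have h1 : gamma_integrand s t * Num.sqrt t <= 1.
    rewrite /gamma_integrand mulrAC -powR12_sqrt ?(ltW t0) // -powRD; last by rewrite (gt_eqF t0) implybT.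
    rewrite mulr_ile1 ?powR_ge0 ?expR_ge0 //; last by rewrite expR_le1 oppr_le0 ltW.
    rewrite -[leRHS](powRr0 t); apply: ger_powR; first by rewrite t0.
    by lra.
  have h2 : (1 + Num.sqrt t) ^+ 2 <= 4 by nra.
  have h3 := sqr_ge0 (1 + Num.sqrt t).
  have h4 : 0 <= gamma_integrand s t * Num.sqrt t.
    by apply: mulr_ge0; [exact: gamma_integrand_ge0|exact: ltW].
  have E (g r k : R) : g * (2 * r * k) = 2 * (g * r * k) by ring.
  rewrite E; have : gamma_integrand s t * Num.sqrt t * (1 + Num.sqrt t) ^+ 2 <= 1 * 4.
    exact: ler_pM.
  by lra.
have r1 : 1 <= Num.sqrt t by rewrite -sqrtr1 ler_wsqrtr.
have h1 : 2 * Num.sqrt t * (1 + Num.sqrt t) ^+ 2 <= 8 * t ^+ 2.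
  rewrite -[X in 8 * X ^+ 2]rr; set r := Num.sqrt t in r1 *.
  have h : (1 + r) ^+ 2 <= 4 * r ^+ 2 by nra.
  have h' : r <= r ^+ 2 by nra.
  have -> : 8 * (r ^+ 2) ^+ 2 = (2 * r ^+ 2) * (4 * r ^+ 2) by ring.
  by apply: ler_pM; rewrite ?sqr_ge0 //; lra.
have h2 : gamma_integrand s t * t ^+ 2 <= (N.+3`!)%:R.
  have e1 : t ^+ N.+3 / (N.+3`!)%:R <= expR t.
    by apply: le_trans (expR_ge1Dxn N.+2 (ltW t0)); rewrite lerDr.
  have p1 : t `^ (s - 1) <= t ^+ N.+1.
    rewrite -powR_mulrn ?(ltW t0) //; apply: ler_powR => //.
    by apply: le_trans (ler_norm _) _; apply: ltW; exact: truncnS_gt.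
  rewrite /gamma_integrand expRN mulrAC ler_pdivrMr ?expR_gt0 //.
  apply: (@le_trans _ _ (t ^+ N.+1 * t ^+ 2)).
    by rewrite ler_wpM2r ?sqr_ge0.
  by rewrite -exprD addn2 mulrC -ler_pdivrMr // (lt_le_trans ltr01 f1).
apply: le_trans (ler_wpM2l (gamma_integrand_ge0 s t) h1) _.
by rewrite mulrCA ler_pM2l.
Qed.

Lemma Gamma_gt0 (s : R) : 2^-1 <= s -> 0 < Gamma s.
Proof.
move=> s2; rewrite /Gamma /Rintegral.
have mg : measurable_fun pos (EFin \o gamma_integrand s).
  by apply/measurable_EFinP; apply: measurable_fun_pos => x; exact: gamma_integrand_continuous.
have g0 x : pos x -> (0 <= (EFin \o gamma_integrand s) x)%E.
  by move=> _; rewrite lee_fin gamma_integrand_ge0.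
apply: fine_gt0; apply/andP; split.
  apply: (@lt_le_trans _ _ (\int[leb]_(t in `]1%R, 2%R]) (cst (2^-1 * expR (- 2))%:E) t)%E).
    rewrite integral_cst //= lebesgue_measure_itv /= lte_fin ltr1n /=.
    rewrite -EFinB -EFinM lte_fin; apply: mulr_gt0; last by lra.
    by apply: mulr_gt0; [lra|exact: expR_gt0].
  have sub : `]1, 2]%classic `<=` pos.
    by move=> t; rewrite /= !in_itv /= andbT => /andP[+ _]; apply: lt_trans.
  apply: (@le_trans _ _ (\int[leb]_(t in `]1%R, 2%R]) (gamma_integrand s t)%:E)%E).
    apply: ge0_le_integral => //.
    - by move=> t _; rewrite lee_fin mulr_ge0 ?expR_ge0.
    - exact: measurable_funS mg.
    - move=> t; rewrite /= in_itv /= => /andP[t1 t2]; rewrite lee_fin.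
      apply: ler_pM; rewrite ?expR_ge0 //; last by rewrite ler_expR lerN2.
      have t0 : 0 < t by lra.
      apply: (@le_trans _ _ (t `^ (- 1))).
        by rewrite powRN powRr1 ?(ltW t0) // lef_pV2 ?posrE.
      by apply: ler_powR; [exact: ltW|lra].
  by apply: ge0_subset_integral => //; exact: measurable_itv.
have [C [C0 HC]] := gamma_integrand_le s2.
have mdom : measurable_fun pos (EFin \o dominating).
  by apply/measurable_EFinP; apply: measurable_fun_pos; exact: dominating_continuous.
apply: (@le_lt_trans _ _ (\int[leb]_(t in `]0%R, +oo[) (C%:E * (dominating t)%:E))%E).
  apply: ge0_le_integral => //.
  - by apply: emeasurable_funM => //; exact: measurable_cst.
  - by move=> t; rewrite /= in_itv /= andbT => t0; rewrite -EFinM lee_fin HC.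
rewrite ge0_integralZl //=; last by move=> t _; rewrite lee_fin dominating_ge0.
by rewrite integral_dominating mule1 ltry.
Qed.

Lemma omega1 : omega 1 = 2 * pi :> R.
Proof.
rewrite /omega -[1 + 1]/(2%:R) divff ?pnatr_eq0 // Gamma1 powRr1 ?pi_ge0 //.
by rewrite divr1.
Qed.

Lemma omega_gt0 (beta : R) : 0 <= beta -> 0 < omega beta.
Proof.
move=> b0; rewrite /omega; apply: divr_gt0; last by apply: Gamma_gt0; lra.
by apply: mulr_gt0 => //; apply: powR_gt0; exact: pi_gt0.
Qed.

Section even_exponent.
Variables (n : nat) (beta : R) (u : R -> R).
Hypotheses (n_even : ~~ odd n.+1) (beta_ge0 : 0 <= beta) (mu : measurable_fun pos u).

Let I : \bar R := (\int[leb]_(x in `]0%R, +oo[) (u x ^+ n.+1 * x `^ beta)%:E)%E.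

Let I_ge0 : (0 <= I)%E.
Proof.
apply: integral_ge0 => x _; rewrite lee_fin.
by apply: mulr_ge0; [exact: exprn_even_ge0|exact: powR_ge0].
Qed.

Let wnormE : wnorm n.+1%:R beta u = (((omega beta)%:E * I) `^ n.+1%:R^-1)%E.
Proof.
rewrite /wnorm -ge0_integralZl //; first last.
- by rewrite lee_fin ltW // omega_gt0.
- move=> x _; rewrite lee_fin.
  by apply: mulr_ge0; [exact: exprn_even_ge0|exact: powR_ge0].
- apply/measurable_EFinP; apply: measurable_funM; first exact: measurable_funX.
  by apply: measurable_fun_pos => x; exact: powR_continuous.
congr (_ `^ _)%E; apply: eq_integral => x _.
rewrite powR_mulrn // -normrX ger0_norm ?exprn_even_ge0 // -EFinM.
by congr EFin; ring.
Qed.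

Lemma wnorm_expn : (wnorm n.+1%:R beta u ^+ n.+1 = (omega beta)%:E * I)%E.
Proof.
rewrite wnormE; have : (0 <= (omega beta)%:E * I)%E.
  by apply: mule_ge0 => //; rewrite lee_fin ltW // omega_gt0.
case: ((omega beta)%:E * I)%E => [r r0||] //.
  rewrite poweR_EFin -EFin_expe -powR_mulrn ?powR_ge0 // -powRrM mulVf ?pnatr_eq0 //.
  by rewrite powRr1.
move=> _; rewrite poweRyr ?invr_neq0 ?pnatr_eq0 //.
by elim: (n) => [|k IH]; rewrite expeS ?expe0 ?mule1 // IH.
Qed.

Lemma wLebesgueP : wLebesgue n.+1%:R beta u <-> (I < +oo)%E.
Proof.
have w0 := omega_gt0 beta_ge0; rewrite /wLebesgue wnormE; split.
  move=> [_ /lty_poweRy]; rewrite invr_neq0 ?pnatr_eq0 // => /(_ isT).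
  have := I_ge0; case: (I) => [r _ _||//]; first exact: ltry.
  by move=> _; rewrite mulry gtr0_sg // mul1e.
have := I_ge0; case: (I) => [r _ _|_|//]; last by rewrite ltxx.
by split=> //; apply: poweR_lty; rewrite -EFinM ltry.
Qed.
End even_exponent.

End weighted_norms.

(** * The sharp constant *)

Section sharp_constant.
Context {R : realType}.
Local Notation leb := (@lebesgue_measure R).
Local Notation pos := (`]0, +oo[%classic : set R).

Lemma integral_gt0_of_continuous (f : R -> R) (x : R) :
  (forall x, 0 < x -> {for x, continuous f}) -> (forall x, 0 < x -> 0 <= f x) ->
  0 < x -> 0 < f x -> (0 < \int[leb]_(x in `]0%R, +oo[) (f x)%:E)%E.
Proof.
move=> cf f0 x0 fx.
have mf : measurable_fun pos (EFin \o f).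
  by apply/measurable_EFinP; exact: measurable_fun_pos.
have /cvgrPdist_lt /(_ (f x / 2)) := cf x x0.
rewrite divr_gt0 // => /(_ isT) [d /= d0 near_x].
have sub : `]x, (x + d)%R[%classic `<=` pos.
  by move=> t; rewrite /= !in_itv /= andbT => /andP[+ _]; exact: lt_trans.
have fge0 t : pos t -> (0 <= (EFin \o f) t)%E.
  by rewrite /= in_itv /= andbT lee_fin; exact: f0.
apply: (@lt_le_trans _ _ (\int[leb]_(t in `]x, (x + d)%R[) (cst (f x / 2)%:E) t)%E).
  rewrite integral_cst //= lebesgue_measure_itv /= lte_fin ltrDl d0.
  by rewrite -EFinB -EFinM lte_fin addrAC subrr add0r mulr_gt0 // divr_gt0.
apply: (@le_trans _ _ (\int[leb]_(t in `]x, (x + d)%R[) (f t)%:E)%E).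
  apply: ge0_le_integral => //.
  - by move=> t _; rewrite lee_fin divr_ge0 // ltW.
  - exact: measurable_funS mf.
  - move=> t; rewrite /= in_itv /= => /andP[t1 t2]; rewrite lee_fin.
    have : `|f x - f t| < f x / 2.
      by apply: near_x; rewrite /= ltr_norml; apply/andP; split; lra.
    by rewrite ltr_norml => /andP[_]; lra.
by apply: ge0_subset_integral => //; exact: measurable_itv.
Qed.

Lemma energy_bound_norm (u G : R -> R) (M : R) : energy_bound u G M ->
  energy_bound (fun x => `|u x|) G M.
Proof.
move=> [GM Gm uG]; split => // x y x0 xy; apply: le_trans (uG x y x0 xy).
rewrite -[leRHS]real_normK ?num_real // -[leLHS]real_normK ?num_real //.
by rewrite ler_pXn2r ?nnegrE // ler_dist_dist.
Qed.

(** Without energy u is constant, hence equal to its limit. *)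
Lemma energy_bound_gt0 (u G : R -> R) (M : R) : energy_bound u G M ->
  u x @[x --> +oo] --> (0 : R) -> nonzero u -> 0 < M.
Proof.
move=> [GM Gm uG] u_cvg [x x0 ux]; have /andP[G0 GxM] := GM x x0.
rewrite lt0r (le_trans G0 GxM) andbT; apply: contra_neq ux => M0.
have G_eq0 (y : R) : 0 < y -> G y = 0.
  by move=> y0; have := GM y y0; rewrite M0 => /andP[? ?]; lra.
have u_eq y : x <= y -> u y = u x.
  move=> xy; have := uG _ _ x0 xy.
  rewrite !G_eq0 ?(lt_le_trans x0 xy) // subrr mulr0 => h.
  by apply/eqP; rewrite -subr_eq0 -sqrf_eq0 eq_le h sqr_ge0.
have <- : lim (u y @[y --> +oo]) = 0 by exact: cvg_lim.
apply/esym/cvg_lim => //; apply: cvg_near_cst.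
by near=> y; apply: u_eq; near: y; apply: nbhs_pinfty_ge; rewrite num_real.
Unshelve. all: by end_near. Qed.

Variable theta : R.
Hypothesis theta_ge0 : 0 <= theta.

(** The constant omega theta occurs to the same power in the numerator and in
    the denominator. *)
Lemma GN_quotientE (u : R -> R) (D a q : R) :
  measurable_fun pos u -> measurable_fun pos (derive1 u) -> 0 < q ->
  (\int[leb]_(x in `]0%R, +oo[) (derive1 u x ^+ 2 * x)%:E = D%:E)%E ->
  (\int[leb]_(x in `]0%R, +oo[) (u x ^+ 2 * x `^ theta)%:E = a%:E)%E ->
  (\int[leb]_(x in `]0%R, +oo[) (u x ^+ 4 * x `^ theta)%:E = q%:E)%E ->
  GN_quotient theta u = (2 * pi * (D * a / q))%:E.
Proof.
move=> mu mdu q0 iD ia iq; have w0 := @omega_gt0 R _ theta_ge0.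
rewrite /GN_quotient (wnorm_expn (n := 1)) // (wnorm_expn (n := 1)) //.
rewrite (wnorm_expn (n := 3)) // omega1 ia iq.
have -> : (\int[leb]_(x in `]0%R, +oo[) (derive1 u x ^+ 2 * x `^ 1)%:E = D%:E)%E.
  rewrite -iD; apply: eq_integral => x; rewrite inE /= in_itv /= andbT => x0.
  by rewrite powRr1 // ltW.
rewrite -!EFinM inver (gt_eqF (mulr_gt0 w0 q0)). rewrite -EFinM; congr EFin.
by field; rewrite !gt_eqF.
Qed.

Variable Q : R.
Hypothesis quartic_le : forall v G : R -> R, admissible v G -> (quartic v <= Q%:E)%E.

(** The weighted inequality is applied to |u|, which has no more energy than u. *)
Lemma GN_quotient_ge (u : R -> R) : 0 < Q -> W12 theta u -> nonzero u ->
  ((2 * pi * ((1 + theta) / Q))%:E <= GN_quotient theta u)%E.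
Proof.
move=> Q0 [acu L2u L2du u_cvg] nzu.
have m0 : 0 < 1 + theta by rewrite ltr_pwDl.
have [mu _] := L2u; have [mdu _] := L2du.
have fin_int (f : R -> R) : (forall x, 0 < x -> 0 <= f x) ->
    (\int[leb]_(x in `]0%R, +oo[) (f x)%:E < +oo)%E ->
    exists r : R, (\int[leb]_(x in `]0%R, +oo[) (f x)%:E = r%:E)%E.
  move=> f0 h; exists (fine (\int[leb]_(x in `]0%R, +oo[) (f x)%:E)%E).
  rewrite fineK // ge0_fin_numE //; apply: integral_ge0 => x.
  by rewrite /= in_itv /= andbT lee_fin; exact: f0.
have [D iD] : exists D : R, (\int[leb]_(x in `]0%R, +oo[) (derive1 u x ^+ 2 * x)%:E = D%:E)%E.
  apply: fin_int => [x x0|]; first by rewrite mulr_ge0 ?sqr_ge0 // ltW.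
  have /(wLebesgueP (n := 1) _ _ mdu) h := L2du.
  apply: le_lt_trans (h _ _) => //; rewrite le_eqVlt; apply/orP; left; apply/eqP.
  apply: eq_integral => x; rewrite inE /= in_itv /= andbT => x0.
  by rewrite powRr1 // ltW.
have [a ia] : exists a : R, (\int[leb]_(x in `]0%R, +oo[) (u x ^+ 2 * x `^ theta)%:E = a%:E)%E.
  apply: fin_int => [x x0|]; first by rewrite mulr_ge0 ?sqr_ge0 ?powR_ge0.
  have /(wLebesgueP (n := 1) _ _ mu) h := L2u; exact: h.
have [G uG] := abs_continuous_energy acu mdu iD.
have cu := energy_continuous uG.
have D0 := energy_bound_gt0 uG u_cvg nzu.
have moment_gt0 (n : nat) : ~~ odd n -> (0 < \int[leb]_(x in `]0%R, +oo[) (u x ^+ n * x `^ theta)%:E)%E.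
  move=> nodd; have [x x0 ux] := nzu.
  apply: (@integral_gt0_of_continuous _ x) => //.
  - move=> y y0; apply: cvgM; last exact: powR_continuous.
    exact: cvg_pow (cu y y0).
  - by move=> y _; rewrite mulr_ge0 ?powR_ge0 // exprn_even_ge0.
  - by rewrite mulr_gt0 ?powR_gt0 // exprn_even_gt0 // ux orbT.
have a0 : 0 < a by rewrite -lte_fin -ia; exact: moment_gt0.
have q_le : (\int[leb]_(x in `]0%R, +oo[) (u x ^+ 4 * x `^ theta)%:E <=
    (Q * (D * a / (1 + theta)))%:E)%E.
  have := @quartic_weighted_le _ Q quartic_le theta _ _ D a theta_ge0
    (energy_bound_norm uG) D0 a0.
  under [X in (_ -> _ -> (X <= _)%E -> _)]eq_integral do rewrite real_normK ?num_real //.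
  under [X in (_ -> _ -> _ -> (X <= _)%E)]eq_integral do
    rewrite -normrX (ger0_norm (exprn_even_ge0 _ _)) //.
  apply => //; last by rewrite ia.
  by rewrite -[X in _ --> X](normr0 R); apply: cvg_norm.
have [q iq] : exists q : R, (\int[leb]_(x in `]0%R, +oo[) (u x ^+ 4 * x `^ theta)%:E = q%:E)%E.
  apply: fin_int => [x x0|]; first by rewrite mulr_ge0 ?powR_ge0 // exprn_even_ge0.
  exact: le_lt_trans q_le (ltry _).
have q0 : 0 < q by rewrite -lte_fin -iq; exact: moment_gt0.
move: q_le; rewrite iq lee_fin => q_le.
rewrite (GN_quotientE mu mdu q0 iD ia iq) lee_fin.
rewrite ler_pM2l ?mulr_gt0 ?pi_gt0 // ler_pdivlMr // mulrAC ler_pdivrMr // mulrC.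
by rewrite -ler_pdivlMr // mulrAC [leRHS]mulrC.
Qed.

Variables v G : R -> R.
Hypothesis av : admissible v G.
Hypothesis qv : quartic v = Q%:E.
Hypothesis Q0 : 0 < Q.

(* The power of x turns x ^ theta dx into a multiple of Lebesgue measure. *)
Let u (x : R) : R := v (x `^ (1 + theta)).

Let m0 : 0 < 1 + theta. Proof. by rewrite ltr_pwDl. Qed.

Let uG : energy_bound u (fun x => (1 + theta) * G (x `^ (1 + theta))) ((1 + theta) * 1).
Proof. by have [_ _ vG _] := av; exact: energy_bound_powR. Qed.

Let mu : measurable_fun pos u.
Proof. by apply: measurable_fun_pos; exact: energy_continuous uG. Qed.

Let mdu : measurable_fun pos (derive1 u).
Proof. by apply: measurable_fun_derive1; exact: energy_continuous uG. Qed.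

Let moment (n : nat) : ~~ odd n.+1 ->
  (\int[leb]_(x in `]0%R, +oo[) (u x ^+ n.+1 * x `^ theta)%:E =
   (1 + theta)^-1%:E * \int[leb]_(t in `]0%R, +oo[) (v t ^+ n.+1)%:E)%E.
Proof.
move=> nodd; have [v0 _ _ _] := av.
rewrite -(integral_powR_moment n theta_ge0 av) -ge0_integralZl //.
- apply: eq_integral => x _; rewrite -EFinM; congr EFin.
  by rewrite /u; field; rewrite gt_eqF.
- apply/measurable_EFinP; apply: measurable_funM; first exact: measurable_funX.
  apply: measurable_funM; first exact: measurable_cst.
  by apply: measurable_fun_pos => x; exact: powR_continuous.
- move=> x _; rewrite lee_fin; apply: mulr_ge0; first exact: exprn_even_ge0.
  by apply: mulr_ge0; [exact: ltW|exact: powR_ge0].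
- by rewrite lee_fin invr_ge0 ltW.
Qed.

Let moment2_le : (\int[leb]_(x in `]0%R, +oo[) (u x ^+ 2 * x `^ theta)%:E <=
  (1 + theta)^-1%:E)%E.
Proof.
have [_ _ _ v2] := av; rewrite moment //.
rewrite -[leRHS]mule1; apply: lee_wpmul2l => //.
by rewrite lee_fin invr_ge0 ltW.
Qed.

Let u_cvg0 : u x @[x --> +oo] --> (0 : R).
Proof.
have [v0 _ _ _] := av; apply/cvgrPdist_le => e e0; near=> x.
have x0 : 0 < x by near: x; apply: nbhs_pinfty_gt; rewrite num_real.
have xm : 0 < x `^ (1 + theta) by exact: powR_gt0.
rewrite sub0r normrN ger0_norm /u ?v0 //.
rewrite -(@ler_pXn2r _ 2) ?nnegrE ?v0 ?(ltW e0) //.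
have := admissible_sqr_le av xm; rewrite mulrC -ler_pdivlMr // mul1r => /le_trans; apply.
rewrite -[leRHS]invrK lef_pV2 ?posrE ?invr_gt0 ?exprn_gt0 //.
have x1 : 1 <= x by near: x; apply: nbhs_pinfty_ge; rewrite num_real.
apply: (@le_trans _ _ x); first by near: x; apply: nbhs_pinfty_ge; rewrite num_real.
by rewrite -[leLHS]powRr1 ?(ltW x0) // ler_powR // lerDl.
Unshelve. all: by end_near. Qed.

Lemma maximizer_W12 : W12 theta u.
Proof.
split => //.
- exact: energy_loc_abs_continuous uG.
- apply/(wLebesgueP (n := 1)) => //.
  exact: le_lt_trans moment2_le (ltry _).
- apply/(wLebesgueP (n := 1)) => //.
  apply: le_lt_trans (ltry ((1 + theta) * 1)); apply: le_trans (energy_dirichlet_le uG).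
  rewrite le_eqVlt; apply/orP; left; apply/eqP.
  apply: eq_integral => x; rewrite inE /= in_itv /= andbT => x0.
  by rewrite powRr1 // ltW.
Qed.

Lemma GN_quotient_maximizer_le :
  (GN_quotient theta u <= (2 * pi * ((1 + theta) / Q))%:E)%E.
Proof.
have iq : (\int[leb]_(x in `]0%R, +oo[) (u x ^+ 4 * x `^ theta)%:E = (Q / (1 + theta))%:E)%E.
  by rewrite moment // -/(quartic v) qv -EFinM mulrC.
have fin_int (f : R -> R) (c : R) : (forall x, 0 < x -> 0 <= f x) ->
    (\int[leb]_(x in `]0%R, +oo[) (f x)%:E <= c%:E)%E ->
    exists2 r : R, (\int[leb]_(x in `]0%R, +oo[) (f x)%:E = r%:E)%E & 0 <= r <= c.
  move=> f0 h; have i0 : (0 <= \int[leb]_(x in `]0%R, +oo[) (f x)%:E)%E.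
    by apply: integral_ge0 => x; rewrite /= in_itv /= andbT lee_fin; exact: f0.
  exists (fine (\int[leb]_(x in `]0%R, +oo[) (f x)%:E)%E).
    by rewrite fineK // ge0_fin_numE //; exact: le_lt_trans h (ltry _).
  have E : (fine (\int[leb]_(x in `]0%R, +oo[) (f x)%:E)%E)%:E =
      (\int[leb]_(x in `]0%R, +oo[) (f x)%:E)%E.
    by rewrite fineK // ge0_fin_numE //; exact: le_lt_trans h (ltry _).
  by rewrite -!lee_fin E i0.
have [D iD /andP[D0 Dm]] := fin_int _ _ (fun x x0 => mulr_ge0 (sqr_ge0 (derive1 u x)) (ltW x0)) (energy_dirichlet_le uG).
have [a ia /andP[a0 am]] := fin_int _ _ (fun x _ => mulr_ge0 (sqr_ge0 (u x)) (powR_ge0 x theta)) moment2_le.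
rewrite (GN_quotientE mu mdu (divr_gt0 Q0 m0) iD ia iq) lee_fin.
rewrite ler_pM2l ?mulr_gt0 ?pi_gt0 // invf_div ler_piMl ?divr_ge0 ?(ltW m0) ?(ltW Q0) //.
by have := ler_pM D0 a0 Dm am; rewrite mulr1 divff ?lt0r_neq0.
Qed.

End sharp_constant.

Theorem proposition7p1 (R : realType) (theta : R) (theta_ge0 : 0 <= theta) :
  (exists u : R -> R,
    [/\ W12 theta u,
        (forall x : R, 0 < x -> 0 < u x),
        (forall x y : R, 0 < x -> x <= y -> u y <= u x) &
        GN_quotient theta u = GN_inf theta]) /\
  (GN_inf theta < (pi * (1 + theta))%:E)%E.
Proof.
have [v [G [av qv_fin max_v]]] := @quartic_maximizer R.
pose Q := fine (quartic v); have qv : quartic v = Q%:E by rewrite fineK.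
have quartic_le (v' G' : R -> R) : admissible v' G' -> (quartic v' <= Q%:E)%E.
  by rewrite -qv; exact: max_v.
have Q2 := quartic_bound_gt2 quartic_le; have Q0 : 0 < Q by lra.
have m0 : 0 < 1 + theta by lra.
pose u (x : R) : R := v (x `^ (1 + theta)).
have u0 (x : R) : 0 < x -> 0 < u x.
  by move=> x0; apply: (maximizer_gt0 quartic_le av qv Q0); exact: powR_gt0.
have Wu : W12 theta u by exact: maximizer_W12 av.
have nzu : nonzero u by exists 1 => //; rewrite gt_eqF // u0.
have u_le := GN_quotient_maximizer_le theta_ge0 av qv Q0.
have inf_le : (GN_inf theta <= GN_quotient theta u)%E.
  by apply: ereal_inf_lbound; exists u.
have inf_ge : ((2 * pi * ((1 + theta) / Q))%:E <= GN_inf theta)%E.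
  apply: le_ereal_inf_tmp => _ [w [Ww nzw] <-].
  exact: (GN_quotient_ge theta_ge0 quartic_le Q0 Ww nzw).
split.
  exists u; split => // [x y x0 xy|].
    have [_ vm _ _] := av; apply: vm; first exact: powR_gt0.
    by apply: ge0_ler_powR; rewrite ?nnegrE ?(ltW m0) ?(ltW x0) ?(le_trans (ltW x0)).
  by apply/le_anti; rewrite inf_le (le_trans u_le inf_ge).
apply: le_lt_trans (le_trans inf_le u_le) _.
have -> : 2 * pi * ((1 + theta) / Q) = pi * (1 + theta) * (2 / Q) by ring.
rewrite lte_fin gtr_pMr; last by apply: mulr_gt0 => //; exact: pi_gt0.
by rewrite ltr_pdivrMr // mul1r.
Qed.
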